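(* (Rate form of energy balance.) Let $\mathbf{u}\in C^2([0,T];X)$ be the solution of $$\rho\,\ddot{\mathbf{u}}(t,\mathbf{x})+\mathcal{L}^\epsilon[\mathbf{u}](t,\mathbf{x})=\mathbf{b}(t,\mathbf{x}),\qquad \mathbf{u}(0)=\mathbf{u}_0,\quad \dot{\mathbf{u}}(0)=\mathbf{v}_0,$$ with $\mathbf{u}_0,\mathbf{v}_0\in X$ and $\mathbf{b}\in C([0,T];X)$. Then $$\partial_t\mathcal{K}(t)+\partial_t\mathcal{E}^\epsilon(t)+\partial_t\mathcal{D}^\epsilon(t)=\int_\Omega\mathbf{b}(t)\cdot\dot{\mathbf{u}}(t)\,d\mathbf{x}$$ for every $t\in[0,T]$ when $\gamma$ is the degradation factor (a) of the context, and for almost every $t\in[0,T]$ when $\gamma$ is the degradation factor (b).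
   Context: Let $d\in\{2,3\}$, $\Omega\subset\mathbb{R}^d$ a bounded domain, $T>0$, $\epsilon>0$ and $\rho>0$ constants. Put $H_\epsilon(\mathbf{x})=\{\mathbf{y}:|\mathbf{y}-\mathbf{x}|<\epsilon\}$, let $\omega_d$ be the volume of the unit ball of $\mathbb{R}^d$ and $V_d^\epsilon=\omega_d\epsilon^d$. Function space: $\mathcal{U}=\{\mathbf{w}:\mathbf{w}(\mathbf{x})=\mathbb{Q}\mathbf{x}+\mathbf{c},\ \mathbb{Q}\in\mathbb{R}^{d\times d},\ \mathbb{Q}^T=-\mathbb{Q},\ \mathbf{c}\in\mathbb{R}^d\}$, and $X=\{\mathbf{u}\in L^\infty(\Omega;\mathbb{R}^d):\int_\Omega\mathbf{u}\cdot\mathbf{w}\,d\mathbf{x}=0\ \text{for all }\mathbf{w}\in\mathcal{U}\}$ with the $L^\infty$ norm. Kernel: $\rho^\epsilon(\mathbf{y},\mathbf{x})=\chi_\Omega(\mathbf{y})J(|\mathbf{y}-\mathbf{x}|/\epsilon)/(\epsilon V_d^\epsilon)$, where $J:[0,\infty)\to[0,\infty)$ is decreasing, positive on $[0,1)$, with $J(0)=M<\infty$ and $J=0$ on $[1,\infty)$. Strain: $\mathbf{e}=(\mathbf{y}-\mathbf{x})/|\mathbf{y}-\mathbf{x}|$, $S(\mathbf{y},\mathbf{x},\mathbf{u}(t))=\frac{\mathbf{u}(t,\mathbf{y})-\mathbf{u}(t,\mathbf{x})}{|\mathbf{y}-\mathbf{x}|}\cdot\mathbf{e}$, and $r(t,\mathbf{u})=\sqrt{|\mathbf{y}-\mathbf{x}|}\,S(\mathbf{y},\mathbf{x},\mathbf{u}(t))$.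 Potential: there are constants $r^-<r^e<0<r^c<r^+$; $g:\mathbb{R}\to\mathbb{R}$ is $C^2$, with $g',g''$ bounded, $g=C^-$ for $r\le r^-$, $g=C^+$ for $r\ge r^+$; $g$ is convex on $[r^e,r^c]$ and concave on $[r^-,r^e]$ and on $[r^c,r^+]$. Degradation factor, one of the following: (a) $\gamma(\mathbf{u})(\mathbf{y},\mathbf{x},t)=h\big(\int_0^t(r(\tau,\mathbf{u})-r^+)^+\,d\tau\big)$, where $(\cdot)^+$ is the positive part and $h\ge 0$ is smooth, equal to $1$ for negative arguments, decreasing to zero on $[0,x^D)$, and zero on $[x^D,\infty)$, for some $x^D>0$; (b) $\gamma(\mathbf{u})(\mathbf{y},\mathbf{x},t)=h\big(\sqrt{|\mathbf{y}-\mathbf{x}|}\,S^*(t,\mathbf{y},\mathbf{x},\mathbf{u})\big)$, where $S^*(t,\mathbf{y},\mathbf{x},\mathbf{u})=\max_{0\le\tau\le t}S(\mathbf{y},\mathbf{x},\mathbf{u}(\tau))$ and $h\ge0$ is smooth, equal to $1$ on $(-\infty,r^+]$, decreasing to zero on $[r^+,r^D]$, and zero on $[r^D,\infty)$, for some $r^D>r^+$. (In case (b), for the solution $\mathbf u$, $\gamma(\mathbf u)(\mathbf y,\mathbf x,\cdot)$ is Lipschitz in time and $\partial_t\gamma$ is its a.e. derivative.) Force density: $\mathcal{L}^\epsilon[\mathbf{u}](t,\mathbf{x})=-\int_\Omega\frac{2\rho^\epsilon(\mathbf{y},\mathbf{x})}{\sqrt{|\mathbf{y}-\mathbf{x}|}}\,\gamma(\mathbf{u})(\mathbf{y},\mathbf{x},t)\,g'(r(t,\mathbf{u}))\,\mathbf{e}\,d\mathbf{y}$.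 Energies: kinetic $\mathcal{K}(t)=\int_\Omega\rho\frac{|\dot{\mathbf{u}}(t)|^2}{2}d\mathbf{x}$; elastic $\mathcal{E}^\epsilon(t)=\int_\Omega\int_\Omega\rho^\epsilon(\mathbf{y},\mathbf{x})\gamma(\mathbf{u})(\mathbf{y},\mathbf{x},t)g(r(t,\mathbf{u}))\,d\mathbf{y}\,d\mathbf{x}$; damage $\mathcal{D}^\epsilon(t)=-\int_0^t\int_\Omega\int_\Omega\rho^\epsilon(\mathbf{y},\mathbf{x})\,\partial_t\gamma(\mathbf{u})(\mathbf{y},\mathbf{x},\tau)\,g(r(\tau,\mathbf{u}))\,d\mathbf{y}\,d\mathbf{x}\,d\tau$. *)

(* Defs.v *)
From HB Require Import structures.
From mathcomp Require Import all_boot all_order all_algebra.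
From mathcomp Require Import all_classical all_reals all_analysis.

Set Implicit Arguments.
Unset Strict Implicit.
Unset Printing Implicit Defensive.

Import Order.TTheory GRing.Theory Num.Theory.
Import numFieldNormedType.Exports.

Local Open Scope classical_set_scope.
Local Open Scope ring_scope.

(* R^n is 'rV[R]_n, with the product of the Borel sigma-algebras of its
   coordinates. *)
Section measurable_rV.
Context {R : realType} {n : nat}.

Let coord (i : 'I_n) (x : 'rV[R]_n) : R := x ord0 i.

Let rV_set0 : g_sigma_preimage coord set0.
Proof. exact: sigma_algebra0. Qed.

Let rV_setC A : g_sigma_preimage coord A -> g_sigma_preimage coord (~` A).
Proof. exact: sigma_algebraC. Qed.

Let rV_bigcup (F : _^nat) : (forall i, g_sigma_preimage coord (F i)) ->
  g_sigma_preimage coord (\bigcup_i (F i)).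
Proof. exact: sigma_algebra_bigcup. Qed.

HB.instance Definition _ := @isMeasurable.Build default_measure_display
  'rV[R]_n (g_sigma_preimage coord) rV_set0 rV_setC rV_bigcup.

Lemma measurable_coord_rV (i : 'I_n) :
  measurable_fun [set: 'rV[R]_n] (fun x : 'rV[R]_n => x ord0 i).
Proof.
move=> _ Y mY; rewrite setTI; apply: sub_sigma_algebra => /=.
rewrite -bigcup_seq/=; exists i => /=; first by rewrite mem_index_enum.
by exists Y => //; rewrite setTI.
Qed.

Lemma measurable_fun_rVP d (T : measurableType d) (f : T -> 'rV[R]_n) :
  (forall i, measurable_fun [set: T] (fun x => f x ord0 i)) ->
  measurable_fun [set: T] f.
Proof.
move=> mf _ A mA; rewrite setTI.
move: A mA; apply: (@smallest_sub _ _ _ [set A | measurable (f @^-1` A)]).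
  split=> /=.
  - by rewrite preimage_set0.
  - by move=> A mA; rewrite setTD -preimage_setC; exact: measurableC.
  - by move=> F mF; rewrite preimage_bigcup; exact: bigcupT_measurable.
rewrite -bigcup_seq/= => _ [i _ [B mB <-]] /=.
by rewrite setTI; have := mf i measurableT _ mB; rewrite setTI.
Qed.

End measurable_rV.

Section lebesgue_rV.
Context {R : realType}.

Definition rV_cons n (p : measurableTypeR R * 'rV[R]_n) : 'rV[R]_n.+1 :=
  \row_i (if unlift ord0 i is Some j then p.2 ord0 j else p.1).

Lemma measurable_rV_cons n :
  measurable_fun [set: measurableTypeR R * 'rV[R]_n] (@rV_cons n).
Proof.
apply: measurable_fun_rVP => i.
have [j ij|i0] := unliftP ord0 i.
- rewrite (_ : (fun x => _) = (fun x : 'rV[R]_n => x ord0 j) \o snd).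
    by apply: measurableT_comp => //; exact: measurable_coord_rV.
  by apply/funext => x /=; rewrite mxE ij liftK.
- rewrite (_ : (fun x => _) = fst) //.
  by apply/funext => x /=; rewrite mxE i0 unlift_none.
Qed.

Section step.
Variables (n : nat) (m : {sigma_finite_measure set 'rV[R]_n -> \bar R}).

Definition lebesgue_rV_step : set 'rV[R]_n.+1 -> \bar R :=
  pushforward (@lebesgue_measure R \x m)%E (@rV_cons n).

Let step0 : lebesgue_rV_step set0 = 0%E.
Proof. by rewrite /lebesgue_rV_step /pushforward preimage_set0 measure0. Qed.

Let step_ge0 A : (0 <= lebesgue_rV_step A)%E.
Proof. by rewrite /lebesgue_rV_step /pushforward measure_ge0. Qed.

Let step_sigma_additive : semi_sigma_additive lebesgue_rV_step.
Proof.
have mf : forall A, measurable A -> measurable (@rV_cons n @^-1` A).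
  by move=> A mA; rewrite -[X in measurable X]setTI; exact: measurable_rV_cons.
move=> F mF tF mUF; rewrite /lebesgue_rV_step /pushforward preimage_bigcup.
apply: measure_semi_sigma_additive => //.
- by move=> k; exact: mf.
- apply/trivIsetP => /= i j _ _ ij; rewrite -preimage_setI.
  by move/trivIsetP : tF => /(_ _ _ _ _ ij) ->//; rewrite preimage_set0.
- by rewrite -preimage_bigcup; exact: mf.
Qed.

HB.instance Definition _ := isMeasure.Build _ _ _ lebesgue_rV_step
  step0 step_ge0 step_sigma_additive.

Let step_sigma_finite : sigma_finite setT lebesgue_rV_step.
Proof.
pose behd (x : 'rV[R]_n.+1) : measurableTypeR R * 'rV[R]_n :=
  (x ord0 ord0, \row_j x ord0 (lift ord0 j)).
have mbehd : measurable_fun setT behd.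
  apply/measurable_fun_pairP; split; first exact: measurable_coord_rV.
  apply: measurable_fun_rVP => i.
  rewrite (_ : (fun x => _) = (fun x : 'rV[R]_n.+1 => x ord0 (lift ord0 i))).
    exact: measurable_coord_rV.
  by apply/funext => x /=; rewrite mxE.
have consK : cancel (@rV_cons n) behd.
  move=> [a x]; rewrite /behd /rV_cons mxE unlift_none /=; congr pair.
  by apply/rowP => j; rewrite !mxE liftK.
have [F FT mF] : sigma_finite setT (@lebesgue_measure R \x m)%E.
  have /sigma_finiteP[A [TA ndA Aoo]] := sigma_finiteT (@lebesgue_measure R).
  have /sigma_finiteP[B [TB ndB Boo]] := sigma_finiteT m.
  exists (fun k => A k `*` B k).
    rewrite -setXTT TA TB predeqE => -[x y]; split.
      move=> [/= [i _ Aix] [j _ Bjy]]; exists (maxn i j) => //; split.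
      - by move: x Aix; exact/subsetPset/ndA/leq_maxl.
      - by move: y Bjy; exact/subsetPset/ndB/leq_maxr.
    by move=> [i _ []/= ? ?]; split; exists i.
  move=> k; have [? ?] := Aoo k; have [? ?] := Boo k.
  split; first exact: measurableX.
  by rewrite product_measure1E// lte_mul_pinfty// ge0_fin_numE.
exists (fun i => behd @^-1` F i).
  by rewrite -preimage_bigcup -FT preimage_setT.
move=> i; have [mFi Fioo] := mF i; split.
  by rewrite -[X in measurable X]setTI; exact: mbehd.
rewrite /lebesgue_rV_step /pushforward -comp_preimage.
by rewrite (_ : behd \o _ = id) //; apply/funext.
Qed.

HB.instance Definition _ := Measure_isSigmaFinite.Build _ _ _ lebesgue_rV_step
  step_sigma_finite.

End step.

(* Lebesgue measure on R^n; lebesgue_rV_box is its characterization on boxes. *)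
Fixpoint lebesgue_rV n : {sigma_finite_measure set 'rV[R]_n -> \bar R} :=
  match n with
  | 0 => \d_(0 : 'rV[R]_0)
  | n'.+1 => lebesgue_rV_step (lebesgue_rV n')
  end.

Lemma lebesgue_rV_box n (A : 'I_n -> set R) :
  (forall i, measurable (A i)) ->
  lebesgue_rV n [set x | forall i, A i (x ord0 i)] =
  (\prod_(i < n) lebesgue_measure (A i))%E.
Proof.
elim: n A => [|n IH] A.
  by rewrite big_ord0 /= diracE mem_set// => -[].
move=> mA; rewrite big_ord_recl /= /lebesgue_rV_step /pushforward.
rewrite [X in product_measure1 _ _ X](_ : _ =
    A ord0 `*` [set x : 'rV[R]_n | forall i, A (lift ord0 i) (x ord0 i)]).
  rewrite product_measure1E//.
  - by congr (_ * _)%E; apply: (IH (fun i => A (lift ord0 i))) => i; exact: mA.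
  - exact: mA.
  - have -> : [set x : 'rV[R]_n | forall i : 'I_n, A (lift ord0 i) (x ord0 i)] =
        \bigcap_(i in [set: 'I_n])
          ((fun x : 'rV[R]_n => x ord0 i) @^-1` A (lift ord0 i)).
      by apply/seteqP; split => [x /= Ax i _|x /= Ax i]; exact: Ax.
    apply: fin_bigcap_measurable => [|i _]; first exact: finite_finset.
    rewrite -[X in measurable X]setTI; apply: measurable_coord_rV; first by [].
    exact: mA.
apply/seteqP; split => [[a x] /= Ax|[a x] /= [A0 Ax] i].
- split => [|i].
    by have := Ax ord0; rewrite mxE unlift_none.
  by have := Ax (lift ord0 i); rewrite mxE liftK.
- by rewrite mxE; have [j ->|->] := unliftP ord0 i.
Qed.

End lebesgue_rV.

Section euclidean.
Context {R : realType} {d : nat}.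
Implicit Types x y : 'rV[R]_d.

Definition dotr x y : R := \sum_(i < d) x ord0 i * y ord0 i.

(* The library norm on 'rV[R]_d is the sup norm. *)
Definition enorm x : R := Num.sqrt (dotr x x).

Definition unit_ball_volume : R :=
  fine (lebesgue_rV d [set x : 'rV[R]_d | enorm x < 1]).

(* Vectors are rows, so Q x is written x *m Q^T. *)
Definition rigid_motion : set ('rV[R]_d -> 'rV[R]_d) :=
  [set w | exists (Q : 'M[R]_d) (c : 'rV[R]_d),
     Q^T = - Q /\ w = (fun x => x *m Q^T + c)].

Definition bounded_domain (Omega : set 'rV[R]_d) : Prop :=
  [/\ Omega !=set0, open Omega, connected Omega & bounded_set Omega].

End euclidean.

(* Elements of L^oo(Omega; R^d) are represented by functions on R^d, of which
   only the restriction to Omega matters, up to a null set. *)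
Section function_space.
Context {R : realType} {d : nat}.
Variable Omega : set 'rV[R]_d.
Local Notation vfield := ('rV[R]_d -> 'rV[R]_d).

Definition Linf_norm (w : vfield) : \bar R :=
  ('N[lebesgue_rV d]_+oo[(fun x => (enorm (w x) * \1_Omega x)%R%:E)])%E.

Definition space_X : set vfield :=
  [set w | [/\ measurable_fun Omega w, (Linf_norm w < +oo)%E &
     forall z, rigid_motion z ->
       \int[lebesgue_rV d]_(x in Omega) dotr (w x) (z x) = 0]].

Variable T : R.

Definition Linf_continuous (w : R -> vfield) : Prop :=
  forall t : R, 0 <= t <= T ->
    Linf_norm (w s \- w t) @[s --> within `[0, T] (nbhs t)] --> (0 : \bar R).

(* w' is the time derivative of w on [0, T] in the norm of L^oo, one-sided at
   the endpoints. *)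
Definition Linf_derivative (w w' : R -> vfield) : Prop :=
  forall t : R, 0 <= t <= T ->
    Linf_norm (fun x => (s - t)^-1 *: (w s x - w t x) - w' t x)
      @[s --> within `[0, T] t^'] --> (0 : \bar R).

Definition C0_X (w : R -> vfield) : Prop :=
  (forall t : R, 0 <= t <= T -> space_X (w t)) /\ Linf_continuous w.

(* u is in C^2([0, T]; X), with first and second derivatives v and a. *)
Definition C2_X (u v a : R -> vfield) : Prop :=
  [/\ C0_X u, C0_X v, C0_X a, Linf_derivative u v & Linf_derivative v a].

(* A path with values in L^oo is a family of almost-everywhere classes, and a
   C^2 one has representatives whose trajectories t |-> u(t, x) are continuous
   for almost every x. Two such families agree, for almost every x, at all
   times simultaneously, so that quantities involving u(tau, x) for all tau in
   [0, t] at a fixed x, such as degradation factors, are well defined up to a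
   null set. *)
Definition continuous_trajectories (u : R -> vfield) : Prop :=
  {ae lebesgue_rV d, forall x, Omega x ->
    {within `[0, T], continuous (fun t => u t x)}}.

End function_space.

Section model_data.
Context {R : realType}.

Definition smooth (f : R -> R) : Prop :=
  forall n (r : R), derivable (derive1n n f) r 1.

(* Only the values of J on [0, +oo[ are used. Since J vanishes on [1, +oo[,
   "decreasing" can only mean nonincreasing; the same reading is used for h in
   both degradation factors. *)
Record influence_function (J : R -> R) (M : R) : Prop := {
  influence_ge0 : forall r, 0 <= r -> 0 <= J r;
  influence_noninc : forall r s, 0 <= r -> r <= s -> J s <= J r;
  influence_gt0 : forall r, 0 <= r < 1 -> 0 < J r;
  influence_0 : J 0 = M;
  influence_out : forall r, 1 <= r -> J r = 0 }.

Record bond_potential (g : R -> R) (rm re rc rp Cm Cp : R) : Prop := {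
  potential_order : rm < re /\ re < 0 /\ 0 < rc /\ rc < rp;
  potential_derivable : forall r : R, derivable g r 1;
  potential_derivable2 : forall r : R, derivable (derive1 g) r 1;
  potential_C2 : continuous (derive1n 2 g);
  potential_bounded1 : bounded_fun (derive1 g);
  potential_bounded2 : bounded_fun (derive1n 2 g);
  potential_left : forall r, r <= rm -> g r = Cm;
  potential_right : forall r, rp <= r -> g r = Cp;
  potential_convex : @convex_function R R^o `[re, rc]%classic g;
  potential_concave_left :
    @convex_function R R^o `[rm, re]%classic (fun r => - g r);
  potential_concave_right :
    @convex_function R R^o `[rc, rp]%classic (fun r => - g r) }.

Record damage_profile_a (h : R -> R) (xD : R) : Prop := {
  profile_a_gt0 : 0 < xD;
  profile_a_smooth : smooth h;
  profile_a_ge0 : forall r, 0 <= h r;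
  profile_a_one : forall r, r < 0 -> h r = 1;
  profile_a_noninc : forall r s, 0 <= r -> r <= s -> s < xD -> h s <= h r;
  profile_a_zero : forall r, xD <= r -> h r = 0 }.

Record damage_profile_b (h : R -> R) (rp rD : R) : Prop := {
  profile_b_lt : rp < rD;
  profile_b_smooth : smooth h;
  profile_b_ge0 : forall r, 0 <= h r;
  profile_b_one : forall r, r <= rp -> h r = 1;
  profile_b_noninc : forall r s, rp <= r -> r <= s -> s <= rD -> h s <= h r;
  profile_b_zero : forall r, rD <= r -> h r = 0 }.

End model_data.

Section dynamics.
Context {R : realType} {d : nat}.
Local Notation point := 'rV[R]_d.
Local Notation vfield := ('rV[R]_d -> 'rV[R]_d).
Local Notation mu := (lebesgue_rV d).

(* On the null set y = x, division by |y - x| = 0 yields 0. *)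
Definition bond_dir (y x : point) : point := (enorm (y - x))^-1 *: (y - x).

Definition strain (u : R -> vfield) (t : R) (y x : point) : R :=
  dotr ((enorm (y - x))^-1 *: (u t y - u t x)) (bond_dir y x).

Definition bond_r (u : R -> vfield) (t : R) (y x : point) : R :=
  Num.sqrt (enorm (y - x)) * strain u t y x.

Definition gamma_a (h : R -> R) (rp : R) (u : R -> vfield)
    (y x : point) (t : R) : R :=
  h (\int[lebesgue_measure]_(tau in `[0, t]) Num.max (bond_r u tau y x - rp) 0).

(* The supremum is the maximum as soon as the trajectories of u through x and y
   are continuous. *)
Definition max_strain (u : R -> vfield) (t : R) (y x : point) : R :=
  sup [set strain u tau y x | tau in `[0, t]].

Definition gamma_b (h : R -> R) (u : R -> vfield) (y x : point) (t : R) : R :=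
  h (Num.sqrt (enorm (y - x)) * max_strain u t y x).

Variables (Omega : set point) (eps : R) (J : R -> R).

Definition nonlocal_kernel (y x : point) : R :=
  \1_Omega y * J (enorm (y - x) / eps)
    / (eps * (@unit_ball_volume R d * eps ^+ d)).

Variables (g : R -> R) (gamma : (R -> vfield) -> point -> point -> R -> R).

Definition force (u : R -> vfield) (t : R) (x : point) : point :=
  - \row_i \int[mu]_(y in Omega)
      (2 * nonlocal_kernel y x / Num.sqrt (enorm (y - x)) * gamma u y x t
         * derive1 g (bond_r u t y x) * bond_dir y x ord0 i).

Definition elastic_energy (u : R -> vfield) (t : R) : R :=
  \int[mu]_(x in Omega) \int[mu]_(y in Omega)
    (nonlocal_kernel y x * gamma u y x t * g (bond_r u t y x)).

Definition damage_energy (u : R -> vfield) (t : R) : R :=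
  - \int[lebesgue_measure]_(tau in `[0, t])
      \int[mu]_(x in Omega) \int[mu]_(y in Omega)
        (nonlocal_kernel y x * derive1 (gamma u y x) tau
           * g (bond_r u tau y x)).

Variable rho : R.

(* v stands for the velocity of u. *)
Definition kinetic_energy (v : R -> vfield) (t : R) : R :=
  \int[mu]_(x in Omega) (rho * (enorm (v t x) ^+ 2 / 2)).

Variables (T : R) (b : R -> vfield) (u0 v0 : vfield).

Record solution (u v a : R -> vfield) : Prop := {
  solution_C2 : C2_X Omega T u v a;
  solution_trajectories : continuous_trajectories Omega T u;
  solution_eq : forall t : R, 0 <= t <= T ->
    {ae mu, forall x, Omega x -> rho *: a t x + force u t x = b t x};
  solution_u0 : {ae mu, forall x, Omega x -> u 0 x = u0 x};
  solution_v0 : {ae mu, forall x, Omega x -> v 0 x = v0 x} }.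

(* l is the derivative at t of f on [0, T], one-sided at the endpoints. *)
Definition is_derivative_on (f : R -> R) (t l : R) : Prop :=
  (f s - f t) / (s - t) @[s --> within `[0, T] t^'] --> l.

Definition energy_rate_balance (u v : R -> vfield) (t : R) : Prop :=
  exists dK dE dD : R,
    [/\ is_derivative_on (kinetic_energy v) t dK,
        is_derivative_on (elastic_energy u) t dE,
        is_derivative_on (damage_energy u) t dD &
        dK + dE + dD = \int[mu]_(x in Omega) dotr (b t x) (v t x)].

End dynamics.

(* Main.v *)
(** A C^1 path in L^oo has, up to a null set, Lipschitz trajectories which, at
    each fixed time, are strictly differentiable (both increments may vary) for
    almost every point, by a mean value inequality. So is the strain of almost
    every bond. Difference quotients along a bond are dominated by
    C |y - x|^(-1/2), hence the elastic energy can be differentiated under the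
    integral sign:
      E' = int int rho^eps d_t gamma g(r) + int int rho^eps gamma g'(r) d_t r.
    By the symmetry of bonds the second term is int L[u] . v, which the equation
    of motion turns into int b . v - K'. The first term is - D', since strict
    derivatives are continuous on the set where they exist: the first term is
    therefore continuous on the set of times at which gamma is strictly
    differentiable for almost every bond, and as soon as this set has full
    measure its primitive has the expected derivative at each of these times.
    In case (a) all times qualify. In case (b) the running maximum of a strictly
    differentiable function can fail to be strictly differentiable only at the
    right end of a plateau. For a given bond there is at most one such time per
    rational in the plateau, so Tonelli's theorem shows that almost every time
    qualifies. *)

From HB Require Import structures.
Require Import Defs.
From mathcomp Require Import all_boot all_order all_algebra.
From mathcomp Require Import all_classical all_reals all_analysis.
From mathcomp Require Import measurable_realfun ess_sup_inf ring lra.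

Set Implicit Arguments.
Unset Strict Implicit.
Unset Printing Implicit Defensive.

Import Order.TTheory GRing.Theory Num.Theory.
Import numFieldNormedType.Exports.

Local Open Scope classical_set_scope.
Local Open Scope ring_scope.

(** * Strict derivatives *)

(** Strict differentiability, rather than C^1 regularity, survives the two sources of roughness. The
    velocity [v] is a family of almost-everywhere classes, with one null set per time, so its
    trajectories need not be continuous; but at a fixed time a strict derivative of [u] reduces to
    inequalities between pairs of rational times, hence to countably many null sets. And the running
    maximum is not C^1 even for smooth strains, while it inherits strict derivatives away from
    plateau ends. Two devices control exceptional sets. [u] is replaced by [U], equal to it on a
    measurable set [A] of full measure and zero elsewhere, so that Lipschitz bounds hold for every
    bond. Time derivatives of [gamma] are selected by choice, with no evident Borel measurability,
    so integrals are handled for functions almost everywhere equal to measurable ones. The exponent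
    -1/2 comes from [sqrt |y - x| * |y - x|^-1]; slicing along one coordinate shows integrability
    against the bounded kernel in any dimension. Both degradation factors enter one abstract
    balance, where they differ in the set of good times and in a Lipschitz constant. *)

Section strict_derivative.
Context {R : realType}.
Implicit Types (A : set R) (f g : R -> R) (t l : R).

(** The strict derivative in the sense of Peano, relative to [A], hence one-sided at the end points
    of an interval. The product form makes [p = q] harmless. *)
Definition strict_deriv A f t l : Prop :=
  forall e : R, 0 < e -> exists2 delta : R, 0 < delta & forall p q, A p -> A q ->
    `|p - t| < delta -> `|q - t| < delta ->
    `|f p - f q - (p - q) * l| <= e * `|p - q|.

Lemma strict_deriv_near A f g t l r : 0 < r ->
  (forall p, A p -> `|p - t| < r -> f p = g p) ->
  strict_deriv A g t l -> strict_deriv A f t l.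
Proof.
move=> r0 fg sg e e0; have [dl dl0 H] := sg e e0.
exists (Num.min dl r); first by rewrite lt_min dl0.
move=> p q Ap Aq; rewrite !lt_min => /andP[pd pr] /andP[qd qr].
by rewrite (fg p)// (fg q)//; exact: H.
Qed.

Lemma eq_strict_deriv A f g t l : (forall p, A p -> f p = g p) ->
  strict_deriv A g t l -> strict_deriv A f t l.
Proof. by move=> fg; apply: (strict_deriv_near ltr01) => p Ap _; exact: fg. Qed.

Lemma strict_deriv_cst A c t : strict_deriv A (cst c) t 0.
Proof.
move=> e e0; exists 1 => // p q _ _ _ _ /=.
by rewrite mulr0 !subrr normr0 mulr_ge0// ltW.
Qed.

Lemma strict_derivZ A f t l c :
  strict_deriv A f t l -> strict_deriv A (fun s => c * f s) t (c * l).
Proof.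
move=> sf e e0; have c0 : 0 < `|c| + 1 by rewrite ltr_wpDl.
have [dl dl0 H] := sf (e / (`|c| + 1)) (divr_gt0 e0 c0).
exists dl => // p q Ap Aq pd qd; have := H p q Ap Aq pd qd.
rewrite (_ : c * f p - _ - _ = c * (f p - f q - (p - q) * l)); last by ring.
rewrite normrM => {}H.
apply: (@le_trans _ _ ((`|c| + 1) * (e / (`|c| + 1) * `|p - q|))).
  by apply: ler_pM => //; rewrite lerDl.
by rewrite mulrA [_ * (e / _)]mulrC divfK// gt_eqF.
Qed.

Lemma strict_derivD A f g t l m : strict_deriv A f t l -> strict_deriv A g t m ->
  strict_deriv A (fun s => f s + g s) t (l + m).
Proof.
move=> sf sg e e0; have e20 : 0 < e / 2 by rewrite divr_gt0.
have [d1 d10 H1] := sf _ e20; have [d2 d20 H2] := sg _ e20.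
exists (Num.min d1 d2); first by rewrite lt_min d10.
move=> p q Ap Aq; rewrite !lt_min => /andP[pd1 pd2] /andP[qd1 qd2].
have {}H1 := H1 p q Ap Aq pd1 qd1; have {}H2 := H2 p q Ap Aq pd2 qd2.
rewrite (_ : f p + g p - _ - _ = (f p - f q - (p - q) * l) +
  (g p - g q - (p - q) * m)); last by ring.
apply: le_trans (ler_normD _ _) _.
by apply: le_trans (lerD H1 H2) _; rewrite -mulrDl -splitr.
Qed.

Lemma strict_deriv_lipschitz_near A f t l : strict_deriv A f t l ->
  exists2 delta : R, 0 < delta & forall p q, A p -> A q ->
    `|p - t| < delta -> `|q - t| < delta ->
    `|f p - f q| <= (`|l| + 1) * `|p - q|.
Proof.
move=> /(_ 1 ltr01)[dl dl0 H]; exists dl => // p q Ap Aq pd qd.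
have {}H := H p q Ap Aq pd qd.
rewrite (_ : f p - f q = (p - q) * l + (f p - f q - (p - q) * l)); last by ring.
apply: le_trans (ler_normD _ _) _; rewrite [leRHS]mulrDl lerD//.
by rewrite normrM mulrC.
Qed.

Lemma strict_deriv_comp A h f t l m : A t ->
  strict_deriv A f t l -> strict_deriv setT h (f t) m ->
  strict_deriv A (h \o f) t (m * l).
Proof.
move=> At sf sh e e0.
have [d0 d00 H0] := strict_deriv_lipschitz_near sf.
(* [L] is a local Lipschitz constant of [f]: it makes the error of [h], proportional to
   [|f p - f q|], proportional to [|p - q|]. Each of the two errors then takes half of [e]. *)
pose L := `|l| + 1; have L0 : 0 < L by rewrite ltr_wpDl.
pose K := `|m| + 1; have K0 : 0 < K by rewrite ltr_wpDl.
have [d1 d10 H1] := sh (e / (2 * L)) (divr_gt0 e0 (mulr_gt0 (ltr0Sn R 1) L0)).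
have [d2 d20 H2] := sf (e / (2 * K)) (divr_gt0 e0 (mulr_gt0 (ltr0Sn R 1) K0)).
exists (Num.min (Num.min d0 d2) (d1 / L)).
  by rewrite !lt_min d00 d20 divr_gt0.
have cl p : A p -> `|p - t| < d0 -> `|p - t| < d1 / L -> `|f p - f t| < d1.
  move=> Ap pd0 pd1; apply: (le_lt_trans (H0 p t Ap At pd0 _)).
    by rewrite subrr normr0.
  by rewrite -/L mulrC -ltr_pdivlMr.
move=> p q Ap Aq; rewrite !lt_min => /andP[/andP[p0 p2] p1] /andP[/andP[q0 q2] q1] /=.
have {}H1 := H1 (f p) (f q) I I (cl p Ap p0 p1) (cl q Aq q0 q1).
have {}H2 := H2 p q Ap Aq p2 q2; have {}H0 := H0 p q Ap Aq p0 q0.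
rewrite (_ : h (f p) - _ - _ = (h (f p) - h (f q) - (f p - f q) * m) +
  m * (f p - f q - (p - q) * l)); last by ring.
apply: le_trans (ler_normD _ _) _.
rewrite (_ : e * `|p - q| = e / 2 * `|p - q| + e / 2 * `|p - q|); last first.
  by rewrite -mulrDl -splitr.
apply: lerD.
  apply: (le_trans H1).
  apply: (@le_trans _ _ (e / (2 * L) * (L * `|p - q|))).
    by rewrite ler_wpM2l// ltW// divr_gt0// mulr_gt0.
  by rewrite le_eqVlt; apply/orP; left; apply/eqP; field; rewrite gt_eqF.
rewrite normrM; apply: (@le_trans _ _ (K * (e / (2 * K) * `|p - q|))).
  by apply: ler_pM => //; rewrite lerDl.
by rewrite le_eqVlt; apply/orP; left; apply/eqP; field; rewrite gt_eqF.
Qed.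

(** The mean value point lies between [p] and [q], hence in the ball where [derive1 f] is within [e]
    of its value at [x]. *)
Lemma C1_strict_deriv f x : (forall r, derivable f r 1) ->
  {for x, continuous (derive1 f)} -> strict_deriv setT f x (derive1 f x).
Proof.
move=> df cf e e0.
move/cvgrPdist_le : cf => /(_ e e0)/nbhs_ballP[dl /= dl0 H].
exists dl => // p q _ _.
wlog pq : p q / q <= p => [wl pd qd|].
  have [/wl|/ltW/wl] := leP q p; first by apply.
  move=> /(_ qd pd); rewrite (distrC q p); apply: le_trans.
  by rewrite -normrN; apply: ler_normlW; rewrite normr_id le_eqVlt;
    apply/orP; left; apply/eqP; congr `| _ |; ring.
move=> pd qd.
have [c cpq ->] : exists2 c, c \in `[q, p] & f p - f q = derive1 f c * (p - q).
  apply: MVT_segment => //.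
    by move=> y _; rewrite derive1E; apply/derivableP/df.
  apply: derivable_within_continuous => y _; exact: df.
rewrite [derive1 f c * _]mulrC -mulrBr normrM mulrC ler_wpM2r//.
rewrite distrC; apply: H; rewrite -ball_normE/=.
move: cpq; rewrite in_itv/= => /andP[qc cp].
move: pd qd; rewrite !ltr_norml => /andP[? ?] /andP[? ?].
by apply/andP; split; lra.
Qed.

Lemma strict_deriv_quotient A f t l (s : nat -> R) : A t ->
  (forall n, A (s n)) -> (forall n, s n != t) -> s n @[n --> \oo] --> t ->
  strict_deriv A f t l ->
  (f (s n) - f t) / (s n - t) @[n --> \oo] --> l.
Proof.
move=> At As st sct sf; apply/cvgrPdist_le => e e0.
have [dl dl0 H] := sf e e0.
move/cvgrPdist_lt : sct => /(_ dl dl0); apply: filterS => n nd.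
have {}H := H (s n) t (As n) At; rewrite distrC in nd.
have := H nd; rewrite subrr normr0 => /(_ dl0) {}H.
have snt : s n - t != 0 by rewrite subr_eq0.
rewrite distrC (_ : _ / _ - l = (f (s n) - f t - (s n - t) * l) / (s n - t)).
  by rewrite normrM normfV ler_pdivrMr// normr_gt0.
by field.
Qed.

(** [derive1] is a two-sided limit, hence the neighbourhood hypothesis. This identifies the time
    derivative inside [damage_energy] at interior times. *)
Lemma strict_deriv_derive1 A f t l : nbhs t A ->
  strict_deriv A f t l -> derive1 f t = l.
Proof.
move=> /nbhs_ballP[r /= r0 rA] sf; rewrite /derive1; apply: cvg_lim => //.
apply/cvgrPdist_le => e e0; have [dl dl0 H] := sf e e0.
near=> h.
have h0 : h != 0 by near: h; exact: nbhs_dnbhs_neq.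
have hm : `|h| < Num.min r dl.
  near: h; apply: dnbhs0_lt; by rewrite lt_min r0.
move: hm; rewrite lt_min => /andP[hr hd].
have := H (h + t) t; rewrite subrr normr0 addrK => /(_ _ _ hd dl0) {}H.
rewrite distrC (_ : _ *: _ - l = (f (h + t) - f t - h * l) / h).
  rewrite normrM normfV ler_pdivrMr ?normr_gt0//; apply: H => //.
    by apply: rA; rewrite /ball/= opprD addrCA subrr addr0 normrN.
  by apply: rA; exact: ballxx.
by rewrite /GRing.scale/=; field.
Unshelve. all: by end_near. Qed.

(** The quotient over a short increment from [s n] is within [e / 2] of [ls n] by definition, and of
    [l] because both its points are near [t]. The limit point hypothesis supplies a nonzero
    increment inside [A]; at an isolated point every number would be a strict derivative. *)
Lemma strict_deriv_cvg A f t l (s ls : nat -> R) :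
  (forall n, A (s n)) -> s n @[n --> \oo] --> t ->
  (forall x, A x -> forall e : R, 0 < e -> exists y, [/\ A y, y != x & `|y - x| < e]) ->
  strict_deriv A f t l ->
  (forall n, strict_deriv A f (s n) (ls n)) -> ls n @[n --> \oo] --> l.
Proof.
move=> As sct Alim sf sfn; apply/cvgrPdist_le => e e0.
have e20 : 0 < e / 2 by rewrite divr_gt0.
have [dl dl0 H] := sf _ e20.
move/cvgrPdist_lt : sct => /(_ (dl / 2)); rewrite divr_gt0// => /(_ isT).
apply: filterS => n; rewrite distrC => nd.
have [dn dn0 Hn] := sfn n _ e20.
have [y [Ay yn yd]] := Alim _ (As n) (Num.min (dl / 2) dn) ltac:(by rewrite lt_min divr_gt0).
move: yd; rewrite lt_min => /andP[yd1 yd2].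
have {}Hn := Hn y (s n) Ay (As n) yd2; rewrite subrr normr0 in Hn.
have {}Hn := Hn dn0.
have yt : `|y - t| < dl.
  rewrite (_ : y - t = (y - s n) + (s n - t)); last by ring.
  by apply: le_lt_trans (ler_normD _ _) _; rewrite (splitr dl) ltrD.
have {}H := H y (s n) Ay (As n) yt (lt_trans nd _).
have := H ltac:(lra) => {}H.
have yn0 : 0 < `|y - s n| by rewrite normr_gt0 subr_eq0.
rewrite -(ler_pM2r yn0) -normrM.
rewrite (_ : (l - ls n) * (y - s n) = (f y - f (s n) - (y - s n) * ls n) -
  (f y - f (s n) - (y - s n) * l)); last by ring.
apply: le_trans (ler_normB _ _) _.
by apply: le_trans (lerD Hn H) _; rewrite -mulrDl -splitr.
Qed.

(** Cousin's lemma as an induction along the interval: the supremum of the points reached from [a]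
    is itself reached, and passed unless it is [b]. *)
Lemma cousin (P : R -> R -> Prop) (a b : R) : a <= b ->
  (forall x y z, a <= x -> x <= y -> y <= z -> z <= b ->
     P x y -> P y z -> P x z) ->
  (forall c, a <= c <= b -> exists2 delta : R, 0 < delta & forall x y,
     a <= x -> x <= c -> c <= y -> y <= b -> y - x < delta -> P x y) ->
  P a b.
Proof.
move=> ab Padd Ploc.
pose S := [set x | a <= x <= b /\ P a x].
have Sa : S a.
  split; first by rewrite lexx.
  have [|dl dl0 H] := Ploc a; first by rewrite lexx.
  by apply: H => //; rewrite subrr.
have hS : has_sup S.
  by split; [exists a|exists b => x [/andP[]]].
have asS : a <= sup S by apply: sup_upper_bound.
have sSb : sup S <= b by apply: ge_sup; [exists a|move=> x [/andP[]]].
have [|dl dl0 H] := Ploc (sup S); first by rewrite asS.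
have [x [/andP[ax xb] Pax] xs] := sup_adherent (divr_gt0 dl0 (ltr0Sn R 1) : 0 < dl / 2) hS.
have xsS : x <= sup S by apply: sup_upper_bound => //; split => //; rewrite ax.
(* [x] is within [dl / 2] of the supremum and [y] at most [dl / 3] beyond it, so that
   [y - x < dl]. *)
pose y := Num.min b (sup S + dl / 3).
have yb : y <= b by rewrite /y ge_min lexx.
have sy : sup S <= y by rewrite /y le_min sSb lerDl divr_ge0// ltW.
have ys : y <= sup S + dl / 3 by rewrite /y ge_min lexx orbT.
have Pay : P a y.
  apply: (Padd a x y) => //; first exact: le_trans sy.
  apply: H => //; lra.
have Sy : S y by split => //; rewrite yb (le_trans asS).
have yS : y <= sup S by apply: sup_upper_bound.
have yeb : y = b.
  by move: yS; rewrite /y minElt; case: ifPn => // _ ?; exfalso; lra.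
by rewrite -yeb.
Qed.

End strict_derivative.

(** * Running maxima of Lipschitz functions *)

Section running_max.
Context {R : realType}.
Variable T : R.
Implicit Types (f : R -> R) (t : R).

Definition running_max f t : R := sup [set f tau | tau in `[0, t]].

Definition lipschitz_on f L : Prop := forall p q, 0 <= p <= T -> 0 <= q <= T ->
  `|f p - f q| <= L * `|p - q|.

Variables (f : R -> R) (L : R).
Hypothesis L0 : 0 <= L.
Hypothesis Lf : lipschitz_on f L.

Lemma running_max_ge t tau : t <= T -> 0 <= tau <= t -> f tau <= running_max f t.
Proof.
move=> tT /andP[tau0 taut]; apply: ub_le_sup; last first.
  by exists tau => //=; rewrite in_itv/= tau0.
(* [sup] dominates the elements of bounded sets only; the Lipschitz bound over a length at most [T]
   provides an upper bound. *)
exists (f tau + L * T) => _ [s + <-]; rewrite /= in_itv/= => /andP[s0 st].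
have := @Lf s tau.
rewrite s0 (le_trans st)// tau0 (le_trans taut)// => /(_ isT isT) H.
rewrite -lerBlDl; apply: le_trans (ler_norm _) _; apply: le_trans H _.
rewrite ler_wpM2l// ler_norml; apply/andP; split; lra.
Qed.

Lemma running_max_le t c : 0 <= t -> (forall tau, 0 <= tau <= t -> f tau <= c) ->
  running_max f t <= c.
Proof.
move=> t0 H; apply: ge_sup.
  by exists (f 0); exists 0 => //=; rewrite in_itv/= lexx.
by move=> _ [s + <-]; rewrite /= in_itv/= => /H.
Qed.

Lemma running_max_homo p q : 0 <= q -> q <= p -> p <= T ->
  running_max f q <= running_max f p.
Proof.
move=> q0 qp pT; apply: running_max_le => // tau /andP[tau0 tauq].
by apply: running_max_ge => //; rewrite tau0 (le_trans tauq).
Qed.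

(** Values that raise the maximum occur in [[q, p]], where [f] exceeds [f q], and a fortiori the old
    maximum, by at most [K * (p - q)]. An upper bound on increments is all that remains when the
    derivative is nonpositive. *)
Lemma running_max_increment p q K : 0 <= K -> 0 <= q -> q <= p -> p <= T ->
  (forall tau, q <= tau <= p -> f tau - f q <= K * (p - q)) ->
  `|running_max f p - running_max f q| <= K * `|p - q|.
Proof.
move=> K0 q0 qp pT H.
rewrite !ger0_norm ?subr_ge0//; last exact: running_max_homo.
rewrite lerBlDl; apply: running_max_le; first exact: le_trans qp.
move=> tau /andP[tau0 taup]; have [tq|/ltW qt] := leP tau q.
  apply: (@le_trans _ _ (running_max f q)).
    by apply: running_max_ge; [exact: le_trans qp _|rewrite tau0].
  by rewrite lerDl mulr_ge0// subr_ge0.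
have fq : f q <= running_max f q.
  by apply: running_max_ge; [exact: le_trans qp _|rewrite q0 lexx].
have := H tau; rewrite qt taup => /(_ isT); lra.
Qed.

Lemma lipschitz_running_max : lipschitz_on (running_max f) L.
Proof.
move=> p q; wlog qp : p q / q <= p => [wl pT qT|].
  have [/wl|/ltW/wl] := leP q p; first by apply.
  by rewrite distrC [X in _ <= _ * X]distrC; apply.
move=> /andP[p0 pT] /andP[q0 qT]; apply: running_max_increment => // tau.
move=> /andP[qt tp]; apply: le_trans (ler_norm _) _.
apply: (le_trans (Lf _ _)); rewrite ?q0 ?qT//.
  by rewrite (le_trans q0)// (le_trans tp).
by rewrite ler_wpM2l// ger0_norm ?subr_ge0// lerB.
Qed.

(* At such times the running maximum may have a corner. *)
Definition plateau_end t : Prop := exists q : rat,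
  [/\ 0 <= (ratr q : R) < t, running_max f (ratr q) = running_max f t &
    forall s, t < s <= T -> running_max f t < running_max f s].

(** Three cases. If [f t] is below the maximum, the maximum is locally constant. If they agree and
    [l <= 0], forward increments of [f] near [t] are at most [e] times the time step, so the maximum
    has derivative 0. If they agree and [l > 0], then [f] increases near [t] and, unless [t] ends a
    plateau, the maximum coincides with [f] there. *)
Lemma strict_deriv_running_max t l : 0 <= t <= T -> ~ plateau_end t ->
  strict_deriv `[0, T] f t l ->
  exists m, strict_deriv `[0, T] (running_max f) t m.
Proof.
move=> /andP[t0 tT] noplat sf.
have ftM : f t <= running_max f t by apply: running_max_ge; rewrite ?t0 ?lexx.
move: ftM; rewrite le_eqVlt => /orP[/eqP ftM|ftM]; last first.
  pose eta := running_max f t - f t.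
  have eta0 : 0 < eta by rewrite subr_gt0.
  (* Within this radius the Lipschitz bound lets [f] rise by at most [eta / 2]. *)
  pose r := eta / (2 * (L + 1)).
  have r0 : 0 < r by rewrite divr_gt0// mulr_gt0// ltr_wpDl.
  have near_lt tau : 0 <= tau <= T -> `|tau - t| < r ->
      f tau <= running_max f t - eta / 2.
    move=> tauT taur.
    have : f tau - f t <= eta / 2.
      apply: le_trans (ler_norm _) _; apply: (le_trans (Lf _ _)) => //.
        by rewrite t0.
      apply: (@le_trans _ _ ((L + 1) * r)).
        by apply: ler_pM => //; [rewrite lerDl|rewrite ltW].
      rewrite le_eqVlt; apply/orP; left; apply/eqP; rewrite /r; field.
      by rewrite gt_eqF// ltr_wpDl.
    rewrite /eta; lra.
  exists 0; apply: (strict_deriv_near r0) (strict_deriv_cst _ (running_max f t) t).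
  move=> p; rewrite /= in_itv/= => /andP[p0 pT] pr; apply/eqP.
  have [tp|/ltW pt] := leP t p.
    rewrite eq_le; apply/andP; split; last exact: running_max_homo.
    apply: running_max_le => // tau.
    move=> /andP[tau0 taup]; have [taut|/ltW ttau] := leP tau t.
      by apply: running_max_ge => //; rewrite tau0.
    have : f tau <= running_max f t - eta / 2.
      apply: near_lt; first by rewrite tau0 (le_trans taup).
      apply: le_lt_trans pr; rewrite !ger0_norm ?subr_ge0// lerB//.
    by move=> H; apply: (le_trans H); rewrite gerBl divr_ge0// ltW.
  rewrite eq_le; apply/andP; split; first exact: running_max_homo.
  have : running_max f t <= Num.max (running_max f p) (running_max f t - eta / 2).
    apply: running_max_le => // tau /andP[tau0 taut]; rewrite le_max.
    have [taup|/ltW ptau] := leP tau p.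
      by apply/orP; left; apply: running_max_ge => //; rewrite tau0.
    apply/orP; right; apply: near_lt; first by rewrite tau0 (le_trans taut).
    apply: le_lt_trans pr; rewrite !ler0_norm ?subr_le0// lerN2 lerB//.
  by rewrite le_max => /orP[//|]; rewrite -subr_ge0; lra.
have [l0|l0] := leP l 0.
  exists 0 => e e0; have [dl dl0 H] := sf e e0; exists dl => // p q.
  rewrite mulr0 subr0; wlog qp : p q / q <= p => [wl pT qT pd qd|].
    have [qp|/ltW pq] := leP q p; first exact: wl.
    by rewrite distrC [X in _ <= _ * X]distrC; exact: wl.
  rewrite /= !in_itv/= => /andP[p0 pT] /andP[q0 qT] pd qd.
  apply: running_max_increment => //; first exact: ltW.
  move=> tau /andP[qtau taup].
  have : `|f tau - f q - (tau - q) * l| <= e * `|tau - q|.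
    apply: H; rewrite /= ?in_itv/= ?q0 ?qT//.
      by rewrite (le_trans q0)// (le_trans taup).
    by move: pd qd; rewrite !ltr_norml => /andP[? ?] /andP[? ?]; apply/andP; split; lra.
  move=> /(le_trans (ler_norm _)); rewrite ger0_norm ?subr_ge0// => {}H.
  have : (tau - q) * l <= 0 by rewrite mulr_ge0_le0// subr_ge0.
  have : e * (tau - q) <= e * (p - q) by rewrite ler_wpM2l ?lerB// ltW.
  lra.
exists l.
have [dl dl0 H] := sf (l / 2) (divr_gt0 l0 (ltr0Sn R 1)).
have mono p q : 0 <= q -> q <= p -> p <= T -> `|p - t| < dl -> `|q - t| < dl ->
    (p - q) * (l / 2) <= f p - f q.
  move=> q0 qp pT pd qd; have := H p q; rewrite /= !in_itv/= q0 pT.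
  rewrite (le_trans q0 qp) (le_trans qp pT) => /(_ isT isT pd qd).
  rewrite ler_norml => /andP[+ _]; rewrite [`|p - q|]ger0_norm ?subr_ge0//; nra.
(* This is the last clause of [plateau_end]; since [t] is not a plateau end, no earlier rational
   time can then have the same maximum. *)
have M_gt s : t < s <= T -> running_max f t < running_max f s.
  move=> /andP[ts sT]; pose s' := Num.min s (t + dl / 2).
  have s's : s' <= s by rewrite /s' ge_min lexx.
  have ts' : t < s' by rewrite /s' lt_min ts/= ltrDl divr_gt0.
  have s'd : s' <= t + dl / 2 by rewrite /s' ge_min lexx orbT.
  have : (s' - t) * (l / 2) <= f s' - f t.
    apply: mono => //; [exact: ltW|exact: le_trans sT| |by rewrite subrr normr0].
    rewrite ger0_norm; first lra.
    by rewrite subr_ge0 ltW.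
  have : 0 < (s' - t) * (l / 2) by rewrite mulr_gt0 ?subr_gt0// divr_gt0.
  have : f s' <= running_max f s.
    by apply: running_max_ge => //; rewrite s's andbT (le_trans t0)// ltW.
  rewrite -ftM; lra.
(* If the maximum were the same at [q] and [t], monotonicity would give the same value at a rational
   time between them. *)
have M_lt q : 0 <= q < t -> running_max f q < running_max f t.
  move=> /andP[q0 qt]; have [x [qx [y _ yx]]] := @dense_rat R `]q, t[%classic
    ltac:(by exists ((q + t) / 2); rewrite /= in_itv/=; apply/andP; split; lra)
    ltac:(exact: interval_open).
  move: qx; rewrite /= in_itv/= -yx => /andP[qy yt].
  have y0 : 0 <= ratr y :> R by rewrite (le_trans q0)// ltW.
  apply: (@le_lt_trans _ _ (running_max f (ratr y))).
    by apply: running_max_homo => //; [exact: ltW|rewrite ltW// (lt_le_trans yt)].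
  rewrite lt_neqAle; apply/andP; split; last by apply: running_max_homo => //; exact: ltW.
  apply/eqP => yM.
  by apply: noplat; exists y; split => //; rewrite y0.
(* [f] increases from [t0'] on, near [t]. Close to [t], the value [f p] exceeds the maximum up to
   [t0'], and monotonicity after [t0'] makes it the largest value up to [p]. At [t = 0] one has
   [t0' = 0] and monotonicity gives both. *)
pose t0' := Num.max 0 (t - dl / 2).
have t0'0 : 0 <= t0' by rewrite /t0' le_max lexx.
have t0't : t0' <= t by rewrite /t0' ge_max t0/=; lra.
have t0'd : t - dl / 2 <= t0' by rewrite /t0' le_max lexx orbT.
have [r r0 Hr] : exists2 r : R, 0 < r & forall p, 0 <= p <= T -> `|p - t| < r ->
    t0' <= p /\ running_max f t0' <= f p.
  have [tz|tn0] := eqVneq t 0.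
    have t0'E : t0' = 0.
      by apply/eqP; rewrite eq_le t0'0 andbT /t0' ge_max lexx/= tz; lra.
    exists dl => // p /andP[p0 pT] pd; rewrite t0'E -tz -ftM.
    have tp : t <= p by rewrite tz.
    split => //; have := @mono p t t0 tp pT pd.
    rewrite subrr normr0 => /(_ dl0).
    have : 0 <= (p - t) * (l / 2).
      by rewrite mulr_ge0 ?subr_ge0// divr_ge0// ltW.
    lra.
  have t0'lt : t0' < t by rewrite /t0' gt_max lt_neqAle eq_sym tn0 t0/=; lra.
  have Mt : running_max f t0' < f t by rewrite ftM; apply: M_lt; rewrite t0'0.
  pose eta := f t - running_max f t0'.
  have eta0 : 0 < eta by rewrite subr_gt0.
  exists (Num.min (t - t0') (eta / (L + 1))).
    by rewrite lt_min subr_gt0 t0'lt divr_gt0// ltr_wpDl.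
  move=> p pT; rewrite lt_min => /andP[p1 p2]; split.
    by move: p1; rewrite ltr_norml => /andP[]; lra.
  have := @Lf t p; rewrite t0 tT pT => /(_ isT isT) /(le_trans (ler_norm _)).
  have : L * `|t - p| <= eta.
    rewrite distrC; apply: (@le_trans _ _ ((L + 1) * `|p - t|)).
      by rewrite ler_wpM2r// lerDl.
    by rewrite mulrC -ler_pdivlMr 1?ltW// ltr_wpDl.
  rewrite /eta; lra.
apply: (@strict_deriv_near _ _ _ f _ _ (Num.min r (dl / 2))) => //.
  by rewrite lt_min r0 divr_gt0.
move=> p; rewrite /= in_itv/= lt_min => /andP[p0 pT] /andP[pr pd].
have [|t0'p Mp] := Hr p _ pr; first by rewrite p0.
apply/eqP; rewrite eq_le; apply/andP; split; last first.
  by apply: running_max_ge; rewrite ?p0 ?lexx.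
apply: running_max_le => // tau /andP[tau0 taup].
have [taut|/ltW t0tau] := leP tau t0'.
  apply: le_trans Mp; apply: running_max_ge; last by rewrite tau0.
  exact: le_trans pT.
have := @mono p tau tau0 taup pT.
have : 0 <= (p - tau) * (l / 2) by rewrite mulr_ge0 ?subr_ge0// divr_ge0// ltW.
move=> H1 /(_ _ _)H2; rewrite -subr_ge0; apply: (le_trans H1); apply: H2.
  by move: pd; rewrite ltr_norml ltr_norml => /andP[? ?]; apply/andP; split; lra.
by move: pd; rewrite ltr_norml ltr_norml => /andP[? ?]; apply/andP; split; lra.
Qed.

End running_max.

Import HBNNSimple.

(** * Integration up to null sets *)

Section ae_measurable.
Context d {T : measurableType d} {R : realType}.
Variable mu : {measure set T -> \bar R}.

Lemma ae_imp (P Q : T -> Prop) : (forall x, P x -> Q x) ->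
  {ae mu, forall x, P x} -> {ae mu, forall x, Q x}.
Proof. by move=> PQ; apply: filterS. Qed.

Lemma ae_imp2 (P Q S : T -> Prop) : (forall x, P x -> Q x -> S x) ->
  {ae mu, forall x, P x} -> {ae mu, forall x, Q x} -> {ae mu, forall x, S x}.
Proof. by move=> PQS; apply: filterS2. Qed.

Lemma ae_forall_countable (C : countType) (P : C -> T -> Prop) :
  (forall c, {ae mu, forall x, P c x}) -> {ae mu, forall x, forall c, P c x}.
Proof.
move=> aeP.
have : {ae mu, forall x, forall n, if @unpickle C n is Some c then P c x else True}.
  apply: ae_foralln => n; case: (unpickle n) => [c|]; first exact: aeP.
  exact: aeW.
by apply: filterS => x H c; have := H (pickle c); rewrite pickleK.
Qed.

(* The integral of a nonnegative function is a supremum over the simple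
   functions below it, so that null sets can be discarded without any
   measurability assumption. *)
Let ge0_ae_le_integral (f g : T -> \bar R) :
  (forall x, 0 <= f x)%E -> (forall x, 0 <= g x)%E ->
  {ae mu, forall x, f x <= g x}%E ->
  (\int[mu]_x f x <= \int[mu]_x g x)%E.
Proof.
move=> f0 g0 [N [mN N0 fgN]].
rewrite !ge0_integralTE//; apply: ge_ereal_sup => _ [h hf <-].
pose h' := proj_nnsfun h (measurableC mN).
have h'E x : h' x = (h \_ (~` N)) x by rewrite (mrestrict h (measurableC mN)).
have h'g : (sintegral mu h' <= ereal_sup [set sintegral mu h |
    h in [set h : {nnsfun T >-> R} | (forall x, (h x)%:E <= g x)%E]])%E.
  apply: ereal_sup_ubound; exists h' => // x.
  rewrite h'E patchE; case: ifPn => [|_]; last exact: g0.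
  rewrite in_setC => xN; apply: le_trans (hf x) _.
  by apply: contrapT => nfg; move/negP: xN; apply; apply/mem_set/fgN.
apply: le_trans h'g.
rewrite -(integralT_nnsfun mu h) -(integralT_nnsfun mu h').
rewrite (@ge0_negligible_integral _ _ _ mu setT N)//; first last.
- by move=> x _; rewrite lee_fin.
- by apply/measurable_EFinP; exact: measurable_funTS.
rewrite integral_mkcond le_eqVlt; apply/orP; left; apply/eqP.
apply: eq_integral => x _; rewrite h'E !patchE setTD.
by case: ifPn.
Qed.

(** Meant for integrands of unknown measurability, such as those built on [derive1 (gamma u y x)]:
    positive and negative parts are compared separately, in both directions. *)
Lemma ae_eq_integralW (D : set T) (f g : T -> \bar R) :
  {ae mu, forall x, D x -> f x = g x} ->
  (\int[mu]_(x in D) f x = \int[mu]_(x in D) g x)%E.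
Proof.
move=> fg; rewrite [LHS]integral_mkcond [RHS]integral_mkcond.
rewrite [LHS]integralE [RHS]integralE.
have {}fg : {ae mu, forall x, (f \_ D) x = (g \_ D) x}.
  apply: filterS fg => x fgx; rewrite !patchE; case: ifPn => // /set_mem.
  exact: fgx.
congr (_ - _)%E; apply/eqP; rewrite eq_le; apply/andP; split;
  apply: ge0_ae_le_integral => //; apply: filterS fg => x.
- by rewrite !funeposE => ->.
- by rewrite !funeposE => ->.
- by rewrite !funenegE => ->.
- by rewrite !funenegE => ->.
Qed.

Lemma ae_eq_Rintegral (D : set T) (f g : T -> R) :
  {ae mu, forall x, D x -> f x = g x} ->
  \int[mu]_(x in D) f x = \int[mu]_(x in D) g x.
Proof.
move=> fg; rewrite /Rintegral; congr fine; apply: ae_eq_integralW.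
by apply: filterS fg => x + Dx => ->.
Qed.

Lemma bounded_integrable (D : set T) (f : T -> R) (c : R) : measurable D ->
  (mu D < +oo)%E -> measurable_fun D f -> (forall x, D x -> `|f x| <= c) ->
  mu.-integrable D (EFin \o f).
Proof.
move=> mD Doo mf fc; apply: measurable_bounded_integrable => //.
exists c; split; first exact: num_real.
by move=> M cM x Dx; apply: le_trans (fc x Dx) (ltW cM).
Qed.

(* Lebesgue measure lives on the Borel sets, which are not complete. *)
Definition ae_measurable (D : set T) (f : T -> R) : Prop :=
  exists2 g, measurable_fun D g & {ae mu, forall x, D x -> f x = g x}.

Lemma measurable_ae_measurable D f : measurable_fun D f -> ae_measurable D f.
Proof. by move=> mf; exists f => //; exact: aeW. Qed.

Let ae_measurable_seq D (f_ : nat -> T -> R) :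
  (forall n, ae_measurable D (f_ n)) -> exists g : nat -> T -> R,
  (forall n, measurable_fun D (g n)) /\
  (forall n, {ae mu, forall x, D x -> f_ n x = g n x}).
Proof.
move=> mf; have /choice[g gP] : forall n, exists g, measurable_fun D g /\
    {ae mu, forall x, D x -> f_ n x = g x}.
  by move=> n; have [g mg fg] := mf n; exists g.
by exists g; split => n; have [] := gP n.
Qed.

(** The measurable versions converge only off a null set [N]. Multiplying them and the limit by the
    indicator of its complement gives convergence everywhere on [D]. *)
Lemma ae_measurable_cvg D (f_ : nat -> T -> R) f : measurable D ->
  (forall n, ae_measurable D (f_ n)) ->
  {ae mu, forall x, D x -> f_ ^~ x @ \oo --> f x} -> ae_measurable D f.
Proof.
move=> mD mf ff; have [g [mg fg]] := ae_measurable_seq mf.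
have /= [N [mN N0 NP]] : {ae mu, forall x,
    (forall n, D x -> f_ n x = g n x) /\ (D x -> f_ ^~ x @ \oo --> f x)}.
  have {}fg := ae_foralln fg.
  by apply: filterS2 fg ff => x H1 H2; split.
have good x : D x -> ~ N x ->
    (forall n, f_ n x = g n x) /\ f_ ^~ x @ \oo --> f x.
  move=> Dx Nx; apply: contrapT => H; apply: Nx; apply: NP => /= -[H1 H2].
  by apply: H; split => [n|]; [exact: H1|exact: H2].
exists (fun x => f x * \1_(~` N) x); last first.
  exists N; split => // x /=; apply: contra_notP => Nx Dx.
  by rewrite indicE mem_set// mulr1.
apply: (@measurable_fun_cvg _ _ _ _ (fun n x => g n x * \1_(~` N) x)).
  move=> n; apply: measurable_funM; first exact: mg.
  by apply: measurable_indic; exact: measurableC.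
move=> x Dx; have [Nx|Nx] := pselect (N x).
  rewrite indicE memNset; last by move/(_ Nx).
  rewrite mulr0; under eq_fun do rewrite mulr0; exact: cvg_cst.
rewrite indicE mem_set// mulr1; under eq_fun do rewrite mulr1.
have [fgx] := good x Dx Nx; rewrite (_ : f_ ^~ x = g ^~ x)//.
by apply/funext => n; exact: fgx.
Qed.

(** Clipping a measurable version between [-|G|] and [|G|] changes it on a null set only, and turns
    almost-everywhere domination into domination at every point. *)
Lemma ae_measurable_integrable D f G : measurable D -> ae_measurable D f ->
  mu.-integrable D (EFin \o G) ->
  {ae mu, forall x, D x -> `|f x| <= G x} ->
  exists g, [/\ mu.-integrable D (EFin \o g), {ae mu, forall x, D x -> f x = g x}
    & forall x, D x -> `|g x| <= `|G x|].
Proof.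
move=> mD [g mg fg] iG fG.
have mG : measurable_fun D G by move/integrableP : iG => [/measurable_EFinP].
have mN : measurable_fun D (fun x => Num.max (- `|G x|) (Num.min `|G x| (g x))).
  apply: measurable_maxr; first by apply: measurable_funN; exact: measurableT_comp.
  by apply: measurable_minr => //; exact: measurableT_comp.
have bnd x : D x -> `|Num.max (- `|G x|) (Num.min `|G x| (g x))| <= `|G x|.
  move=> _; rewrite ler_norml le_max lexx/= ge_max ge_min lexx/= andbT.
  by rewrite ge0_cp.
exists (fun x => Num.max (- `|G x|) (Num.min `|G x| (g x))); split => //.
- apply: (@le_integrable _ _ _ _ _ mD _ (EFin \o G)) => //.
    exact/measurable_EFinP.
- apply: filterS2 fg fG => x fg fG Dx.
  have {}fG := fG Dx; rewrite -fg//.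
  have := le_trans fG (ler_norm _); rewrite ler_norml => /andP[h1 h2].
  by rewrite (min_idPr h2) (max_idPr h1).
Qed.

Lemma ae_le_integrable D (f G : T -> R) : measurable D -> measurable_fun D f ->
  mu.-integrable D (EFin \o G) -> {ae mu, forall x, D x -> `|f x| <= G x} ->
  mu.-integrable D (EFin \o f).
Proof.
move=> mD mf iG fG.
have [g [ig fg _]] := ae_measurable_integrable mD (measurable_ae_measurable mf) iG fG.
apply/integrableP; split; first exact/measurable_EFinP.
have /integrableP[_] := ig; apply: le_lt_trans; rewrite le_eqVlt; apply/orP; left.
by apply/eqP/ae_eq_integralW; apply: ae_imp fg => x H Dx /=; rewrite H.
Qed.

Lemma ae_bounded_Rintegral D f G : measurable D -> ae_measurable D f ->
  mu.-integrable D (EFin \o G) -> {ae mu, forall x, D x -> `|f x| <= G x} ->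
  `|\int[mu]_(x in D) f x| <= \int[mu]_(x in D) `|G x|.
Proof.
move=> mD mf iG fG; have [g [ig fg gG]] := ae_measurable_integrable mD mf iG fG.
rewrite (ae_eq_Rintegral fg); apply: le_trans (le_normr_Rintegral mD ig) _.
apply: le_Rintegral => //; first exact: integrable_norm.
exact: integrable_norm.
Qed.

(** All terms are replaced by measurable versions, which leaves the integrals unchanged. The limit
    may be built from derivatives selected by choice. *)
Lemma ae_dominated_convergence D (f_ : nat -> T -> R) f G : measurable D ->
  (forall n, ae_measurable D (f_ n)) ->
  {ae mu, forall x, D x -> f_ ^~ x @ \oo --> f x} ->
  (forall n, {ae mu, forall x, D x -> `|f_ n x| <= G x}) ->
  mu.-integrable D (EFin \o G) ->
  \int[mu]_(x in D) f_ n x @[n --> \oo] --> \int[mu]_(x in D) f x.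
Proof.
move=> mD mf ff fG iG.
have [f' mf' ff'] := ae_measurable_cvg mD mf ff.
have [g [mg fg]] := ae_measurable_seq mf.
have aefg := ae_foralln fg; have aefG := ae_foralln fG.
rewrite (ae_eq_Rintegral ff').
have -> : (fun n => \int[mu]_(x in D) f_ n x) = (fun n => \int[mu]_(x in D) g n x).
  by apply/funext => n; apply: ae_eq_Rintegral; exact: fg.
have [|||||if' _ cv] := @dominated_convergence _ _ _ mu D mD
    (fun n => EFin \o g n) (EFin \o f') (EFin \o G).
- by move=> n; apply/measurable_EFinP; exact: mg.
- exact/measurable_EFinP.
- apply: filterS3 ff ff' aefg => x h1 h2 h3 Dx.
  apply: cvg_EFin; first exact: nearW.
  rewrite -h2//; apply: cvg_trans (h1 Dx); apply: near_eq_cvg; apply: nearW => n.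
  by rewrite /= h3.
- exact: iG.
- apply: filterS2 aefg aefG => x h1 h2 n Dx.
  by rewrite /= lee_fin -h1//; exact: h2.
- apply: (@fine_cvg _ _ _ _ (fun n => \int[mu]_(x in D) (g n x)%:E)%E).
  by rewrite /Rintegral fineK//; exact: integrable_fin_num.
Qed.

End ae_measurable.

(** * Derivatives of bond energies *)

Section sequential_limits.
Context {R : realType}.

(** Dominated convergence speaks of sequences; this transfers it to filters. If the limit failed,
    points of [A] within [1 / (n + 1)] of [t] with values more than [e] away from [l] would form a
    bad sequence. *)
Lemma cvg_within_seq (A : set R) (F : R -> R) (t l : R) :
  (forall s : nat -> R, (forall n, A (s n)) -> s n @[n --> \oo] --> t ->
     F (s n) @[n --> \oo] --> l) ->
  F s @[s --> within A (nbhs t)] --> l.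
Proof.
move=> H; apply/cvgrPdist_le => e e0; apply: contrapT => nF.
have /choice[s sP] : forall n : nat,
    exists x, [/\ A x, `|x - t| < n.+1%:R^-1 & e < `|l - F x| ].
  move=> n; apply: contrapT => nx; apply: nF.
  have n0 : 0 < n.+1%:R^-1 :> R by rewrite invr_gt0.
  rewrite near_withinE; apply: filterS (nbhsx_ballx t _ n0) => x tx Ax.
  have [//|eF] := leP `|l - F x| e; exfalso; apply: nx; exists x; split => //.
  by rewrite distrC.
have st : s n @[n --> \oo] --> t.
  apply/cvgrPdist_lt => d d0; near=> n.
  have [_ + _] := sP n; rewrite distrC => /lt_trans; apply.
  by near: n; exact: near_infty_natSinv_lt (PosNum d0).
have As n : A (s n) by have [] := sP n.
have /cvgrPdist_le/(_ _ e0) := H s As st; case=> N _ /(_ N (leqnn N))/=.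
by have [_ _] := sP N; rewrite ltNge => /negP.
Unshelve. all: by end_near. Qed.

Lemma is_derivative_on_seq (T : R) (f : R -> R) (t l : R) :
  (forall s : nat -> R, (forall n, 0 <= s n <= T) -> (forall n, s n != t) ->
     s n @[n --> \oo] --> t ->
     (f (s n) - f t) / (s n - t) @[n --> \oo] --> l) ->
  is_derivative_on T f t l.
Proof.
move=> H.
have := @cvg_within_seq [set s | 0 <= s <= T /\ s != t]
  (fun s => (f s - f t) / (s - t)) t l.
rewrite /is_derivative_on => cv; apply: cvg_trans (cv _) => [|s As st].
  move=> P; rewrite /nbhs/= /within/= => nP; rewrite /dnbhs /within/=.
  apply: filterS nP => s Ps snt; rewrite in_itv/= => sT.
  exact: Ps.
by apply: H => // n; have [] := As n.
Qed.

(** Supplies the increments that [strict_deriv_cvg] asks for. Moving away from the nearer end by at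
    most [T / 2] stays in the interval. *)
Lemma itv_limit_point (T : R) : 0 < T -> forall x : R, 0 <= x <= T ->
  forall e : R, 0 < e -> exists y, [/\ 0 <= y <= T, y != x & `|y - x| < e].
Proof.
move=> T0 x /andP[x0 xT] e e0.
have [xh|xh] := leP x (T / 2).
  exists (x + Num.min (T / 2) (e / 2)).
  have m0 : 0 < Num.min (T / 2) (e / 2) by rewrite lt_min !divr_gt0.
  have m1 : Num.min (T / 2) (e / 2) <= T / 2 by rewrite ge_min lexx.
  have m2 : Num.min (T / 2) (e / 2) <= e / 2 by rewrite ge_min lexx orbT.
  split; first by apply/andP; split; lra.
    by rewrite gt_eqF// ltrDl.
  by rewrite addrAC subrr add0r gtr0_norm//; lra.
exists (x - Num.min (T / 2) (e / 2)).
have m0 : 0 < Num.min (T / 2) (e / 2) by rewrite lt_min !divr_gt0.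
have m1 : Num.min (T / 2) (e / 2) <= T / 2 by rewrite ge_min lexx.
have m2 : Num.min (T / 2) (e / 2) <= e / 2 by rewrite ge_min lexx orbT.
split; first by apply/andP; split; lra.
  by rewrite lt_eqF// gtrBl.
by rewrite addrAC subrr add0r normrN gtr0_norm//; lra.
Qed.

Lemma itv_limit_seq (T : R) : 0 < T -> forall x : R, 0 <= x <= T ->
  exists s : nat -> R, [/\ forall n, 0 <= s n <= T, forall n, s n != x &
    s n @[n --> \oo] --> x].
Proof.
move=> T0 x xT.
have /choice[s sP] : forall n : nat, exists y : R,
    [/\ 0 <= y <= T, y != x & `|y - x| < n.+1%:R^-1].
  by move=> n; apply: itv_limit_point.
exists s; split => [n|n|]; [by have [] := sP n|by have [] := sP n|].
apply/cvgrPdist_lt => d d0; near=> n.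
have [_ _] := sP n; rewrite distrC => /lt_trans; apply.
by near: n; exact: near_infty_natSinv_lt (PosNum d0).
Unshelve. all: by end_near. Qed.

Lemma strict_deriv_is_derivative_on (T : R) (f : R -> R) (t l : R) :
  0 <= t <= T -> strict_deriv `[0, T] f t l -> is_derivative_on T f t l.
Proof.
move=> tT sf; apply: is_derivative_on_seq => s sT st sct.
by apply: strict_deriv_quotient sf => //= [|n]; rewrite in_itv.
Qed.

(** The error is the integral of [phi - l] between [q] and [p], so an almost-everywhere bound near
    [t] is enough, with both ends free. *)
Lemma strict_deriv_primitive (T : R) (phi : R -> R) (t l : R) :
  lebesgue_measure.-integrable `[0, T] (EFin \o phi) ->
  (forall e : R, 0 < e -> exists2 delta : R, 0 < delta &
     {ae lebesgue_measure, forall tau : R, 0 <= tau <= T ->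
        `|tau - t| < delta -> `|phi tau - l| <= e}) ->
  strict_deriv `[0, T]
    (fun s => \int[lebesgue_measure]_(tau in `[0, s]) phi tau) t l.
Proof.
move=> iphi H e e0; have [dl dl0 Hdl] := H e e0; exists dl => // p q.
wlog qp : p q / q <= p => [wl pT qT pd qd|].
  have [qp|/ltW pq] := leP q p; first exact: wl.
  have := wl q p pq qT pT qd pd.
  rewrite (distrC q p); apply: le_trans.
  by rewrite -normrN le_eqVlt; apply/orP; left; apply/eqP; congr `| _ |; ring.
rewrite /= !in_itv/= => /andP[p0 pT] /andP[q0 qT] pd qd.
have ip : lebesgue_measure.-integrable `[0, p] (EFin \o phi).
  by apply: integrableS iphi => //; apply: subset_itvl; rewrite bnd_simp.
rewrite (@Rintegral_itvB _ phi (BLeft 0) (BRight p) q ip); last 2 first.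
- by rewrite bnd_simp.
- by rewrite bnd_simp.
have iqp : lebesgue_measure.-integrable `]q, p] (EFin \o phi).
  by apply: integrableS ip => //; apply: subset_itvr; rewrite bnd_simp.
have mI : lebesgue_measure `]q, p]%classic = (p - q)%:E.
  rewrite lebesgue_measure_itv/= lte_fin; case: ltP => // pq.
  have -> : p = q by apply/eqP; rewrite eq_le pq qp.
  by rewrite subrr.
have icst (x : R) : lebesgue_measure.-integrable `]q, p] (EFin \o cst x).
  apply: (@bounded_integrable _ _ _ lebesgue_measure _ _ `|x|) => //=.
  by rewrite [X in (X < _)%E]mI ltry.
have -> : (p - q) * l = \int[lebesgue_measure]_(tau in `]q, p]) cst l tau.
  by rewrite Rintegral_cst// [X in fine X]mI/= mulrC.
rewrite -RintegralB//.
have -> : e * `|p - q| = \int[lebesgue_measure]_(tau in `]q, p]) `|cst e tau|.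
  by rewrite /= Rintegral_cst// [X in fine X]mI/= ger0_norm ?subr_ge0// gtr0_norm.
have aeb : {ae lebesgue_measure, forall tau : R, `]q, p]%classic tau ->
    `|phi tau - cst l tau| <= cst e tau}.
  move: Hdl; apply: ae_imp => tau; rewrite /= in_itv/= => + /andP[qt tp].
  apply; first by rewrite (le_trans q0 (ltW qt)) (le_trans tp pT).
  move: pd qd; rewrite !ltr_norml => /andP[? ?] /andP[? ?].
  by apply/andP; split; lra.
apply: ae_bounded_Rintegral => //.
apply: measurable_ae_measurable; apply: measurable_funB => //.
by case/integrableP : iqp => /measurable_EFinP.
Qed.

End sequential_limits.

(** * Differentiation of energies over an abstract space of bonds *)

Section weighted_energy.
Context d {Z : measurableType d} {R : realType}.
Variable m : {measure set Z -> \bar R}.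
Variables (T : R) (k c : Z -> R) (r gam : R -> Z -> R) (g : R -> R) (G0 G1 : R).
Hypotheses (T0 : 0 < T) (k0 : forall z, 0 <= k z) (c0 : forall z, 0 <= c z).
Hypotheses (mk : measurable_fun setT k) (ik : m.-integrable setT (EFin \o k)).
Hypothesis ikc : m.-integrable setT (EFin \o (fun z => k z * c z)).
Hypothesis mr : forall s, 0 <= s <= T -> measurable_fun setT (r s).
Hypothesis mgam : forall s, 0 <= s <= T -> measurable_fun setT (gam s).
Hypothesis lip_r : forall z, lipschitz_on T (r ^~ z) (c z).
Hypothesis lip_gam : forall z, lipschitz_on T (gam ^~ z) (c z).
Hypothesis bnd_gam : forall s z, `|gam s z| <= 1.
Hypotheses (G0_ge0 : 0 <= G0) (G1_ge0 : 0 <= G1) (bnd_g : forall x, `|g x| <= G0).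
Hypothesis mg : measurable_fun setT g.
Hypothesis lip_g : forall x y, `|g x - g y| <= G1 * `|x - y|.
Variable g' : R -> R.
Hypothesis strict_g : forall x, strict_deriv setT g x (g' x).

Let mgr s : 0 <= s <= T -> measurable_fun setT (fun z => g (r s z)).
Proof. by move=> sT; apply: measurableT_comp => //; exact: mr. Qed.

Let tT_itv (t : R) : 0 <= t <= T -> `[0, T]%classic t.
Proof. by rewrite /= in_itv. Qed.

Let quot_le (f : R -> R) L s t : 0 <= s <= T -> 0 <= t <= T -> s != t ->
  lipschitz_on T f L -> `|(f s - f t) / (s - t)| <= L.
Proof.
move=> sT tT st Lf; rewrite normrM normfV ler_pdivrMr ?normr_gt0 ?subr_eq0//.
exact: Lf.
Qed.

Let ikcM (M : R) : m.-integrable setT (EFin \o (fun z => M * (k z * c z))).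
Proof.
rewrite (_ : _ \o _ = (fun z => M%:E * (k z * c z)%:E)%E)//.
by apply: integrableZl => //; exact: ikc.
Qed.

(** In the application [Z] consists of pairs of points, [k] is the kernel, and [c z] is a multiple
    of [|y - x|^(-1/2)]. Lipschitz constants in time are thus unbounded over the bonds, and
    dominations rest on the integrability of [k * c]. *)
Definition wenergy s := \int[m]_z (k z * gam s z * g (r s z)).

Let integrable_kgg s t : 0 <= s <= T -> 0 <= t <= T ->
  m.-integrable setT (EFin \o (fun z => k z * gam s z * g (r t z))).
Proof.
move=> sT tT; apply: (@le_integrable _ _ _ m setT _ _
  (EFin \o (fun z => G0 * k z))) => //=.
- apply/measurable_EFinP; apply: measurable_funM; last exact: mgr.
  by apply: measurable_funM => //; exact: mgam.
- move=> z _; rewrite lee_fin normrM normrM (ger0_norm (k0 z)) normrM.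
  rewrite (ger0_norm (k0 z)) (ger0_norm G0_ge0) mulrC.
  by apply: ler_pM => //; [exact: mulr_ge0|exact: ler_piMr].
- rewrite (_ : _ \o _ = (fun z => G0%:E * (k z)%:E)%E)//.
  by apply: integrableZl => //; exact: ik.
Qed.

Section rate.
Variables (t : R) (dgam dr : Z -> R).
Hypothesis tT : 0 <= t <= T.
Hypothesis sd_gam : {ae m, forall z, strict_deriv `[0, T] (gam ^~ z) t (dgam z)}.

(** With [dgam] the time derivative of [gam], this is the damage rate with the opposite sign. *)
Definition wflux := \int[m]_z (k z * dgam z * g (r t z)).

Let flux_cvg (s : nat -> R) : (forall n, 0 <= s n <= T) ->
  (forall n, s n != t) -> s n @[n --> \oo] --> t ->
  {ae m, forall z, setT z ->
    k z * ((gam (s n) z - gam t z) / (s n - t)) * g (r t z) @[n --> \oo] -->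
    k z * dgam z * g (r t z)}.
Proof.
move=> sT st sct; apply: ae_imp sd_gam => z sd _.
apply: cvgM; last exact: cvg_cst.
apply: cvgM; first exact: cvg_cst.
by apply: (strict_deriv_quotient (tT_itv tT) _ st sct sd) => n; exact: tT_itv.
Qed.

Let flux_meas (s : R) : 0 <= s <= T -> measurable_fun setT
  (fun z => k z * ((gam s z - gam t z) / (s - t)) * g (r t z)).
Proof.
move=> sT; apply: measurable_funM; last exact: mgr.
apply: measurable_funM => //; apply: measurable_funM => //.
by apply: measurable_funB; exact: mgam.
Qed.

Let flux_bnd (s : R) : 0 <= s <= T -> s != t -> forall z,
  `|k z * ((gam s z - gam t z) / (s - t)) * g (r t z)| <= G0 * (k z * c z).
Proof.
move=> sT st z; rewrite normrM normrM (ger0_norm (k0 z)) mulrC.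
apply: ler_pM => //; first exact: mulr_ge0.
by apply: ler_wpM2l => //; exact: (quot_le sT tT st (lip_gam z)).
Qed.

(** Whatever selection produced [dgam], at a fixed time it is almost everywhere a limit of
    measurable difference quotients along one sequence of times. *)
Lemma ae_measurable_flux :
  ae_measurable m setT (fun z => k z * dgam z * g (r t z)).
Proof.
have [s [sT st sct]] := itv_limit_seq T0 tT.
apply: (ae_measurable_cvg _ _ (flux_cvg sT st sct)) => // n.
by apply: measurable_ae_measurable; exact: flux_meas.
Qed.

Lemma ae_flux_le :
  {ae m, forall z, setT z -> `|k z * dgam z * g (r t z)| <= G0 * (k z * c z)}.
Proof.
have [s [sT st sct]] := itv_limit_seq T0 tT.
apply: ae_imp (flux_cvg sT st sct) => z /(_ I) cv _.
apply: (cvgr_to_le (cvg_norm cv)).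
by apply: nearW => n; exact: flux_bnd.
Qed.

Lemma wenergy_rate :
  {ae m, forall z, strict_deriv `[0, T] (r ^~ z) t (dr z)} ->
  is_derivative_on T wenergy t
    (wflux + \int[m]_z (k z * gam t z * (g' (r t z) * dr z))).
Proof.
move=> sd_r; apply: is_derivative_on_seq => s sT st sct.
(* Discrete product rule: the quotient of [gam * g (r)] is [A n + B n], where [g (r)] is frozen at
   [t] in [A] while [gam] is taken at the new time in [B], where it is bounded by 1 and
   converges. *)
pose A n z := k z * ((gam (s n) z - gam t z) / (s n - t)) * g (r t z).
pose B n z := k z * gam (s n) z * ((g (r (s n) z) - g (r t z)) / (s n - t)).
have mA n : measurable_fun setT (A n) by exact: flux_meas.
have mB n : measurable_fun setT (B n).
  apply: measurable_funM; first by apply: measurable_funM => //; exact: mgam.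
  by apply: measurable_funM => //; apply: measurable_funB; exact: mgr.
have bB n z : `|B n z| <= G1 * (k z * c z).
  rewrite /B normrM normrM (ger0_norm (k0 z)) mulrCA -mulrA.
  apply: ler_wpM2l => //; rewrite -[leRHS]mul1r; apply: ler_pM => //.
  apply: (@quot_le (fun s => g (r s z))) => // p q pT qT.
  by apply: (le_trans (lip_g _ _)); rewrite -mulrA ler_wpM2l//; exact: lip_r.
have iA n : m.-integrable setT (EFin \o A n).
  apply: (@le_integrable _ _ _ m setT _ _ (EFin \o (fun z => G0 * (k z * c z)))) => //=.
    exact/measurable_EFinP.
  move=> z _; rewrite lee_fin [leRHS]ger0_norm ?mulr_ge0//; exact: flux_bnd.
have iB n : m.-integrable setT (EFin \o B n).
  apply: (@le_integrable _ _ _ m setT _ _ (EFin \o (fun z => G1 * (k z * c z)))) => //=.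
    exact/measurable_EFinP.
  by move=> z _; rewrite lee_fin [leRHS]ger0_norm ?mulr_ge0.
rewrite (_ : (fun n => _) = (fun n => \int[m]_z A n z + \int[m]_z B n z)); last first.
  apply/funext => n; rewrite -RintegralD// /wenergy -RintegralB//; last 2 first.
  - exact: integrable_kgg.
  - exact: integrable_kgg.
  rewrite mulrC -RintegralZl//; last first.
    exact: (integrableB measurableT (integrable_kgg (sT n) (sT n))
      (integrable_kgg tT tT)).
  apply: eq_Rintegral => z _; rewrite /A /B; field.
  by rewrite subr_eq0.
apply: cvgD.
  apply: (@ae_dominated_convergence _ _ _ m setT A _ (fun z => G0 * (k z * c z))) => //.
  - by move=> n; exact: measurable_ae_measurable.
  - exact: flux_cvg.
  - by move=> n; apply: aeW => z _; exact: flux_bnd.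
apply: (@ae_dominated_convergence _ _ _ m setT B _ (fun z => G1 * (k z * c z))) => //.
- by move=> n; exact: measurable_ae_measurable.
- apply: ae_imp sd_r => z sd _; apply: cvgM.
    apply: cvgM; first exact: cvg_cst.
    apply/cvgrPdist_le => e e0.
    have e'0 : 0 < e / (c z + 1) by rewrite divr_gt0// ltr_wpDl.
    move/cvgrPdist_le : sct => /(_ _ e'0); apply: filterS => n H.
    apply: (le_trans (lip_gam z tT (sT n))).
    apply: (@le_trans _ _ ((c z + 1) * (e / (c z + 1)))).
      by apply: ler_pM => //; rewrite lerDl.
    by rewrite mulrC divfK// gt_eqF// ltr_wpDl.
  apply: (@strict_deriv_quotient _ `[0, T]%classic (g \o r ^~ z) t _ s
    (tT_itv tT) _ st sct) => [n|]; first exact: tT_itv.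
  apply: (strict_deriv_comp (tT_itv tT) sd); exact: strict_g.
- by move=> n; apply: aeW => z _.
Qed.

End rate.

Lemma wflux_cvg t dgam (s : nat -> R) (dgams : nat -> Z -> R) :
  0 <= t <= T -> (forall n, 0 <= s n <= T) -> s n @[n --> \oo] --> t ->
  {ae m, forall z, strict_deriv `[0, T] (gam ^~ z) t (dgam z)} ->
  (forall n, {ae m, forall z, strict_deriv `[0, T] (gam ^~ z) (s n) (dgams n z)}) ->
  wflux (s n) (dgams n) @[n --> \oo] --> wflux t dgam.
Proof.
move=> tT sT sct sd sds.
apply: (@ae_dominated_convergence _ _ _ m setT _ _ (fun z => G0 * (k z * c z))) => //.
- by move=> n; exact: ae_measurable_flux.
- have {}sds := ae_foralln sds.
  apply: ae_imp2 sd sds => z sd sds _.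
  apply: cvgM.
    apply: cvgM; first exact: cvg_cst.
    apply: (strict_deriv_cvg _ sct _ sd sds) => [n|].
      exact: tT_itv.
    move=> x; rewrite /= in_itv/= => xT e e0.
    by have [y [? ? ?]] := itv_limit_point T0 xT e0; exists y; split => //; rewrite in_itv.
  apply/cvgrPdist_le => e e0.
  have K0 : 0 < G1 * c z + 1 by rewrite ltr_wpDl// mulr_ge0.
  have e'0 : 0 < e / (G1 * c z + 1) by rewrite divr_gt0.
  move/cvgrPdist_le : sct => /(_ _ e'0); apply: filterS => n H.
  apply: (le_trans (lip_g _ _)).
  apply: (@le_trans _ _ (G1 * (c z * `|t - s n|))).
    by rewrite ler_wpM2l//; exact: lip_r.
  rewrite mulrA; apply: (@le_trans _ _ ((G1 * c z + 1) * (e / (G1 * c z + 1)))).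
    by apply: ler_pM => //; [rewrite mulr_ge0|rewrite lerDl].
  by rewrite mulrC divfK// gt_eqF.
- by move=> n; exact: ae_flux_le.
Qed.

Lemma wflux_bounded t dgam : 0 <= t <= T ->
  {ae m, forall z, strict_deriv `[0, T] (gam ^~ z) t (dgam z)} ->
  `|wflux t dgam| <= \int[m]_z `|G0 * (k z * c z)|.
Proof.
move=> tT sd; apply: ae_bounded_Rintegral => //.
- exact: ae_measurable_flux.
- exact: ae_flux_le.
Qed.

(* [phi] is not assumed to be measurable: on [A] the flux is continuous, by
   dominated convergence, because strict derivatives are. *)
Lemma wdamage_rate (A : set R) (dgam : R -> Z -> R) (phi : R -> R) :
  measurable A -> A `<=` `[0, T] ->
  {ae lebesgue_measure, forall s, 0 <= s <= T -> A s} ->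
  (forall s, A s -> {ae m, forall z, strict_deriv `[0, T] (gam ^~ z) s (dgam s z)}) ->
  {ae lebesgue_measure, forall s, 0 <= s <= T -> phi s = wflux s (dgam s)} ->
  forall t, A t -> is_derivative_on T
    (fun s => - \int[lebesgue_measure]_(tau in `[0, s]) phi tau) t (- wflux t (dgam t)).
Proof.
move=> mA A_T aeA sdA aephi t At.
have AT s : A s -> 0 <= s <= T by move=> /A_T; rewrite /= in_itv.
(* A measurable version of [phi]: continuity on the subspace [A] suffices for measurability, and
   times outside [A] are sent to 0. *)
pose Phi s := wflux s (dgam s) * \1_A s.
pose C := \int[m]_z `|G0 * (k z * c z)|.
have cvPhi x : A x -> forall s : nat -> R, (forall n, A (s n)) ->
    s n @[n --> \oo] --> x -> wflux (s n) (dgam (s n)) @[n --> \oo] --> wflux x (dgam x).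
  move=> Ax s As sx; apply: wflux_cvg => //; [exact: AT|by move=> n; exact: AT| |].
  - exact: sdA.
  - by move=> n; exact: sdA.
have cont : {within A, continuous (fun s => wflux s (dgam s))}.
  rewrite continuous_subspace_in => x /set_mem Ax.
  have := @cvg_within_seq _ A (fun s => wflux s (dgam s)) x _ (cvPhi x Ax).
  rewrite /continuous_at (nbhs_subspace_in Ax) => cv.
  by apply: cvg_trans cv; apply: cvg_app.
have mPhi : measurable_fun `[0, T] Phi.
  rewrite /Phi (_ : (fun s => _) = (fun s => wflux s (dgam s)) \_ A); last first.
    by apply/funext => s; rewrite patchE indicE; case: ifPn; rewrite ?mulr1 ?mulr0.
  apply: (@measurable_funS _ _ _ _ setT) => //.
  apply/measurable_restrict => //; rewrite setTI.
  exact: subspace_continuous_measurable_fun cont.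
have bPhi s : `|Phi s| <= C.
  rewrite /Phi indicE; have [/set_mem As|_] := boolP (s \in A).
    by rewrite mulr1; apply: wflux_bounded; [exact: AT|exact: sdA].
  by rewrite mulr0 normr0; apply: Rintegral_ge0.
have iPhi : lebesgue_measure.-integrable `[0, T] (EFin \o Phi).
  apply: (@bounded_integrable _ _ _ lebesgue_measure _ _ C) => //=.
  by rewrite lebesgue_measure_itv/= lte_fin T0 -EFinD ltry.
have aephi' : {ae lebesgue_measure, forall s, 0 <= s <= T -> phi s = Phi s}.
  apply: ae_imp2 aephi aeA => s + As sT; rewrite /Phi indicE mem_set; last exact: As.
  by rewrite mulr1; apply.
have sd : strict_deriv `[0, T]
    (fun s => \int[lebesgue_measure]_(tau in `[0, s]) Phi tau) t (wflux t (dgam t)).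
  apply: strict_deriv_primitive => // e e0.
  have /cvgrPdist_le/(_ e e0) :=
    @cvg_within_seq _ A (fun s => wflux s (dgam s)) t _ (cvPhi t At).
  rewrite near_withinE => /nbhs_ballP[dl /= dl0 H]; exists dl => //.
  apply: ae_imp aeA => s As sT sd.
  rewrite /Phi indicE mem_set; last exact: As.
  by rewrite mulr1 distrC; apply: H; [rewrite /ball/= distrC|exact: As].
apply: strict_deriv_is_derivative_on; first exact: AT.
have := strict_derivZ (-1) sd; rewrite mulN1r.
apply: (@strict_deriv_near _ _ _ _ _ _ 1) => // p; rewrite /= in_itv/= => /andP[p0 pT] _.
rewrite mulN1r; congr (- _); apply: ae_eq_Rintegral.
apply: ae_imp aephi' => s + /=; rewrite in_itv/= => H /andP[s0 sp].
by apply: H; rewrite s0 (le_trans sp).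
Qed.

End weighted_energy.

(** * Trajectories of paths in L^oo *)

Lemma rat_dense_le {R : realType} (f : R -> R) (c d : R) : continuous f ->
  (forall a : rat, c < ratr a < d -> f (ratr a) <= 0) ->
  forall s : R, c < s < d -> f s <= 0.
Proof.
move=> cf H s /andP[cs sd]; rewrite leNgt; apply/negP => fs.
have h1 := @cvgr_gt _ _ (nbhs s) (nbhs_filter s) f _ (cf s) _ fs.
have h2 := @cvgr_gt _ _ (nbhs s) (nbhs_filter s) id s (@cvg_id _ _) _ cs.
have h3 := @cvgr_lt _ _ (nbhs s) (nbhs_filter s) id s (@cvg_id _ _) _ sd.
have /nbhs_ballP[e /= e0 He] :=
  @filterI _ _ (nbhs_filter s) _ _ h1 (@filterI _ _ (nbhs_filter s) _ _ h2 h3).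
have [x [xe [y _ yx]]] := @dense_rat R (ball s e)
  ltac:(by exists s; exact: ballxx) ltac:(exact: ball_open).
have [fy [cy yd]] := He _ xe; rewrite -yx in fy cy yd.
by have := H y; rewrite cy yd => /(_ isT); rewrite leNgt fy.
Qed.

Section clamp.
Context {R : realType}.
Variable T : R.
Hypothesis T0 : 0 <= T.

(** Projection onto [[0, T]]: the rationals become a countable dense family of times, both ends
    included, and a continuous function on [[0, T]] extends continuously to the line. *)
Definition clamp (s : R) : R := Num.min (Num.max s 0) T.

Lemma clamp_itv s : 0 <= clamp s <= T.
Proof. by rewrite /clamp le_min le_max lexx orbT T0/= ge_min lexx orbT. Qed.

Lemma clamp_id s : 0 <= s <= T -> clamp s = s.
Proof. by move=> /andP[s0 sT]; rewrite /clamp (max_idPl s0) (min_idPl sT). Qed.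

Lemma clamp_lip s t : `|clamp s - clamp t| <= `|s - t|.
Proof.
rewrite /clamp /Num.min /Num.max.
case: (ltP s 0) => s0; case: (ltP t 0) => t0;
repeat (case: ifP => [|/negbT]; rewrite -?leNgt => ?); rewrite ?subrr ?normr0//;
by rewrite ler_norml; have := ler_norm (s - t); have := ler_norm (t - s);
  rewrite (distrC t s) => *; apply/andP; split; lra.
Qed.

Lemma continuous_clamp : continuous clamp.
Proof.
move=> s; apply/cvgrPdist_le => e e0; near=> t.
apply: (le_trans (clamp_lip _ _)); near: t; exact: (@cvgr_dist_le _ _ _ (nbhs s) _ id s).
Unshelve. all: by end_near. Qed.

Lemma continuous_comp_clamp (f : R -> R) :
  (forall t : R, 0 <= t <= T -> forall e : R, 0 < e -> exists2 delta : R, 0 < delta &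
     forall s : R, 0 <= s <= T -> `|s - t| < delta -> `|f s - f t| <= e) ->
  continuous (f \o clamp).
Proof.
move=> H s; apply/cvgrPdist_le => e e0.
have [dl dl0 Hd] := H _ (clamp_itv s) e e0.
have : \forall t \near s, `|s - t| < dl by exact: (@cvgr_dist_lt _ _ _ (nbhs s) _ id s).
apply: filterS => t st; rewrite distrC /=; apply: Hd; first exact: clamp_itv.
by apply: (le_lt_trans (clamp_lip _ _)); rewrite distrC.
Qed.

End clamp.

(** * Pointwise consequences of estimates in the essential supremum norm *)

Section essential_bounds.
Context {R : realType} {d : nat}.
Variable Omega : set 'rV[R]_d.
Local Notation mu := (lebesgue_rV d).
Local Notation vfield := ('rV[R]_d -> 'rV[R]_d).

Lemma coord_le_enorm (x : 'rV[R]_d) i : `|x ord0 i| <= enorm x.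
Proof.
rewrite /enorm -sqrtr_sqr ler_wsqrtr// /dotr expr2 (bigD1 i)//= lerDl.
by apply: sumr_ge0 => j _; rewrite -expr2 sqr_ge0.
Qed.

Lemma Linf_norm_le (w : vfield) (K : \bar R) : (Linf_norm Omega w <= K)%E ->
  {ae mu, forall x, Omega x -> forall i, (`|w x ord0 i|%:E <= K)%E}.
Proof.
rewrite /Linf_norm unlock /=; case: ifPn => [_|].
  move=> wK; have := ess_sup_ge mu (abse \o (fun x => (enorm (w x) * \1_Omega x)%:E)).
  apply: ae_imp => x /= H Ox i; apply: le_trans wK; apply: le_trans H.
  rewrite indicE mem_set// mulr1 lee_fin.
  by rewrite (le_trans (coord_le_enorm _ i))// ler_norm.
(* The norm is defined by a separate case when the whole space is null; every property then holds
   almost everywhere. *)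
rewrite -leNgt => muT _; exists setT; split => //.
by apply/eqP; rewrite eq_le muT measure_ge0.
Qed.

Lemma Linf_norm_lt (w : vfield) (K : R) : (Linf_norm Omega w < K%:E)%E ->
  {ae mu, forall x, Omega x -> forall i, `|w x ord0 i| <= K}.
Proof.
move=> /ltW/Linf_norm_le; apply: ae_imp => x H Ox i.
by have := H Ox i; rewrite lee_fin.
Qed.

Lemma cvg_ereal0_lt (F : set_system R) (f : R -> \bar R) {FF : Filter F} :
  f x @[x --> F] --> (0 : \bar R) -> forall e : R, 0 < e ->
  \forall x \near F, (f x < e%:E)%E.
Proof.
move=> cf e e0; apply: (cf [set y | (y < e%:E)%E]).
by apply: open_nbhs_nbhs; split; [exact: open_ereal_lt_ereal|rewrite /= lte_fin].
Qed.

Variable T : R.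
Hypothesis T0 : 0 < T.

Lemma Linf_continuousP (w : R -> vfield) : Linf_continuous Omega T w ->
  forall t : R, 0 <= t <= T -> forall e : R, 0 < e -> exists2 delta : R, 0 < delta &
    forall s : R, 0 <= s <= T -> `|s - t| < delta ->
    {ae mu, forall x, Omega x -> forall i, `|w s x ord0 i - w t x ord0 i| <= e}.
Proof.
move=> cw t tT e e0.
have : \forall s \near within `[0, T] (nbhs t),
    (Linf_norm Omega (w s \- w t)%R < e%:E)%E.
  exact: cvg_ereal0_lt (cw t tT) _ e0.
rewrite near_withinE => /(@nbhs_ballP R R t _)[dl /= dl0 H]; exists dl => // s sT sd.
have : (Linf_norm Omega (w s \- w t)%R < e%:E)%E.
  by apply: H; rewrite /ball/= ?in_itv//= distrC.
move/Linf_norm_lt; apply: ae_imp => x Hx Ox i.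
by have := Hx Ox i; rewrite !mxE.
Qed.

(** The null set depends on [s]. Multiplying out by [s - t] also covers [s = t], which the punctured
    limit omits. *)
Lemma Linf_derivativeP (u v : R -> vfield) : Linf_derivative Omega T u v ->
  forall t : R, 0 <= t <= T -> forall e : R, 0 < e -> exists2 delta : R, 0 < delta &
    forall s : R, 0 <= s <= T -> `|s - t| < delta ->
    {ae mu, forall x, Omega x -> forall i,
      `|u s x ord0 i - u t x ord0 i - (s - t) * v t x ord0 i| <= e * `|s - t|}.
Proof.
move=> cw t tT e e0.
have : \forall s \near within `[0, T] t^',
    (Linf_norm Omega (fun x => (s - t)^-1 *: (u s x - u t x) - v t x)%R < e%:E)%E.
  exact: cvg_ereal0_lt (cw t tT) _ e0.
rewrite near_withinE /dnbhs near_withinE => /(@nbhs_ballP R R t _)[dl /= dl0 H]; exists dl => // s sT sd.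
have [->|st] := eqVneq s t.
  by apply: aeW => x _ i; rewrite !subrr mul0r subrr normr0 mulr0.
have : (Linf_norm Omega
    (fun x => (s - t)^-1 *: (u s x - u t x) - v t x)%R < e%:E)%E.
  by apply: H; rewrite /ball/= ?in_itv//= distrC.
move/Linf_norm_lt; apply: ae_imp => x Hx Ox i.
have := Hx Ox i; rewrite !mxE => {}Hx.
have st0 : s - t != 0 by rewrite subr_eq0.
rewrite (_ : _ - _ - _ = ((s - t)^-1 * (u s x ord0 i - u t x ord0 i) - v t x ord0 i)
  * (s - t)); last by field.
by rewrite normrM ler_wpM2r.
Qed.

(** Cousin's lemma plays the part of compactness: near [c], continuity gives the bound at [c]
    increased by 1, and finitely many such bounds have a maximum. *)
Lemma Linf_bounded_path (v : R -> vfield) :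
  (forall t, 0 <= t <= T -> (Linf_norm Omega (v t) < +oo)%E) ->
  Linf_continuous Omega T v ->
  exists2 L : R, 0 <= L & forall t, 0 <= t <= T ->
    {ae mu, forall x, Omega x -> forall i, `|v t x ord0 i| <= L}.
Proof.
move=> vX cv.
apply: (@cousin _ (fun p q => exists2 L : R, 0 <= L & forall t, p <= t <= q ->
  {ae mu, forall x, Omega x -> forall i, `|v t x ord0 i| <= L})).
- exact: ltW.
- move=> x y z _ _ _ _ [L1 L10 H1] [L2 L20 H2]; exists (Num.max L1 L2).
    by rewrite le_max L10.
  move=> t /andP[xt tz]; have [ty|/ltW yt] := leP t y.
    by apply: ae_imp (H1 t _) => [s H Os i|]; rewrite ?xt// le_max H.
  by apply: ae_imp (H2 t _) => [s H Os i|]; rewrite ?yt// le_max H ?orbT.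
- move=> c cT; have [dl dl0 H] := Linf_continuousP cv cT (ltr01 : 0 < 1 :> R).
  exists dl => // x y x0 xc cy yT yx.
  have [K K0 HK] : exists2 K : R, 0 <= K & {ae mu, forall x, Omega x -> forall i,
      `|v c x ord0 i| <= K}.
    have := vX c cT.
    have := Linf_norm_le (lexx (Linf_norm Omega (v c))).
    have : (0 <= Linf_norm Omega (v c))%E by exact: Lnorm_ge0.
    case: (Linf_norm Omega (v c)) => [r r0 H' _|//|//].
    by exists r => //; apply: ae_imp H' => s H' Os i; have := H' Os i; rewrite lee_fin.
  exists (K + 1); first by rewrite addr_ge0.
  move=> t /andP[xt ty].
  have tT : 0 <= t <= T by rewrite (le_trans x0 xt) (le_trans ty yT).
  have tc : `|t - c| < dl.
    by rewrite ltr_norml; apply/andP; split; lra.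
  apply: ae_imp2 HK (H t tT tc) => s HK' H' Os i.
  rewrite (_ : v t s ord0 i = v c s ord0 i + (v t s ord0 i - v c s ord0 i)).
    by apply: le_trans (ler_normD _ _) _; rewrite lerD ?HK' ?H'.
  by ring.
Qed.

(* By Cousin's lemma only finitely many null sets are involved. *)
Lemma Linf_mean_value (u v : R -> vfield) (z : vfield) (p q K e : R) :
  Linf_derivative Omega T u v -> 0 <= p -> p <= q -> q <= T -> 0 < e ->
  (forall c, p <= c <= q -> {ae mu, forall x, Omega x -> forall i,
     `|v c x ord0 i - z x ord0 i| <= K}) ->
  {ae mu, forall x, Omega x -> forall i,
    `|u q x ord0 i - u p x ord0 i - (q - p) * z x ord0 i| <= (K + e) * (q - p)}.
Proof.
move=> uv p0 pq qT e0 vz.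
apply: (@cousin _ (fun s t => {ae mu, forall x, Omega x -> forall i,
  `|u t x ord0 i - u s x ord0 i - (t - s) * z x ord0 i| <= (K + e) * (t - s)})) => //.
  move=> r s t _ _ _ _; apply: ae_imp2 => x H1 H2 Ox i.
  rewrite (_ : _ - _ - _ = (u s x ord0 i - u r x ord0 i - (s - r) * z x ord0 i) +
    (u t x ord0 i - u s x ord0 i - (t - s) * z x ord0 i)); last by ring.
  apply: le_trans (ler_normD _ _) _; apply: le_trans (lerD (H1 Ox i) (H2 Ox i)) _.
  by rewrite le_eqVlt; apply/orP; left; apply/eqP; ring.
move=> c cpq; have cT : 0 <= c <= T.
  by move: cpq => /andP[pc cq]; rewrite (le_trans p0 pc) (le_trans cq qT).
have [dl dl0 H] := Linf_derivativeP uv cT e0; exists dl => // s t ps sc ct tq ts.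
have sT : 0 <= s <= T by apply/andP; split; lra.
have tT : 0 <= t <= T by apply/andP; split; lra.
have sd : `|s - c| < dl by rewrite ler0_norm ?subr_le0//; lra.
have td : `|t - c| < dl by rewrite ger0_norm ?subr_ge0//; lra.
have Hs := ae_imp2 (fun x h1 h2 => conj h1 h2) (H s sT sd) (H t tT td).
apply: ae_imp2 Hs (vz c cpq) => x [H1 H2] H3 Ox i.
have {}H1 := H1 Ox i; have {}H2 := H2 Ox i; have {}H3 := H3 Ox i.
rewrite (ler0_norm (_ : s - c <= 0)) ?subr_le0// in H1.
rewrite (ger0_norm (_ : 0 <= t - c)) ?subr_ge0// in H2.
(* Expanding at [c] towards both sides costs [e * (t - c)] and [e * (c - s)], which add up to
   [e * (t - s)]; replacing [v c] by [z] costs [K * (t - s)]. *)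
rewrite (_ : _ - _ - _ = (u t x ord0 i - u c x ord0 i - (t - c) * v c x ord0 i) -
  (u s x ord0 i - u c x ord0 i - (s - c) * v c x ord0 i) +
  (t - s) * (v c x ord0 i - z x ord0 i)); last by ring.
apply: le_trans (ler_normD _ _) _.
apply: le_trans (lerD (ler_normB _ _) (lexx _)) _.
rewrite normrM (ger0_norm (_ : 0 <= t - s)); last by rewrite subr_ge0 (le_trans sc).
apply: le_trans (lerD (lerD H2 H1) (ler_wpM2l _ H3)) _.
  by rewrite subr_ge0 (le_trans sc).
by rewrite le_eqVlt; apply/orP; left; apply/eqP; ring.
Qed.

End essential_bounds.

(** * Representatives with regular trajectories *)

Section regular_representative.
Context {R : realType} {d : nat}.
Variable Omega : set 'rV[R]_d.
Variable T : R.
Hypothesis T0 : 0 < T.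
Local Notation mu := (lebesgue_rV d).
Local Notation vfield := ('rV[R]_d -> 'rV[R]_d).

Lemma continuous_trajectory_coord (f : R -> 'rV[R]_d) :
  {within `[0, T], continuous f} -> forall i, forall t : R, 0 <= t <= T ->
  forall e : R, 0 < e -> exists2 delta : R, 0 < delta & forall s : R,
    0 <= s <= T -> `|s - t| < delta -> `|f s ord0 i - f t ord0 i| <= e.
Proof.
move=> cf i t tT e e0.
have At : `[0, T]%classic t by rewrite /= in_itv.
have ft : f s @[s --> within `[0, T] (nbhs t)] --> f t.
  have := cf t; rewrite /continuous_at (nbhs_subspace_in At) => cft.
  by apply: cvg_trans cft; apply: cvg_app.
have : \forall s \near within `[0, T] (nbhs t), ball (f t) e (f s).
  exact: (ft _ (nbhsx_ballx _ _ e0)).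
rewrite near_withinE => /(@nbhs_ballP R R t _)[dl /= dl0 H]; exists dl => // s sT sd.
have := H s; rewrite /ball/= distrC in_itv/= => /(_ sd sT)[_ /(_ ord0 i)].
by rewrite /ball/= distrC => /ltW.
Qed.

Let continuous_abs_diff (f : R -> R) (l c K : R) : continuous f ->
  continuous (fun s => `|f s - c - (clamp T s - l) * K|).
Proof.
move=> cf s; apply: cvg_norm; apply: cvgB.
  by apply: cvgB; [exact: cf|exact: cvg_cst].
apply: cvgM; last exact: cvg_cst.
by apply: cvgB; [apply: continuous_clamp; exact: ltW|exact: cvg_cst].
Qed.

(** Rational times are replaced by arbitrary ones one variable at a time: with one time fixed, the
    difference of the two sides is continuous in the other. *)
Let clamp_dense_le (f : R -> R) (l : R) (c c' e : R) :
  (forall t : R, 0 <= t <= T -> forall e : R, 0 < e ->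
     exists2 delta : R, 0 < delta & forall s : R,
     0 <= s <= T -> `|s - t| < delta -> `|f s - f t| <= e) ->
  (forall a b : rat, c < ratr a < c' -> c < ratr b < c' ->
    `|f (clamp T (ratr b)) - f (clamp T (ratr a)) -
      (clamp T (ratr b) - clamp T (ratr a)) * l| <=
    e * `|clamp T (ratr b) - clamp T (ratr a)|) ->
  forall p q, 0 <= p <= T -> 0 <= q <= T -> c < p < c' -> c < q < c' ->
  `|f p - f q - (p - q) * l| <= e * `|p - q|.
Proof.
move=> cf H p q pT qT pc qc.
have cF : continuous (f \o clamp T) by exact: (continuous_comp_clamp (ltW T0)).
have cN x y : continuous (fun s => `|(f \o clamp T) s - x - (clamp T s - y) * l| -
    e * `|clamp T s - y|).
  move=> s; apply: cvgB; first exact: continuous_abs_diff.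
  apply: cvgM; first exact: cvg_cst.
  apply: cvg_norm; apply: cvgB; [apply: continuous_clamp; exact: ltW|exact: cvg_cst].
have step1 (a : rat) (s : R) : c < ratr a < c' -> c < s < c' ->
    `|f (clamp T s) - f (clamp T (ratr a)) - (clamp T s - clamp T (ratr a)) * l| <=
    e * `|clamp T s - clamp T (ratr a)|.
  move=> ac sc; rewrite -subr_le0.
  apply: (rat_dense_le (cN (f (clamp T (ratr a))) (clamp T (ratr a))) _ sc).
  by move=> b bc; rewrite subr_le0; exact: H.
have := rat_dense_le (cN (f (clamp T q)) (clamp T q)) _ pc.
rewrite /= subr_le0 (clamp_id pT) (clamp_id qT); apply => a ac.
rewrite subr_le0 (distrC _ q).
have := step1 a q ac qc; rewrite (clamp_id qT); apply: le_trans.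
by rewrite -normrN le_eqVlt; apply/orP; left; apply/eqP; congr `| _ |; ring.
Qed.

Variables u v : R -> vfield.
Hypothesis uv : Linf_derivative Omega T u v.
Hypothesis v_fin : forall t : R, 0 <= t <= T -> (Linf_norm Omega (v t) < +oo)%E.
Hypothesis cv : Linf_continuous Omega T v.
Hypothesis traj : continuous_trajectories Omega T u.

Lemma Linf_lipschitz : exists2 L : R, 0 <= L &
  forall s t : R, 0 <= s <= T -> 0 <= t <= T ->
  {ae mu, forall x, Omega x -> forall i,
    `|u t x ord0 i - u s x ord0 i| <= L * `|t - s|}.
Proof.
have [L L0 HL] := Linf_bounded_path T0 v_fin cv; exists (L + 1).
  by rewrite addr_ge0.
move=> s t; wlog st : s t / s <= t => [wl sT tT|].
  have [st|/ltW ts] := leP s t; first exact: wl.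
  have := wl t s ts tT sT.
  by apply: ae_imp => x H Ox i; rewrite distrC [X in _ <= _ * X]distrC; exact: H.
move=> /andP[s0 sT] /andP[t0 tT].
have := @Linf_mean_value _ _ _ _ u v (fun=> 0) s t L 1 uv s0 st tT ltr01.
rewrite ger0_norm ?subr_ge0// => mvi; apply: ae_imp (mvi _).
  by move=> x H Ox i; have := H Ox i; rewrite mxE mulr0 subr0.
move=> c /andP[sc ct]; apply: ae_imp (HL c _).
  by move=> x H Ox i; rewrite mxE subr0; exact: H.
by rewrite (le_trans s0 sc) (le_trans ct tT).
Qed.

(** The exceptional set of [Linf_lipschitz] depends on the pair of times. Rational pairs give a
    single null set, and continuity of trajectories extends the bound to all pairs. *)
Lemma ae_lipschitz_trajectories : exists2 L : R, 0 <= L &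
  {ae mu, forall x, Omega x -> forall i, lipschitz_on T (fun t => u t x ord0 i) L}.
Proof.
have [L L0 HL] := Linf_lipschitz; exists L => //.
have aeab (a b : rat) : {ae mu, forall x, Omega x -> forall i,
    `|u (clamp T (ratr b)) x ord0 i - u (clamp T (ratr a)) x ord0 i| <=
    L * `|clamp T (ratr b) - clamp T (ratr a)|}.
  by apply: HL; apply: clamp_itv; exact: ltW.
have := ae_forall_countable (fun a => ae_forall_countable (aeab a)).
apply: ae_imp2 traj => x tr H Ox i p q pT qT.
have cf := continuous_trajectory_coord (tr Ox) i.
have := @clamp_dense_le (fun t => u t x ord0 i) 0 (Num.min p q - 1)
  (Num.max p q + 1) L cf.
have -> : u p x ord0 i - u q x ord0 i =
  u p x ord0 i - u q x ord0 i - (p - q) * 0 by rewrite mulr0 subr0.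
have p1 : Num.min p q <= p by rewrite ge_min lexx.
have p2 : p <= Num.max p q by rewrite le_max lexx.
have q1 : Num.min p q <= q by rewrite ge_min lexx orbT.
have q2 : q <= Num.max p q by rewrite le_max lexx orbT.
apply => //; try by (apply/andP; split; lra).
by move=> a b _ _; rewrite mulr0 subr0; exact: H.
Qed.

(** Near [t], where [v] is essentially within [1 / (n + 1)] of [v t], the mean value inequality with
    [z := v t] has error [2 / (n + 1)], the second half being its slack [e]. Since [n] and the
    rational times range over countable sets, the null set depends on [t] alone. *)
Lemma ae_strict_deriv_trajectories (t : R) : 0 <= t <= T ->
  {ae mu, forall x, Omega x -> forall i,
    strict_deriv `[0, T] (fun s => u s x ord0 i) t (v t x ord0 i)}.
Proof.
move=> tT.
have /choice[dl dlP] : forall n : nat, exists dl : R, 0 < dl /\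
    forall c : R, 0 <= c <= T -> `|c - t| < dl ->
    {ae mu, forall x, Omega x -> forall i,
      `|v c x ord0 i - v t x ord0 i| <= n.+1%:R^-1}.
  move=> n; have n0 : 0 < n.+1%:R^-1 :> R by rewrite invr_gt0.
  by have [dl dl0 H] := Linf_continuousP cv tT n0; exists dl.
pose P n (a b : rat) x := Omega x -> t - dl n < ratr a < t + dl n ->
  t - dl n < ratr b < t + dl n -> forall i,
  `|u (clamp T (ratr b)) x ord0 i - u (clamp T (ratr a)) x ord0 i -
    (clamp T (ratr b) - clamp T (ratr a)) * v t x ord0 i| <=
  (n.+1%:R^-1 *+ 2) * `|clamp T (ratr b) - clamp T (ratr a)|.
have aeP n a b : {ae mu, forall x, P n a b x}.
  have [dl0 Hdl] := dlP n.
  have [an|an] := boolP (t - dl n < ratr a < t + dl n); last first.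
    by apply: aeW => x; rewrite /P (negbTE an).
  have [bn|bn] := boolP (t - dl n < ratr b < t + dl n); last first.
    by apply: aeW => x; rewrite /P (negbTE bn).
  have near_t (s : R) : t - dl n < s < t + dl n -> `|clamp T s - t| < dl n.
    move=> /andP[s1 s2]; rewrite -[X in _ - X](clamp_id tT).
    apply: le_lt_trans (clamp_lip T _ _) _.
    by rewrite ltr_norml; apply/andP; split; lra.
  have mv (p q : R) : 0 <= p <= T -> 0 <= q <= T -> p <= q ->
    `|p - t| < dl n -> `|q - t| < dl n ->
    {ae mu, forall x, Omega x -> forall i,
      `|u q x ord0 i - u p x ord0 i - (q - p) * v t x ord0 i| <=
      (n.+1%:R^-1 *+ 2) * `|q - p|}.
    move=> /andP[p0 pT] /andP[q0 qT] pq pd qd; rewrite ger0_norm ?subr_ge0//.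
    rewrite mulr2n; apply: (Linf_mean_value uv) => //.
    move=> c /andP[pc cq]; apply: Hdl; first by rewrite (le_trans p0 pc) (le_trans cq).
    move: pd qd; rewrite !ltr_norml => /andP[? ?] /andP[? ?].
    by apply/andP; split; lra.
  have [ab|/ltW ba] := leP (clamp T (ratr a)) (clamp T (ratr b)).
    have := mv _ _ (clamp_itv (ltW T0) _) (clamp_itv (ltW T0) _) ab (near_t _ an) (near_t _ bn).
    by apply: ae_imp => x H Ox _ _; exact: H.
  have := mv _ _ (clamp_itv (ltW T0) _) (clamp_itv (ltW T0) _) ba (near_t _ bn) (near_t _ an).
  apply: ae_imp => x H Ox _ _ i; have := H Ox i.
  rewrite (distrC (clamp T (ratr a))) => {}H; apply: le_trans H.
  by rewrite -normrN le_eqVlt; apply/orP; left; apply/eqP; congr `| _ |; ring.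
have aeall : {ae mu, forall x, forall n, forall a b, P n a b x}.
  apply: ae_foralln => n; apply: ae_forall_countable => a.
  by apply: ae_forall_countable => b; exact: aeP.
apply: ae_imp2 traj aeall => x tr H Ox i e e0.
have cf := continuous_trajectory_coord (tr Ox) i.
have e20 : 0 < e / 2 by rewrite divr_gt0.
have [n _ /(_ n (leqnn n))/= ltn] := near_infty_natSinv_lt (PosNum e20).
have ne : n.+1%:R^-1 *+ 2 <= e.
  by rewrite mulr2n (splitr e) lerD// ltW.
have [dl0 _] := dlP n.
exists (dl n) => // p q; rewrite /= !in_itv/= => pT qT pd qd.
apply: (@le_trans _ _ ((n.+1%:R^-1 *+ 2) * `|p - q|)); last by rewrite ler_wpM2r.
apply: (@clamp_dense_le (fun s => u s x ord0 i) _ (t - dl n) (t + dl n)) => //.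
- by move=> a b an bn; exact: H.
- by move: pd; rewrite ltr_norml => /andP[? ?]; apply/andP; split; lra.
- by move: qd; rewrite ltr_norml => /andP[? ?]; apply/andP; split; lra.
Qed.

Hypothesis mOmega : measurable Omega.
Hypothesis u_fin : forall t : R, 0 <= t <= T -> (Linf_norm Omega (u t) < +oo)%E.
Hypothesis mu_ : forall t : R, 0 <= t <= T -> measurable_fun Omega (u t).

(** The zero trajectory satisfies every bound, so extending by it off a set of full measure leaves
    no exceptional points. [C] is an essential bound of [u 0] increased by [L * T]. *)
Lemma regular_representative : exists (A : set 'rV[R]_d) (U : R -> vfield) (L C : R),
  [/\ measurable A, A `<=` Omega, {ae mu, forall x, Omega x -> A x},
      forall t x, A x -> U t x = u t x & forall t x, ~ A x -> U t x = 0] /\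
  [/\ 0 <= L, 0 <= C,
      forall t : R, 0 <= t <= T -> forall i,
        measurable_fun setT (fun x => U t x ord0 i),
      forall x i, lipschitz_on T (fun t => U t x ord0 i) L &
      forall t x i, 0 <= t <= T -> `|U t x ord0 i| <= C].
Proof.
have [L L0 aeL] := ae_lipschitz_trajectories.
have [C0 C00 aeC] : exists2 C : R, 0 <= C & {ae mu, forall x, Omega x -> forall i,
    `|u 0 x ord0 i| <= C}.
  have zT : 0 <= (0 : R) <= T by rewrite lexx ltW.
  have := u_fin zT; have := Linf_norm_le (lexx (Linf_norm Omega (u 0))).
  have : (0 <= Linf_norm Omega (u 0))%E by exact: Lnorm_ge0.
  case: (Linf_norm Omega (u 0)) => [r r0 H' _|//|//].
  by exists r => //; apply: ae_imp H' => s H' Os i; have := H' Os i; rewrite lee_fin.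
have [N [mN N0 NP]] : {ae mu, forall x, Omega x -> (forall i,
    lipschitz_on T (fun t => u t x ord0 i) L) /\ forall i, `|u 0 x ord0 i| <= C0}.
  by apply: ae_imp2 aeL aeC => x H1 H2 Ox; split; [exact: H1|exact: H2].
pose A := Omega `\` N.
have AP x : A x -> (forall i, lipschitz_on T (fun t => u t x ord0 i) L) /\
    forall i, `|u 0 x ord0 i| <= C0.
  move=> [Ox Nx]; apply: contrapT => H; apply: Nx; apply: NP => /= H'.
  exact/H/H'.
pose U t x := if x \in A then u t x else 0.
have UA t x : A x -> U t x = u t x by move=> Ax; rewrite /U mem_set.
have UNA t x : ~ A x -> U t x = 0 by move=> Ax; rewrite /U memNset.
have mA : measurable A by exact: measurableD.
exists A, U, L, (C0 + L * T); split; split => //.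
- by move=> x [].
- exists N; split => // x /= /not_implyP[Ox nAx].
  by apply: contrapT => Nx; exact: nAx.
- by rewrite addr_ge0// mulr_ge0// ltW.
- move=> t tT i; rewrite (_ : (fun x => _) = (fun x => u t x ord0 i) \_ A); last first.
    by apply/funext => x; rewrite /U patchE; case: ifP => // _; rewrite mxE.
  apply/measurable_restrict => //; rewrite setTI.
  apply: (@measurable_funS _ _ _ _ Omega) => //; first by move=> x [].
  by apply: (measurableT_comp (measurable_coord_rV i)); exact: mu_.
- move=> x i p q pT qT; have [Ax|Ax] := pselect (A x).
    by rewrite !UA//; exact: (AP x Ax).1.
  by rewrite !UNA// !mxE subrr normr0 mulr_ge0.
- move=> t x i tT; have [Ax|Ax] := pselect (A x); last first.
    by rewrite UNA// mxE normr0 addr_ge0// mulr_ge0// ltW.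
  rewrite UA//; have [Lx Cx] := AP x Ax.
  have zT : 0 <= (0 : R) <= T by rewrite lexx ltW.
  rewrite -[X in `|X|](subrK (u 0 x ord0 i)) addrC.
  apply: le_trans (ler_normD _ _) _; apply: lerD => //.
  apply: (le_trans (Lx i t 0 tT zT)); rewrite subr0 ler_wpM2l//.
  by move: tT => /andP[t0 tT]; rewrite ger0_norm.
Qed.

End regular_representative.

(** * Integrability of bond kernels *)

Section euclidean_measure.
Context {R : realType} {d : nat}.
Local Notation mu := (@lebesgue_rV R d).

Lemma measurable_rV_box (A : 'I_d -> set R) : (forall i, measurable (A i)) ->
  measurable [set x : 'rV[R]_d | forall i, A i (x ord0 i)].
Proof.
move=> mA; have -> : [set x : 'rV[R]_d | forall i, A i (x ord0 i)] =
    \bigcap_(i in [set: 'I_d]) ((fun x : 'rV[R]_d => x ord0 i) @^-1` A i).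
  by apply/seteqP; split => [x /= Ax i _|x /= Ax i]; exact: Ax.
apply: fin_bigcap_measurable => [|i _]; first exact: finite_finset.
by rewrite -[X in measurable X]setTI; exact: measurable_coord_rV.
Qed.

Lemma ball_rV (x : 'rV[R]_d) (e : R) : 0 < e ->
  ball x e = [set y : 'rV[R]_d | forall i, ball (x ord0 i) e (y ord0 i)].
Proof.
move=> e0; apply/seteqP; split => [y [_ H] i|y /= H]; first exact: H.
by split => // i j; rewrite ord1; exact: H.
Qed.

(** The sigma-algebra is generated by coordinates, so open sets must be reduced to boxes: balls of
    the sup norm are cubes, and those inside [A] with rational centre and radius [1 / (n + 1)] cover
    it. *)
Lemma open_measurable_rV (A : set 'rV[R]_d) : open A -> measurable A.
Proof.
move=> oA.
pose B (i : 'rV[rat]_d * nat) := ball (map_mx ratr i.1 : 'rV[R]_d) i.2.+1%:R^-1.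
pose F i := if pselect (B i `<=` A) then B i else set0.
have -> : A = \bigcup_i F i.
  apply/seteqP; split => [x Ax|x [i _]]; last first.
    by rewrite /F; case: pselect => // BA; exact: BA.
  have /nbhs_ballP[e /= e0 xeA] := open_nbhs_nbhs (conj oA Ax).
  have [n _ /(_ n (leqnn n))/= ne] := near_infty_natSinv_lt (PosNum (divr_gt0 e0 (ltr0Sn R 1))).
  have n0 : 0 < n.+1%:R^-1 :> R by rewrite invr_gt0.
  have /choice[q qP] : forall i : 'I_d, exists q : rat, ball (x ord0 i) n.+1%:R^-1 (ratr q).
    move=> i; have [y [yb [q _ qy]]] := @dense_rat R (ball (x ord0 i) n.+1%:R^-1)
      ltac:(by exists (x ord0 i); exact: ballxx) ltac:(exact: ball_open).
    by exists q; rewrite qy.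
  exists (\row_i q i, n) => //; rewrite /F; case: pselect => [?|[]] /=.
    rewrite /B ball_rV// => i; rewrite !mxE; apply: ball_sym; exact: qP.
  apply: subset_trans xeA => y; rewrite /B !ball_rV//= => H i.
  have := H i; rewrite !mxE => {}H.
  apply: (@le_ball _ _ _ (n.+1%:R^-1 + n.+1%:R^-1)).
    by rewrite (splitr e) lerD// ltW.
  exact: (ball_triangle (qP i) H).
apply: countable_bigcupT_measurable; first exact: countableP.
move=> i; rewrite /F; case: pselect => [?|?] /=; last exact: measurable0.
rewrite /B ball_rV ?invr_gt0//; apply: (@measurable_rV_box
  (fun j => ball ((map_mx ratr i.1 : 'rV[R]_d) ord0 j) i.2.+1%:R^-1)) => j.
exact: measurable_ball.
Qed.

Lemma bounded_rV_coord (A : set 'rV[R]_d) : bounded_set A ->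
  exists2 B : R, 0 < B & forall x, A x -> forall i, `|x ord0 i| <= B.
Proof.
move=> [M [Mreal HM]]; exists (`|M| + 1); first by rewrite ltr_wpDl.
move=> x Ax i; have := HM (`|M| + 1) _ x Ax.
rewrite ltr_pwDr// ?ler_norm// => /(_ isT) /=; apply: le_trans.
rewrite -[leRHS]/(mx_norm x) mx_normrE; apply/bigmax_geP; right => /=.
by exists (ord0, i).
Qed.

(** Restricting one coordinate to a width of order [e] already gives first order in [e], which is
    enough against the exponent 1/2. *)
Lemma lebesgue_slab (B : R) (j : 'I_d) : 0 < B -> exists2 C : R, 0 <= C &
  forall a e : R, 0 < e ->
  mu [set x | forall i, (if i == j then ball a e else `[- B, B]%classic) (x ord0 i)] =
  (C * e)%:E.
Proof.
move=> B0; exists (2 * \prod_(i < d | i != j) (2 * B)).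
  by rewrite mulr_ge0// prodr_ge0// => i _; rewrite mulr_ge0// ltW.
move=> a e e0.
pose A i := if i == j then ball a e else `[- B, B]%classic.
have mA i : measurable (A i).
  by rewrite /A; case: ifP => _ //; exact: measurable_ball.
rewrite [LHS](lebesgue_rV_box mA) (bigD1 j)//=.
rewrite {1}/A eqxx lebesgue_measure_ball; last exact: ltW.
rewrite (eq_bigr (fun=> (2 * B)%:E)).
  by rewrite prodEFin -EFinM -mulr_natl; congr EFin; ring.
move=> i /negbTE; rewrite /A => ->; rewrite lebesgue_measure_itv/= lte_fin.
by rewrite -EFinD opprK gtrN// -mulr2n mulr_natl.
Qed.

Lemma lebesgue_cube (B : R) : 0 < B ->
  (mu [set x | forall i, `[(- B)%R, B]%classic (x ord0 i)] < +oo)%E.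
Proof.
move=> B0; have mA (i : 'I_d) : measurable (`[- B, B]%classic : set R) by [].
rewrite [X in (X < _)%E](lebesgue_rV_box mA).
rewrite (eq_bigr (fun=> (2 * B)%:E)) ?prodEFin ?ltry// => i _.
rewrite lebesgue_measure_itv/= lte_fin.
by rewrite -EFinD opprK gtrN// -mulr2n mulr_natl.
Qed.

End euclidean_measure.

Lemma measurable_sqrtr {R : realType} : measurable_fun setT (@Num.sqrt R).
Proof. by apply: continuous_measurable_fun; exact: sqrt_continuous. Qed.

Lemma measurable_invr {R : realType} : measurable_fun setT (@GRing.inv R).
Proof.
have -> : setT = ~` [set (0 : R)] `|` [set 0] by rewrite setUC setUv.
apply/measurable_funU => //; first exact: measurableC.
split; last exact: measurable_fun_set1.
apply: open_continuous_measurable_fun.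
  by rewrite openC; apply: accessible_closed_set1; exact: hausdorff_accessible.
by move=> x /set_mem/= /eqP x0; exact: inv_continuous.
Qed.

(** * Integrability of inverse square roots *)

Section weak_singularity.
Context dd {Z : measurableType dd} {R : realType}.
Variable m : {measure set Z -> \bar R}.

(* Raising the truncation level of D^(-1/2) from 2^n to 2^(n+1) costs at most
   2^n m{D < 4^(-n)} <= C 2^(-n). *)
Lemma integrable_inv_sqrt (S : set Z) (D : Z -> R) (C : R) :
  measurable S -> (m S < +oo)%E -> measurable_fun setT D -> (forall z, 0 <= D z) ->
  0 <= C -> (forall e : R, 0 < e -> (m (S `&` [set z | (D z < e)%R]) <= (C * e)%:E)%E) ->
  m.-integrable S (EFin \o (fun z => (Num.sqrt (D z))^-1)).
Proof.
move=> mS Soo mD D0 C0 HD.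
pose w (z : Z) : R := (Num.sqrt (D z))^-1.
have mw : measurable_fun setT w.
  apply: (measurableT_comp measurable_invr).
  exact: (measurableT_comp measurable_sqrtr).
have w0 z : 0 <= w z by rewrite invr_ge0 sqrtr_ge0.
pose f (n : nat) (z : Z) : R := Num.min (w z) (2 ^+ n).
have mf n : measurable_fun S (f n).
  by apply: measurable_funTS; apply: measurable_minr.
have f0 n z : 0 <= f n z by rewrite le_min w0/= exprn_ge0.
pose V := fine (m S).
have fV : m S = V%:E by rewrite fineK// ge0_fin_numE.
(* The constant is [V], for level 0 where the truncation is at most 1, plus the sum of the
   increments [C / 2 ^ i] for [i < n]. *)
have bnd n : (\int[m]_(z in S) (f n z)%:E <= (V + C * (2 - 2 * 2^-1 ^+ n))%:E)%E.
  elim: n => [|n IH].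
    rewrite expr0 mulr1 subrr mulr0 addr0 -fV.
    apply: (@le_trans _ _ (\int[m]_(z in S) cst 1 z)%E).
      apply: ge0_le_integral => //.
      - by move=> z _; rewrite lee_fin.
      - exact/measurable_EFinP.
      - by move=> z _; rewrite lee_fin /f expr0 ge_min lexx orbT.
    by rewrite integral_cst// mul1e.
  pose In := S `&` [set z | D z < (4^-1) ^+ n].
  have mIn : measurable In.
    rewrite /In setIC -[X in X `&` _]setTI.
    apply: measurableI => //; rewrite (_ : [set z | _] = D @^-1` `]-oo, (4^-1) ^+ n[%classic).
      exact: mD.
    by apply/seteqP; split => z /=; rewrite in_itv.
  apply: (@le_trans _ _ (\int[m]_(z in S) ((f n z)%:E + (2 ^+ n * \1_In z)%:E))%E).
    apply: ge0_le_integral => //.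
    - by move=> z _; rewrite lee_fin.
    - exact/measurable_EFinP.
    - apply: emeasurable_funD; first exact/measurable_EFinP.
      apply/measurable_EFinP; apply: measurable_funM => //.
    - move=> z Sz; rewrite -EFinD lee_fin /f.
      have [wn|wn] := leP (w z) (2 ^+ n).
        by rewrite ge_min lerDl mulr_ge0// exprn_ge0.
      have -> : \1_In z = 1 :> R.
        rewrite indicE mem_set//; split => //=.
        (* [D z = 0] cannot occur here: the inverse of zero being zero, [w z] would vanish. *)
        have s0 : 0 < Num.sqrt (D z).
          by rewrite -invr_gt0; apply: lt_trans wn; rewrite exprn_gt0.
        have sD : Num.sqrt (D z) < (2^-1) ^+ n.
          by rewrite exprVn -[X in X < _]invrK ltf_pV2// posrE ?exprn_gt0// invr_gt0.
        rewrite -(sqr_sqrtr (D0 z)) (_ : 4^-1 = 2^-1 ^+ 2); last by field.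
        by rewrite exprAC ltr_pXn2r// nnegrE ?sqrtr_ge0// exprn_ge0.
      by rewrite mulr1 ge_min exprS; apply/orP; right; rewrite mulr_natl mulr2n.
  have h1 z : S z -> (0 <= (f n z)%:E)%E by rewrite lee_fin.
  have h2 : measurable_fun S (fun z => (f n z)%:E) by exact/measurable_EFinP.
  have h3 z : S z -> (0 <= (2 ^+ n * \1_In z : R)%:E)%E.
    by rewrite lee_fin mulr_ge0// exprn_ge0.
  have h4 : measurable_fun S (EFin \o (fun z => 2 ^+ n * \1_In z : R)).
    by apply/measurable_EFinP; exact: measurable_funM.
  rewrite (ge0_integralD m mS h1 h2 h3 h4).
  have h5 : measurable_fun S (EFin \o (\1_In : Z -> R)).
    by apply/measurable_EFinP; exact: measurable_indic.
  have -> : (\int[m]_(z in S) (2 ^+ n * \1_In z)%:E =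
      (2 ^+ n)%:E * \int[m]_(z in S) (\1_In z)%:E)%E.
    under eq_integral do rewrite EFinM.
    by rewrite ge0_integralZl// lee_fin exprn_ge0.
  rewrite integral_indic// (_ : In `&` S = In); last first.
    by apply/seteqP; split => [z []//|z [Sz Dz]].
  apply: le_trans (leeD IH (lee_wpmul2l _ (HD _ _))) _.
  - by rewrite lee_fin exprn_ge0.
  - by rewrite exprn_gt0.
  rewrite -EFinM -EFinD lee_fin -addrA lerD2l.
  have -> : 2 ^+ n * (C * (4^-1) ^+ n) = C * 2^-1 ^+ n.
    rewrite mulrCA -exprMn; congr (_ * _ ^+ n); by field.
  by rewrite -mulrDr ler_wpM2l// exprS; lra.
apply/integrableP; split; first by apply/measurable_EFinP; exact: measurable_funTS.
rewrite (eq_integral (fun z => (w z)%:E)); last first.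
  by move=> z _; rewrite /= ger0_norm.
have cv := @cvg_monotone_convergence _ _ _ m S mS (fun n z => (f n z)%:E).
have lim_f z : limn (fun n => (f n z)%:E) = (w z)%:E.
  apply: cvg_lim => //; apply: cvg_EFin; first exact: nearW.
  apply: cvg_near_cst; near=> n; rewrite /f /=; apply/min_idPl.
  near: n; exists (Num.bound (w z)) => // n /= wn.
  apply: (@le_trans _ _ n%:R).
    by apply: le_trans (ltW (archi_boundP (w0 z))) _; rewrite ler_nat.
  by rewrite -natrX ler_nat ltnW// ltn_expl.
have -> : (\int[m]_(z in S) (w z)%:E = limn (fun n => \int[m]_(z in S) (f n z)%:E))%E.
  rewrite -(eq_integral _ _ (fun z _ => lim_f z)).
  apply/esym/cvg_lim => //; apply: cv.
  - by move=> n; exact/measurable_EFinP.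
  - by move=> n z _; rewrite lee_fin.
  - move=> z _ a b ab; rewrite lee_fin /f le_min ge_min lexx/= ge_min.
    by apply/orP; right; rewrite ler_eXn2l ?ltr1n.
apply: (@le_lt_trans _ _ (V + C * 2)%:E); last exact: ltry.
apply: lime_le; last first.
  apply: nearW => n; apply: (le_trans (bnd n)); rewrite lee_fin lerD2l ler_wpM2l//.
  by rewrite gerBl mulr_ge0// exprn_ge0.
apply/cvg_ex; eexists; apply: cv.
- by move=> n; exact/measurable_EFinP.
- by move=> n z _; rewrite lee_fin.
- move=> z _ a b ab; rewrite lee_fin /f le_min ge_min lexx/= ge_min.
  by apply/orP; right; rewrite ler_eXn2l ?ltr1n.
Unshelve. all: by end_near. Qed.

End weak_singularity.

(** * Null sets and iterated integrals on product spaces *)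

Section product_ae.
Context d1 d2 (T1 : measurableType d1) (T2 : measurableType d2) {R : realType}.
Variable m1 : {sigma_finite_measure set T1 -> \bar R}.
Variable m2 : {sigma_finite_measure set T2 -> \bar R}.
Local Notation pm := (m1 \x m2)%E.

Lemma ae_fst (Q : T1 -> Prop) : {ae m1, forall x, Q x} ->
  {ae pm, forall z, Q z.1}.
Proof.
move=> [N [mN N0 NQ]]; exists (N `*` setT); split.
- exact: measurableX.
- by rewrite [LHS]product_measure1E// [X in (X * _)%E]N0 mul0e.
- by move=> z /= nQ; split => //; exact: NQ.
Qed.

Lemma ae_snd (Q : T2 -> Prop) : {ae m2, forall x, Q x} ->
  {ae pm, forall z, Q z.2}.
Proof.
move=> [N [mN N0 NQ]]; exists (setT `*` N); split.
- exact: measurableX.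
- by rewrite [LHS]product_measure1E// [X in (_ * X)%E]N0 mule0.
- by move=> z /= nQ; split => //; exact: NQ.
Qed.

Lemma null_xsection (N : set (T1 * T2)) : measurable N -> pm N = 0%E ->
  {ae m1, forall x, m2 (xsection N x) = 0%E}.
Proof.
move=> mN N0.
have mf : measurable_fun setT (m2 \o xsection N) by exact: measurable_fun_xsection.
have /(ae_eq_integral_abs _ measurableT mf) :
    (\int[m1]_(x in setT) `|(m2 \o xsection N) x| = 0)%E.
  rewrite -[RHS]N0; apply: eq_integral => x _.
  by rewrite gee0_abs//=.
by apply: ae_imp => x; exact.
Qed.

Lemma ae_section (P : T1 -> T2 -> Prop) : {ae pm, forall z, P z.1 z.2} ->
  {ae m1, forall x, {ae m2, forall y, P x y}}.
Proof.
move=> [N [mN N0 NP]]; apply: ae_imp (null_xsection mN N0) => x Nx.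
exists (xsection N x); split => //; first exact: measurable_xsection.
by move=> y /= nP; rewrite xsectionE /=; apply: NP.
Qed.

Lemma integrable_section (f : T1 * T2 -> R) : pm.-integrable setT (EFin \o f) ->
  {ae m1, forall x, m2.-integrable setT (EFin \o (fun y => f (x, y)))}.
Proof. by move=> /ae_integrable1; apply: ae_imp. Qed.

(* [F] is only known on [A1 x A2] and up to a null set; [F'] is its product
   version. *)
Lemma Rintegral_iterated (A1 : set T1) (A2 : set T2)
    (F : T1 -> T2 -> R) (F' G : T1 * T2 -> R) :
  ae_measurable pm setT F' -> pm.-integrable setT (EFin \o G) ->
  {ae pm, forall z, setT z -> `|F' z| <= G z} ->
  (forall z, ~ (A1 z.1 /\ A2 z.2) -> G z = 0) ->
  {ae pm, forall z, A1 z.1 -> A2 z.2 -> F z.1 z.2 = F' z} ->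
  \int[m1]_(x in A1) \int[m2]_(y in A2) F x y = \int[pm]_z F' z.
Proof.
move=> mF' iG F'G GA FF'.
have [g [ig F'g gG]] := ae_measurable_integrable measurableT mF' iG F'G.
have g0 x y : ~ (A1 x /\ A2 y) -> g (x, y) = 0.
  move=> nA; apply/normr0_eq0/eqP; rewrite eq_le normr_ge0 andbT.
  by apply: le_trans (gG _ I) _; rewrite GA// normr0.
have aeFg : {ae m1, forall x, A1 x ->
    {ae m2, forall y, A2 y -> F x y = g (x, y)}}.
  have : {ae pm, forall z, A1 z.1 -> A2 z.2 -> F z.1 z.2 = g (z.1, z.2)}.
    by apply: ae_imp2 FF' F'g => -[x y] H1 H2 A1x A2y; rewrite H1// H2.
  move=> /(@ae_section (fun x y => A1 x -> A2 y -> F x y = g (x, y))).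
  by apply: ae_imp => x H A1x; apply: ae_imp H => y; apply.
rewrite (ae_eq_Rintegral F'g).
have inner x : A1 x -> \int[m2]_(y in A2) g (x, y) = \int[m2]_y g (x, y).
  move=> A1x; rewrite Rintegral_mkcond; apply: eq_Rintegral => y _.
  by rewrite patchE; case: ifPn => // /negP yA; rewrite g0// => -[_ /mem_set].
have -> : \int[m1]_(x in A1) \int[m2]_(y in A2) F x y =
    \int[m1]_(x in A1) \int[m2]_y g (x, y).
  apply: ae_eq_Rintegral; apply: ae_imp aeFg => x H A1x.
  by rewrite (ae_eq_Rintegral (H A1x)) inner.
have -> : \int[m1]_(x in A1) \int[m2]_y g (x, y) = \int[m1]_x \int[m2]_y g (x, y).
  rewrite Rintegral_mkcond; apply: eq_Rintegral => x _.
  rewrite patchE; case: ifPn => // /negP xA.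
  rewrite -[LHS](@Rintegral_set0 _ _ _ m2 (fun=> 0)).
  rewrite Rintegral_mkcond; apply: eq_Rintegral => y _.
  by rewrite patchE if_same g0// => -[/mem_set].
rewrite {1}/Rintegral /Rintegral -integral12_prod_meas1//; congr fine.
apply: ae_eq_integralW; apply: ae_imp (integrable_section ig) => x ix _.
by rewrite fineK//; exact: integrable_fin_num.
Qed.

End product_ae.

Section product_swap.
Context d1 (T1 : measurableType d1) {R : realType}.
Variable m1 : {sigma_finite_measure set T1 -> \bar R}.
Local Notation pm := (m1 \x m1)%E.

(** Fubini's theorem in opposite orders: renaming variables turns one iterated integral into the
    other. *)
Lemma Rintegral_swap (f : T1 * T1 -> R) : pm.-integrable setT (EFin \o f) ->
  pm.-integrable setT (EFin \o (fun z => f (z.2, z.1))) ->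
  \int[pm]_z f (z.2, z.1) = \int[pm]_z f z.
Proof.
move=> i1 i2; rewrite /Rintegral; congr fine.
by rewrite -[LHS](integral12_prod_meas1 i2) -[RHS](integral21_prod_meas1 i1).
Qed.

End product_swap.

Section kernel_integrability.
Context {R : realType} {d : nat}.
Local Notation mu := (@lebesgue_rV R d).
Local Notation pt := 'rV[R]_d.
Local Notation pm := (mu \x mu)%E.

Lemma measurable_fst_coord i : measurable_fun setT (fun z : pt * pt => z.1 ord0 i).
Proof. exact: (measurableT_comp (measurable_coord_rV i) measurable_fst). Qed.

Lemma measurable_snd_coord i : measurable_fun setT (fun z : pt * pt => z.2 ord0 i).
Proof. exact: (measurableT_comp (measurable_coord_rV i) measurable_snd). Qed.

Definition bond_length (z : pt * pt) : R := enorm (z.2 - z.1).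

Lemma bond_length_ge0 z : 0 <= bond_length z.
Proof. exact: sqrtr_ge0. Qed.

Lemma measurable_bond_length : measurable_fun setT bond_length.
Proof.
apply: (measurableT_comp measurable_sqrtr).
rewrite /dotr; apply: measurable_sum => i.
have mi : measurable_fun setT (fun z : pt * pt => (z.2 - z.1) ord0 i).
  under eq_fun do rewrite !mxE.
  by apply: measurable_funB; [exact: measurable_snd_coord|exact: measurable_fst_coord].
exact: measurable_funM.
Qed.

Variables (A : set pt) (B : R) (j : 'I_d).
Hypotheses (mA : measurable A) (B0 : 0 < B).
Hypothesis AB : forall x, A x -> forall i, `|x ord0 i| <= B.

Lemma finite_box_measure : (mu A < +oo)%E.
Proof.
apply: le_lt_trans (lebesgue_cube B0); apply: le_measure; rewrite ?inE//.
  by apply: (@measurable_rV_box _ _ (fun=> `[- B, B]%classic)).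
by move=> x Ax i; rewrite /= in_itv/= -ler_norml; exact: AB.
Qed.

(** For fixed [x], the points of [A] closer than [e] lie in a slab around coordinate [j] of [x].
    Integrating over [x] in [A] bounds the measure of short bonds linearly in [e], as
    [integrable_inv_sqrt] requires. *)
Lemma integrable_inv_sqrt_bond_length :
  pm.-integrable (A `*` A) (EFin \o (fun z => (Num.sqrt (bond_length z))^-1)).
Proof.
have [C C0 slab] := lebesgue_slab j B0.
have muA := finite_box_measure.
have fA : mu A = (fine (mu A))%:E by rewrite fineK// ge0_fin_numE.
apply: (@integrable_inv_sqrt _ _ _ pm _ _ (C * fine (mu A))).
- exact: measurableX.
- by rewrite [X in (X < _)%E]product_measure1E// lte_mul_pinfty// ge0_fin_numE.
- exact: measurable_bond_length.
- exact: bond_length_ge0.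
- by rewrite mulr_ge0// fine_ge0.
move=> e e0.
pose S := A `*` A `&` [set z | (bond_length z < e)%R].
have mS : measurable S.
  apply: measurableI; first exact: measurableX.
  rewrite (_ : [set z | _] = bond_length @^-1` `]-oo, e[%classic); last first.
    by apply/seteqP; split => z /=; rewrite in_itv.
  by rewrite -[X in measurable X]setTI; exact: measurable_bond_length.
have mf : measurable_fun setT (mu \o xsection S) by exact: measurable_fun_xsection.
rewrite -/S -[leLHS]/(\int[mu]_x (mu \o xsection S) x)%E.
apply: (@le_trans _ _ (\int[mu]_x ((C * e)%:E * (\1_A x)%:E))%E); last first.
  rewrite ge0_integralZl//; last 2 first.
  - by apply/measurable_EFinP; exact: measurable_indic.
  - by rewrite lee_fin mulr_ge0// ltW.
  rewrite integral_indic// setIT [X in (_ * X <= _)%E](_ : _ = (fine (mu A))%:E)//.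
  by rewrite -EFinM lee_fin mulrAC.
apply: ge0_le_integral => //.
- by apply: emeasurable_funM => //; apply/measurable_EFinP; exact: measurable_indic.
move=> x _ /=; rewrite indicE; have [/set_mem Ax|xA] := boolP (x \in A); last first.
  rewrite mule0 (_ : xsection S x = set0) ?measure0//.
  apply/seteqP; split => // y; rewrite xsectionE/= => -[[/mem_set]].
  by rewrite (negbTE xA).
rewrite mule1 -(slab (x ord0 j) e e0).
apply: le_measure; rewrite ?inE.
- exact: measurable_xsection.
- apply: (@measurable_rV_box _ _
    (fun i => if i == j then ball (x ord0 j) e else `[- B, B]%classic)) => i.
  by case: ifP => _ //; exact: measurable_ball.
move=> y; rewrite xsectionE/= => -[[_ Ay]] ye i; case: eqP => [->|_].
  rewrite /ball/= distrC; apply: le_lt_trans ye.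
  by have := coord_le_enorm (y - x) j; rewrite !mxE.
by rewrite /= in_itv/= -ler_norml; exact: AB.
Qed.

End kernel_integrability.

(** * Plateaus of running maxima *)

Section caratheodory_functions.
Context dZ {Z : measurableType dZ} {R : realType}.

(** Rounding time down to a multiple of [1 / (n + 1)] gives a function constant in time on countably
    many strips, hence jointly measurable; continuity in time gives the limit. *)
Lemma caratheodory_measurable (f : R -> Z -> R) :
  (forall t, measurable_fun setT (f t)) -> (forall z, continuous (f ^~ z)) ->
  measurable_fun setT (fun w : measurableTypeR R * Z => f w.1 w.2).
Proof.
move=> mf cf.
pose s n (t : R) : R := (Num.floor (t * n.+1%:R))%:~R / n.+1%:R.
apply: (@measurable_fun_cvg _ _ _ setT (fun n w => f (s n w.1) w.2)).
  move=> n _ Y mY; rewrite setTI.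
  pose I (k : int) : set R := `[k%:~R / n.+1%:R, (k + 1)%:~R / n.+1%:R[%classic.
  have n0 : 0 < n.+1%:R :> R by [].
  have -> : (fun w : measurableTypeR R * Z => f (s n w.1) w.2) @^-1` Y =
      \bigcup_(k : int) (I k `*` (f (k%:~R / n.+1%:R) @^-1` Y)).
    apply/seteqP; split => [[t z] /= Yf|[t z] [k _ [/= It Yf]]].
      exists (Num.floor (t * n.+1%:R)) => //; split => //=.
      rewrite /I/= in_itv/= ler_pdivrMr// ltr_pdivlMr//.
      exact: floor_itv.
    rewrite /s (_ : Num.floor _ = k)//; apply: floor_def.
    by move: It; rewrite /I/= in_itv/= ler_pdivrMr// ltr_pdivlMr.
  apply: countable_bigcupT_measurable; first exact: countableP.
  move=> k; apply: measurableX; first exact: measurable_itv.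
  by rewrite -[X in measurable X]setTI; exact: mf.
move=> [t z] _ /=; apply: (cvg_comp _ (f ^~ z) _ (cf z t)).
apply/cvgrPdist_lt => e e0; near=> n.
have n0 : 0 < n.+1%:R :> R by [].
have /andP[h1 h2] := floor_itv (t * n.+1%:R).
have : n.+1%:R^-1 < e by near: n; exact: near_infty_natSinv_lt (PosNum e0).
apply: le_lt_trans; rewrite ger0_norm; last first.
  by rewrite subr_ge0 ler_pdivrMr.
rewrite lerBlDl /s -[X in _ + X]mul1r -mulrDl ler_pdivlMr//.
by rewrite (_ : 1 = 1%:~R)// -intrD ltW.
Unshelve. all: by end_near. Qed.

Variable T : R.
Hypothesis T0 : 0 < T.
Variables (f : R -> Z -> R) (c : Z -> R).
Hypothesis c0 : forall z, 0 <= c z.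
Hypothesis mf : forall s, 0 <= s <= T -> measurable_fun setT (f s).
Hypothesis lip_f : forall z, lipschitz_on T (f ^~ z) (c z).

Lemma lipschitz_clamp_continuous (g : R -> R) (L S : R) : 0 <= L -> 0 <= S ->
  lipschitz_on S g L -> continuous (g \o clamp S).
Proof.
move=> L0 S0 Lg; apply: continuous_comp_clamp => // t tS e e0.
exists (e / (L + 1)); first by rewrite divr_gt0// ltr_wpDl.
move=> s sS st; apply: (le_trans (Lg s t sS tS)).
apply: (@le_trans _ _ ((L + 1) * (e / (L + 1)))).
  by apply: ler_pM => //; [rewrite lerDl|exact: ltW].
by rewrite mulrC divfK// gt_eqF// ltr_wpDl.
Qed.

Lemma measurable_clamped : measurable_fun setT
  (fun w : measurableTypeR R * Z => f (clamp T w.1) w.2).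
Proof.
apply: (caratheodory_measurable (f := fun t z => f (clamp T t) z)).
  by move=> t; apply: mf; apply: clamp_itv; exact: ltW.
by move=> z; apply: (lipschitz_clamp_continuous (c0 z) (ltW T0) (lip_f z)).
Qed.

(** By continuity in time, the maximum exceeds [x] exactly when [f] does so at some clamped rational
    time. *)
Lemma measurable_running_max t : 0 <= t <= T ->
  measurable_fun setT (fun z => running_max (f ^~ z) t).
Proof.
move=> /andP[t0 tT].
apply: (measurability _ (@RGenOInfty.measurableE R)) => _ [_ [x ->] <-].
rewrite setTI.
have -> : (fun z => running_max (f ^~ z) t) @^-1` `]x, +oo[%classic =
    \bigcup_(q : rat) [set z | x < f (clamp t (ratr q)) z].
  apply/seteqP; split => z /=; rewrite in_itv/= andbT; last first.
    move=> [q _ /=] /lt_le_trans; apply.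
    by apply: (running_max_ge (c0 z) (lip_f z) tT); exact: clamp_itv.
  move=> xM; apply: contrapT => nq.
  have fx (q : rat) : f (clamp t (ratr q)) z <= x.
    by rewrite leNgt; apply/negP => h; apply: nq; exists q.
  move: xM; apply/negP; rewrite -leNgt; apply: running_max_le => // tau taut.
  have Lt : lipschitz_on t (f ^~ z) (c z).
    move=> p q /andP[p0 pt] /andP[q0 qt].
    by apply: lip_f; apply/andP; split => //; exact: le_trans tT.
  have cF : continuous (fun s => f (clamp t s) z - x).
    move=> s; apply: cvgB; last exact: cvg_cst.
    exact: (lipschitz_clamp_continuous (c0 z) t0 Lt).
  have := rat_dense_le cF (c := tau - 1) (d := tau + 1).
  move=> /(_ _ tau); rewrite /= clamp_id// subr_le0; apply => [q _|].
    by rewrite subr_le0.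
  by rewrite ltrBlDr ltrDl ltr01.
apply: bigcupT_measurable_rat => q.
rewrite (_ : [set z | _] = f (clamp t (ratr q)) @^-1` `]x, +oo[%classic); last first.
  by apply/seteqP; split => z /=; rewrite in_itv/= andbT.
rewrite -[X in measurable X]setTI; apply: mf => //.
by have /andP[-> h] := clamp_itv t0 (ratr q); rewrite (le_trans h).
Qed.

Lemma measurable_primitive t : 0 <= t <= T -> (forall s z, 0 <= f s z) ->
  measurable_fun setT (fun z => \int[lebesgue_measure]_(tau in `[0, t]) f tau z).
Proof.
move=> /andP[t0 tT] f0.
pose F (w : measurableTypeR R * Z) : \bar R :=
  (f (clamp T w.1) w.2 * \1_(`[0, t]%classic) w.1)%:E.
have mF : measurable_fun setT F.
  apply/measurable_EFinP; apply: measurable_funM; first exact: measurable_clamped.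
  apply: (measurableT_comp _ measurable_fst).
  by apply: measurable_indic; exact: measurable_itv.
have F0 w : (0 <= F w)%E by rewrite lee_fin mulr_ge0.
have -> : (fun z => \int[lebesgue_measure]_(tau in `[0, t]) f tau z) =
    fine \o (fun z => \int[lebesgue_measure]_tau F (tau, z))%E.
  apply/funext => z /=; rewrite /Rintegral integral_mkcond; congr fine.
  apply: eq_integral => tau _; rewrite patchE /F /= indicE.
  case: ifPn => [/set_mem|_]; last by rewrite mulr0.
  rewrite /= in_itv/= => /andP[tau0 taut]; rewrite mulr1 clamp_id//.
  by rewrite tau0 (le_trans taut).
apply: (measurableT_comp (fine_measurable measurableT)).
exact: (@measurable_fun_fubini_tonelli_G _ _ _ _ _ lebesgue_measure F mF F0).
Qed.

Variable m : {sigma_finite_measure set Z -> \bar R}.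

(* For each q there is at most one right end t of a plateau through q, so the
   bad set is null in each time section, hence by Tonelli for a.e. time. *)
Lemma ae_no_plateau_end : {ae lebesgue_measure, forall t : R, 0 <= t <= T ->
  {ae m, forall z, ~ plateau_end T (f ^~ z) t}}.
Proof.
pose M (t : R) z := running_max (f ^~ z) (clamp T t).
have T0' := ltW T0.
have mM : measurable_fun setT (fun w : measurableTypeR R * Z => M w.1 w.2).
  apply: caratheodory_measurable => [t|z].
    by apply: measurable_running_max; exact: clamp_itv.
  apply: (@lipschitz_clamp_continuous (running_max (f ^~ z)) (c z)) => //.
  by apply: lipschitz_running_max => //; exact: lip_f.
have mMc t : measurable_fun setT (fun w : measurableTypeR R * Z => M t w.2).
  apply: (measurableT_comp _ measurable_snd).
  by apply: measurable_running_max; exact: clamp_itv.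
(* Plateau ends with witness [q]. Later times are tested at rationals only: the set becomes
   measurable, and still contains every pair to be excluded. *)
pose Bad (q : rat) : set (measurableTypeR R * Z) :=
  [set w | [/\ 0 <= (ratr q : R) < w.1, w.1 <= T, M (ratr q) w.2 = M w.1 w.2 &
    forall s : rat, w.1 < clamp T (ratr s) -> M w.1 w.2 < M (ratr s) w.2]].
have mBad q : measurable (Bad q).
  have -> : Bad q = ((fun w => w.1) @^-1` `]ratr q, T]%classic `&`
      [set w | 0 <= ratr q :> R]) `&`
      ((fun w => M (ratr q) w.2 - M w.1 w.2) @^-1` [set 0] `&`
      \bigcap_(s : rat) ((fun w => w.1) @^-1` `[clamp T (ratr s), +oo[%classic `|`
        (fun w => M (ratr s) w.2 - M w.1 w.2) @^-1` `]0, +oo[%classic)).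
    apply/seteqP; split => w /=.
      move=> [/andP[q0 qw] wT MM H]; rewrite in_itv/= qw wT; split => //; split.
        by rewrite MM subrr.
      move=> s _ /=; rewrite !in_itv/= !andbT.
      have [ws|sw] := ltP w.1 (clamp T (ratr s)); last by left.
      by right; rewrite subr_gt0; exact: H.
    rewrite in_itv/= => -[[/andP[qw wT] q0] [/eqP MM H]]; split => //.
    - by rewrite q0.
    - by apply/eqP; rewrite -subr_eq0.
    - move=> s ws; have [] := H s I; rewrite /= in_itv/= andbT.
        by rewrite leNgt ws.
      by rewrite subr_gt0.
  have mfst : measurable_fun setT (fun w : measurableTypeR R * Z => w.1).
    exact: measurable_fst.
  have mdiff (s : rat) : measurable_fun setT
      (fun w : measurableTypeR R * Z => M (ratr s) w.2 - M w.1 w.2).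
    exact: measurable_funB.
  apply: measurableI; apply: measurableI.
  - by rewrite -[X in measurable X]setTI; apply: mfst.
  - by have [h|h] := boolP (0 <= (ratr q : R));
      [rewrite (_ : [set w | _] = setT)|rewrite (_ : [set w | _] = set0)];
      rewrite ?predeqE.
  - by rewrite -[X in measurable X]setTI; apply: mdiff.
  - rewrite -[X in measurable X]setCK setC_bigcap; apply: measurableC.
    apply: bigcupT_measurable_rat => s; apply: measurableC; apply: measurableU.
      by rewrite -[X in measurable X]setTI; apply: mfst.
    by rewrite -[X in measurable X]setTI; apply: mdiff.
have Bad_null q : (lebesgue_measure \x m)%E (Bad q) = 0%E.
  transitivity (\int[m]_z (lebesgue_measure \o ysection (Bad q)) z)%E.
    have := indic_fubini_tonelli lebesgue_measure m (mBad q).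
    have -> : fubini_G lebesgue_measure (EFin \o \1_(Bad q)) = lebesgue_measure \o ysection (Bad q) :> (Z -> \bar R).
      exact: (indic_fubini_tonelli_GE lebesgue_measure (mBad q)).
    by rewrite (indic_fubini_tonelli_FE m (mBad q)).
  apply: integral0_eq => z _ /=.
  (* Two ends [t < t'] with the same [q] have equal maxima, against the strict growth after [t] at a
     rational time between them. *)
  have sub1 t t' : Bad q (t, z) -> Bad q (t', z) -> t < t' -> False.
    move=> [/= /andP[q0 qt] tT Mq H] [/= /andP[_ qt'] t'T Mq' _] tt'.
    have [x [xI [y _ yx]]] := @dense_rat R `]t, t'[%classic
      ltac:(by exists ((t + t') / 2); rewrite /= in_itv/=; apply/andP; split; lra)
      ltac:(exact: interval_open).
    move: xI; rewrite /= in_itv/= -yx => /andP[ty yt'].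
    have t0 : 0 <= t by rewrite (le_trans q0)// ltW.
    have y0 : 0 <= ratr y :> R by rewrite (le_trans t0)// ltW.
    have yT : ratr y <= T by rewrite (le_trans (ltW yt')).
    have := H y; rewrite clamp_id ?y0// => /(_ ty).
    rewrite -Mq Mq' /M !clamp_id ?y0// ?t'T ?(le_trans y0 (ltW yt'))//.
    by rewrite ltNge => /negP; apply; apply: (running_max_homo (c0 z) (lip_f z)) => //; exact: ltW.
  have sub t t' : Bad q (t, z) -> Bad q (t', z) -> t = t'.
    by move=> h h'; have [tt'|tt'|//] := ltgtP t t';
      [have := sub1 _ _ h h' tt'|have := sub1 _ _ h' h tt'].
  have [[t Bt]|nB] := pselect (exists t, Bad q (t, z)).
    have -> : ysection (Bad q) z = [set t].
      apply/seteqP; split => t'; rewrite ysectionE/=; first by move=> /sub; exact.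
      by move=> ->.
    exact: lebesgue_measure_set1.
  rewrite (_ : ysection _ _ = set0) ?measure0//.
  by apply/seteqP; split => // t; rewrite ysectionE/= => Bt; apply: nB; exists t.
have Bad_ae q : {ae lebesgue_measure, forall t : R, m (xsection (Bad q) t) = 0%E}.
  exact: (null_xsection (mBad q) (Bad_null q)).
apply: ae_imp (ae_forall_countable Bad_ae) => t Bt tT.
have : {ae m, forall z, forall q : rat, ~ Bad q (t, z)}.
  apply: ae_forall_countable => q; exists (xsection (Bad q) t); split => //.
  - exact: measurable_xsection.
  - exact: Bt.
  - by move=> z /= /contrapT; rewrite xsectionE.
apply: ae_imp => z nB [q [q0t Mqt H]]; apply: (nB q).
have /andP[t0 tT'] := tT; have /andP[q0 qt] := q0t.
split => //=; first by rewrite /M !clamp_id ?q0 ?(le_trans (ltW qt)).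
move=> s ts; rewrite /M (clamp_id tT); apply: H.
by rewrite ts; have /andP[_ ->] := clamp_itv T0' (ratr s).
Qed.

End caratheodory_functions.

(** * Bonds and constitutive functions *)

Section scalar_profiles.
Context {R : realType}.
Implicit Types (f g h : R -> R).

Lemma bounded_deriv_lipschitz f (K : R) : (forall r, derivable f r 1) ->
  (forall r, `|derive1 f r| <= K) -> forall x y, `|f x - f y| <= K * `|x - y|.
Proof.
move=> df fK x y; wlog yx : x y / y <= x => [wl|].
  have [yx|/ltW xy] := leP y x; first exact: wl.
  by rewrite distrC [X in _ <= _ * X]distrC; exact: wl.
have [c _ ->] : exists2 c, c \in `[y, x] & f x - f y = derive1 f c * (x - y).
  apply: MVT_segment => //.
    by move=> z _; rewrite derive1E; apply/derivableP/df.
  apply: derivable_within_continuous => z _; exact: df.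
by rewrite normrM ler_wpM2r.
Qed.

Lemma derivable_continuous_at f x : derivable f x 1 -> {for x, continuous f}.
Proof. by move=> /derivable1_diffP/differentiable_continuous. Qed.

Lemma smooth_strict_deriv h : smooth h ->
  forall x, strict_deriv setT h x (derive1 h x).
Proof.
move=> sh x; apply: C1_strict_deriv; first exact: (sh 0%N).
exact: derivable_continuous_at (sh 1%N x).
Qed.

(** Off [[a, b]] the function is locally constant and its derivative vanishes; on it the continuous
    derivative attains a maximum. Minimum and maximum make [[a, b]] nonempty whatever the order of
    [lo] and [hi]. *)
Lemma const_tails_lipschitz h (lo hi c1 c2 : R) : smooth h ->
  (forall r, r < lo -> h r = c1) -> (forall r, hi <= r -> h r = c2) ->
  exists2 H : R, 0 <= H & forall x y, `|h x - h y| <= H * `|x - y|.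
Proof.
move=> sh hlo hhi; pose a := Num.min lo hi; pose b := Num.max lo hi.
have ab : a <= b by rewrite /a /b ge_min le_max lexx.
have [c _ Hc] : exists2 c, c \in `[a, b] &
    forall t, t \in `[a, b] -> `|derive1 h t| <= `|derive1 h c|.
  apply: (@EVT_max _ (fun t => `|derive1 h t|)) => //.
  apply: continuous_subspaceT => t; apply: cvg_norm.
  exact: derivable_continuous_at (sh 1%N t).
exists `|derive1 h c| => //; apply: bounded_deriv_lipschitz; first exact: (sh 0%N).
move=> r; have [rI|] := boolP (r \in `[a, b]); first exact: Hc.
have flat (e k : R) : 0 < e -> (forall p, `|p - r| < e -> h p = k) -> derive1 h r = 0.
  move=> e0 H; apply: (@strict_deriv_derive1 _ setT); first exact: filterT.
  by apply: (strict_deriv_near e0 _ (strict_deriv_cst _ k r)) => p _; exact: H.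
rewrite in_itv/= negb_and -!ltNge => /orP[ra|br].
  rewrite (flat (a - r) c1) ?subr_gt0 ?normr0// => p.
  rewrite ltr_norml => /andP[_ pa]; apply: hlo.
  have : a <= lo by rewrite /a ge_min lexx.
  lra.
rewrite (flat (r - b) c2) ?subr_gt0 ?normr0// => p.
rewrite ltr_norml => /andP[pb _]; apply: hhi.
have : hi <= b by rewrite /b le_max lexx orbT.
lra.
Qed.

Lemma damage_profile_a_lipschitz h xD : damage_profile_a h xD ->
  exists2 H : R, 0 <= H & forall x y, `|h x - h y| <= H * `|x - y|.
Proof.
move=> [_ sh _ h1 _ h0]; exact: const_tails_lipschitz sh h1 h0.
Qed.

Lemma damage_profile_b_lipschitz h rp rD : damage_profile_b h rp rD ->
  exists2 H : R, 0 <= H & forall x y, `|h x - h y| <= H * `|x - y|.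
Proof.
move=> [_ sh _ h1 _ h0]; apply: (@const_tails_lipschitz h rp rD 1 0) => // r rrp.
by apply: h1; exact: ltW.
Qed.

(** [profile_a_one] stops short of 0, where monotonicity starts; [h 0 <= 1] is therefore a limit
    from the left, taken at [- (e / (H + 1))] with the Lipschitz bound. *)
Lemma damage_profile_a_le1 h xD : damage_profile_a h xD -> forall r, `|h r| <= 1.
Proof.
move=> hp r; have [xD0 _ h_ge0 h1 hni h0] := hp.
have [H H0 LH] := damage_profile_a_lipschitz hp.
rewrite ger0_norm//; have [/h1->//|r0] := ltP r 0.
have [xDr|rxD] := leP xD r; first by rewrite h0.
apply: (@le_trans _ _ (h 0)); first exact: hni.
apply/ler_addgt0Pr => e e0.
have d0 : 0 < e / (H + 1) by rewrite divr_gt0// ltr_wpDl.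
have := LH 0 (- (e / (H + 1))); rewrite (h1 (- _)) ?oppr_lt0// sub0r opprK.
rewrite (gtr0_norm d0) => /(le_trans (ler_norm _)) /le_trans H'.
rewrite -lerBlDl; apply: H'.
rewrite mulrA ler_pdivrMr ?ltr_wpDl// mulrC ler_wpM2l//; first exact: ltW.
by rewrite lerDl.
Qed.

Lemma damage_profile_b_le1 h rp rD : damage_profile_b h rp rD -> forall r, `|h r| <= 1.
Proof.
move=> [rpD _ h_ge0 h1 hni h0] r; rewrite ger0_norm//.
have [/h1->//|/ltW rpr] := leP r rp.
have [rDr|/ltW rrD] := leP rD r; first by rewrite h0.
by rewrite -(h1 rp (lexx _)); apply: hni.
Qed.

(** [g] is constant on both tails and Lipschitz between [rm] and [rp], whence the three terms of
    [G0]. *)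
Lemma bond_potential_bounds g rm re rc rp Cm Cp :
  bond_potential g rm re rc rp Cm Cp -> exists G0 G1 : R,
  [/\ 0 <= G0, 0 <= G1, forall r, `|g r| <= G0,
      forall r, `|derive1 g r| <= G1 & forall x y, `|g x - g y| <= G1 * `|x - y|].
Proof.
move=> [_ dg _ _ [M [Mr HM]] _ gl gr _ _ _].
pose G1 := `|M| + 1.
have G10 : 0 <= G1 by rewrite addr_ge0.
have g'b r : `|derive1 g r| <= G1.
  by apply: (HM G1) => //; rewrite /G1 ltr_pwDr// ler_norm.
have Lg := bounded_deriv_lipschitz dg g'b.
exists (`|Cm| + G1 * `|rp - rm| + `|Cp|), G1; split => //.
  by rewrite !addr_ge0// mulr_ge0.
move=> r; have [rpr|rrp] := leP rp r.
  by rewrite (gr r rpr) lerDr addr_ge0// mulr_ge0.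
have [/gl ->|rmr] := leP r rm.
  by rewrite -addrA lerDl addr_ge0// mulr_ge0.
have : `|g r - g rm| <= G1 * `|rp - rm|.
  apply: (le_trans (Lg _ _)); rewrite ler_wpM2l// !gtr0_norm ?subr_gt0//.
    by rewrite lerB// ltW.
  exact: lt_trans rrp.
rewrite (gl rm (lexx _)) => H; rewrite -[X in `|X|](subrK Cm).
apply: le_trans (ler_normD _ _) _; rewrite addrC -addrA lerD2l.
by apply: le_trans H _; rewrite lerDl.
Qed.

Lemma bond_potential_strict_deriv g rm re rc rp Cm Cp :
  bond_potential g rm re rc rp Cm Cp ->
  forall x, strict_deriv setT g x (derive1 g x).
Proof.
move=> [_ dg d2g _ _ _ _ _ _ _ _] x; apply: C1_strict_deriv => //.
exact: derivable_continuous_at (d2g x).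
Qed.

End scalar_profiles.

(** * Primitives of bounded Lipschitz functions *)

Section primitives.
Context {R : realType}.
Variables (T : R) (phi : R -> R) (L C : R).
Hypotheses (T0 : 0 < T) (L0 : 0 <= L) (C0 : 0 <= C).
Hypothesis Lphi : lipschitz_on T phi L.
Hypothesis phiC : forall t, 0 <= t <= T -> `|phi t| <= C.

Let integrable_phi : lebesgue_measure.-integrable `[0, T] (EFin \o phi).
Proof.
apply: (@bounded_integrable _ _ _ lebesgue_measure _ _ C) => //=.
- by rewrite lebesgue_measure_itv/= lte_fin T0 -EFinD ltry.
- apply: (@eq_measurable_fun _ _ _ _ _ (phi \o clamp T)).
    by move=> t; rewrite inE/= in_itv/= => /clamp_id ->.
  apply: measurable_funTS; apply: continuous_measurable_fun.
  exact: (lipschitz_clamp_continuous L0 (ltW T0) Lphi).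
Qed.

Lemma strict_deriv_integral t : 0 <= t <= T -> strict_deriv `[0, T]
  (fun s => \int[lebesgue_measure]_(tau in `[0, s]) phi tau) t (phi t).
Proof.
move=> tT; apply: strict_deriv_primitive => // e e0.
exists (e / (L + 1)); first by rewrite divr_gt0// ltr_wpDl.
apply: aeW => tau tauT taut; apply: (le_trans (Lphi tauT tT)).
apply: (@le_trans _ _ ((L + 1) * (e / (L + 1)))).
  by apply: ler_pM => //; [rewrite lerDl|exact: ltW].
by rewrite mulrC divfK// gt_eqF// ltr_wpDl.
Qed.

Lemma lipschitz_integral : lipschitz_on T
  (fun s => \int[lebesgue_measure]_(tau in `[0, s]) phi tau) C.
Proof.
move=> p q; wlog qp : p q / q <= p => [wl pT qT|].
  have [qp|/ltW pq] := leP q p; first exact: wl.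
  by rewrite distrC [X in _ <= _ * X]distrC; exact: wl.
move=> /andP[p0 pT] /andP[q0 qT].
have ip : lebesgue_measure.-integrable `[0, p] (EFin \o phi).
  by apply: integrableS integrable_phi => //; apply: subset_itvl; rewrite bnd_simp.
rewrite (@Rintegral_itvB _ phi (BLeft 0) (BRight p) q ip); last 2 first.
- by rewrite bnd_simp.
- by rewrite bnd_simp.
have iqp : lebesgue_measure.-integrable `]q, p] (EFin \o phi).
  by apply: integrableS ip => //; apply: subset_itvr; rewrite bnd_simp.
have mI : lebesgue_measure `]q, p]%classic = (p - q)%:E.
  rewrite lebesgue_measure_itv/= lte_fin; case: ltP => // pq.
  have -> : p = q by apply/eqP; rewrite eq_le pq qp.
  by rewrite subrr.
have -> : C * `|p - q| = \int[lebesgue_measure]_(tau in `]q, p]) `|cst C tau|.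
  by rewrite /= Rintegral_cst// [X in fine X]mI/= ger0_norm ?subr_ge0// ger0_norm.
apply: ae_bounded_Rintegral => //.
- apply: measurable_ae_measurable.
  by case/integrableP : iqp => /measurable_EFinP.
- apply: (@bounded_integrable _ _ _ lebesgue_measure _ _ `|C|) => //=.
  by rewrite [X in (X < _)%E]mI ltry.
- apply: aeW => tau; rewrite /= in_itv/= => /andP[qt tp].
  by apply: phiC; rewrite (le_trans q0 (ltW qt)) (le_trans tp pT).
Qed.

End primitives.

(** * Bond geometry and the nonlocal kernel *)

Section bonds.
Context {R : realType} {d : nat}.
Local Notation mu := (@lebesgue_rV R d).
Local Notation pt := 'rV[R]_d.
Local Notation pm := (mu \x mu)%E.
Local Notation vfield := (pt -> pt).
Implicit Types (w : vfield) (z : pt * pt).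

(* A bond is the pair (x, y) of its end points, in this order, whereas strains
   and kernels take y first. *)
Definition stretch w z : R :=
  dotr ((bond_length z)^-1 *: (w z.2 - w z.1)) (bond_dir z.2 z.1).

Lemma stretchE w z : stretch w z = \sum_i
  ((bond_length z)^-1 * bond_dir z.2 z.1 ord0 i) * (w z.2 ord0 i - w z.1 ord0 i).
Proof. by apply: eq_bigr => i _; rewrite !mxE mulrAC. Qed.

Lemma bond_dir_le1 z i : `|bond_dir z.2 z.1 ord0 i| <= 1.
Proof.
rewrite mxE -/(bond_length z) normrM normfV (ger0_norm (bond_length_ge0 z)).
have := coord_le_enorm (z.2 - z.1) i; rewrite -/(bond_length z).
have := bond_length_ge0 z; rewrite le_eqVlt => /orP[/eqP<- _|n0 H].
  by rewrite invr0 mul0r.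
by rewrite mulrC ler_pdivrMr// mul1r.
Qed.

Lemma stretch_le w z (K : R) : (forall i, `|w z.2 ord0 i - w z.1 ord0 i| <= K) ->
  `|stretch w z| <= (d%:R * K) * (bond_length z)^-1.
Proof.
move=> wK; rewrite stretchE; apply: le_trans (ler_norm_sum _ _ _) _.
apply: (@le_trans _ _ (\sum_(i < d) (bond_length z)^-1 * K)).
  apply: ler_sum => i _; rewrite normrM; apply: ler_pM => //.
  rewrite normrM normfV (ger0_norm (bond_length_ge0 z)) ler_piMr ?invr_ge0//.
    exact: bond_length_ge0.
  exact: bond_dir_le1.
rewrite sumr_const card_ord -[leLHS]mulr_natl.
by rewrite le_eqVlt; apply/orP; left; apply/eqP; ring.
Qed.

(** Each of the [d] coordinates contributes at most [2 * L], one [L] per end point, and the strain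
    divides by the bond length. *)
Lemma lipschitz_stretch (U : R -> vfield) (T L : R) z :
  (forall x i, lipschitz_on T (fun t => U t x ord0 i) L) ->
  lipschitz_on T (fun s => stretch (U s) z) (d%:R * (2 * L) * (bond_length z)^-1).
Proof.
move=> lip_U p q pT qT.
have -> : stretch (U p) z - stretch (U q) z = stretch (fun x => U p x - U q x) z.
  by rewrite !stretchE -sumrB; apply: eq_bigr => i _; rewrite !mxE; ring.
rewrite (_ : d%:R * _ * _ * _ = d%:R * ((2 * L) * `|p - q|) * (bond_length z)^-1);
  last by ring.
apply: stretch_le => i; rewrite !mxE.
rewrite (_ : _ - _ = (U p z.2 ord0 i - U q z.2 ord0 i) -
  (U p z.1 ord0 i - U q z.1 ord0 i)); last by ring.
apply: le_trans (ler_normB _ _) _.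
apply: le_trans (lerD (lip_U _ i p q pT qT) (lip_U _ i p q pT qT)) _.
by rewrite le_eqVlt; apply/orP; left; apply/eqP; ring.
Qed.

(** Origin of the weak singularity: [bond_r] weighs a strain of order [1 / |y - x|] by
    [sqrt |y - x|]. Length zero is covered because the inverse of zero is zero. *)
Lemma sqrt_bond_lengthV z : Num.sqrt (bond_length z) * (bond_length z)^-1 =
  (Num.sqrt (bond_length z))^-1.
Proof.
have := bond_length_ge0 z; rewrite le_eqVlt => /orP[/eqP<-|n0].
  by rewrite sqrtr0 !invr0 mulr0.
have s0 : Num.sqrt (bond_length z) != 0 by rewrite gt_eqF// sqrtr_gt0.
rewrite -{2}(sqr_sqrtr (bond_length_ge0 z)) expr2 invfM mulrA divff// mul1r.
by [].
Qed.

Lemma lipschitz_bond_r (U : R -> vfield) (T L : R) z :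
  (forall x i, lipschitz_on T (fun t => U t x ord0 i) L) ->
  lipschitz_on T (fun s => bond_r U s z.2 z.1)
    (d%:R * (2 * L) * (Num.sqrt (bond_length z))^-1).
Proof.
move=> lip_U p q pT qT.
rewrite -[bond_r U p _ _]/(Num.sqrt (bond_length z) * stretch (U p) z).
rewrite -[bond_r U q _ _]/(Num.sqrt (bond_length z) * stretch (U q) z).
rewrite -mulrBr normrM (ger0_norm (sqrtr_ge0 _)) -sqrt_bond_lengthV.
rewrite mulrCA -[leRHS]mulrA ler_wpM2l ?sqrtr_ge0//.
exact: lipschitz_stretch.
Qed.

Lemma bond_r_le (U : R -> vfield) s z (C : R) : (forall x i, `|U s x ord0 i| <= C) ->
  `|bond_r U s z.2 z.1| <= d%:R * (2 * C) * (Num.sqrt (bond_length z))^-1.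
Proof.
move=> UC; rewrite -[bond_r U s _ _]/(Num.sqrt (bond_length z) * stretch (U s) z).
rewrite normrM (ger0_norm (sqrtr_ge0 _)) -sqrt_bond_lengthV mulrCA.
rewrite ler_wpM2l ?sqrtr_ge0//; apply: stretch_le => i.
apply: le_trans (ler_normB _ _) _.
by rewrite mulr_natl mulr2n lerD.
Qed.

Lemma measurable_bond_dir i : measurable_fun setT (fun z => bond_dir z.2 z.1 ord0 i).
Proof.
under eq_fun do rewrite !mxE.
apply: measurable_funM; first exact: (measurableT_comp measurable_invr measurable_bond_length).
by apply: measurable_funB; [exact: measurable_snd_coord|exact: measurable_fst_coord].
Qed.

Lemma measurable_stretch w : (forall i, measurable_fun setT (fun x => w x ord0 i)) ->
  measurable_fun setT (stretch w).
Proof.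
move=> mw; under [stretch w]funext do rewrite stretchE.
apply: measurable_sum => i; apply: measurable_funM.
  apply: measurable_funM; last exact: measurable_bond_dir.
  exact: (measurableT_comp measurable_invr measurable_bond_length).
by apply: measurable_funB; apply: (measurableT_comp (mw i));
  [exact: measurable_snd|exact: measurable_fst].
Qed.

Lemma measurable_bond_r (U : R -> vfield) s :
  (forall i, measurable_fun setT (fun x => U s x ord0 i)) ->
  measurable_fun setT (fun z : pt * pt => bond_r U s z.2 z.1).
Proof.
move=> mU; apply: measurable_funM; last exact: (measurable_stretch mU).
exact: (measurableT_comp measurable_sqrtr measurable_bond_length).
Qed.

Lemma strict_deriv_sum (I : Type) (s : seq I) (A : set R) (f : I -> R -> R) t (l : I -> R) :
  (forall i, strict_deriv A (f i) t (l i)) ->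
  strict_deriv A (fun p => \sum_(i <- s) f i p) t (\sum_(i <- s) l i).
Proof.
move=> H; elim: s => [|i s IH].
  rewrite big_nil; apply: eq_strict_deriv (strict_deriv_cst _ 0 t) => p _.
  by rewrite big_nil.
rewrite big_cons; apply: eq_strict_deriv (strict_derivD (H i) IH) => p _.
by rewrite big_cons.
Qed.

Lemma strict_deriv_stretch (A : set R) (U : R -> vfield) w t z :
  (forall i, strict_deriv A (fun s => U s z.1 ord0 i) t (w z.1 ord0 i)) ->
  (forall i, strict_deriv A (fun s => U s z.2 ord0 i) t (w z.2 ord0 i)) ->
  strict_deriv A (fun s => stretch (U s) z) t (stretch w z).
Proof.
move=> H1 H2; rewrite stretchE.
apply: (eq_strict_deriv (fun p _ => stretchE (U p) z)).
apply: strict_deriv_sum => i; apply: strict_derivZ.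
have := strict_derivD (H2 i) (strict_derivZ (-1) (H1 i)); rewrite mulN1r.
by apply: eq_strict_deriv => p _; rewrite mulN1r.
Qed.

Lemma bond_lengthC (x y : pt) : bond_length (x, y) = bond_length (y, x).
Proof.
rewrite /bond_length /enorm; congr Num.sqrt; apply: eq_bigr => i _.
by rewrite !mxE -[LHS]mulrNN !opprB.
Qed.

Lemma bond_dirC (x y : pt) i : bond_dir x y ord0 i = - bond_dir y x ord0 i.
Proof.
rewrite !mxE -/(bond_length (y, x)) -/(bond_length (x, y)) bond_lengthC.
by rewrite -mulrN opprB.
Qed.

Lemma strainC (u : R -> vfield) s (x y : pt) : strain u s x y = strain u s y x.
Proof.
rewrite -[LHS]/(stretch (u s) (y, x)) -[RHS]/(stretch (u s) (x, y)) !stretchE.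
by apply: eq_bigr => i _; rewrite bond_lengthC /= bond_dirC; ring.
Qed.

Lemma bond_rC (u : R -> vfield) s (x y : pt) : bond_r u s x y = bond_r u s y x.
Proof. by rewrite /bond_r strainC -/(bond_length (y, x)) bond_lengthC. Qed.

Section kernel.
Variables (A : set pt) (eps B : R) (J : R -> R) (M : R) (j : 'I_d).
Hypotheses (mA : measurable A) (eps0 : 0 < eps) (B0 : 0 < B).
Hypothesis AB : forall x, A x -> forall i, `|x ord0 i| <= B.
Hypothesis hJ : influence_function J M.

(** [nonlocal_kernel] carries the indicator at [y] only. The extra factor makes the kernel symmetric
    and lets integrals run over the whole product space. *)
Definition bond_kernel z : R := \1_A z.1 * nonlocal_kernel A eps J z.2 z.1.

Lemma measurable_bond_kernel : measurable_fun setT bond_kernel.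
Proof.
apply: measurable_funM.
  by apply: (measurableT_comp _ measurable_fst); exact: measurable_indic.
apply: measurable_funM => //; apply: measurable_funM.
  by apply: (measurableT_comp _ measurable_snd); exact: measurable_indic.
(* [J] is controlled on nonnegative arguments; composing with the positive part gives a function
   nonincreasing on the whole line, hence measurable. *)
rewrite (_ : (fun z : pt * pt => _) = (fun r => J (Num.max r 0)) \o
    (fun z : pt * pt => bond_length z / eps)); last first.
  apply/funext => z /=; rewrite (max_idPl _)//.
  by rewrite divr_ge0 ?bond_length_ge0// ltW.
apply: measurableT_comp; last first.
  by apply: measurable_funM => //; exact: measurable_bond_length.
apply: nonincreasing_measurable => // r s rs.
apply: (influence_noninc hJ); first by rewrite le_max lexx orbT.
by rewrite ge_max !le_max rs lexx orbT.
Qed.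

Let V0 : 0 <= eps * (@unit_ball_volume R d * eps ^+ d).
Proof.
by rewrite mulr_ge0 ?(ltW eps0)// mulr_ge0 ?exprn_ge0 ?(ltW eps0)// fine_ge0.
Qed.

Let J_ge0 z : 0 <= J (bond_length z / eps).
Proof.
by apply: (influence_ge0 hJ); rewrite divr_ge0 ?bond_length_ge0// ltW.
Qed.

Lemma bond_kernel_ge0 z : 0 <= bond_kernel z.
Proof.
rewrite /bond_kernel /nonlocal_kernel mulr_ge0 ?indicE ?ler0n//.
by rewrite mulr_ge0 ?invr_ge0// mulr_ge0 ?indicE ?ler0n//; exact: J_ge0.
Qed.

Lemma bond_kernel_out z : ~ (A z.1 /\ A z.2) -> bond_kernel z = 0.
Proof.
move=> nA; rewrite /bond_kernel /nonlocal_kernel !indicE.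
have [/set_mem A1|_] := boolP (z.1 \in A); last by rewrite mul0r.
have [/set_mem A2|_] := boolP (z.2 \in A); last by rewrite !mul0r mulr0.
by case: nA.
Qed.

Let bond_kernel_le : exists2 K : R, 0 <= K &
  forall z, bond_kernel z <= K * \1_(A `*` A) z.
Proof.
exists (M / (eps * (@unit_ball_volume R d * eps ^+ d))).
  by rewrite divr_ge0// -(influence_0 hJ); apply: (influence_ge0 hJ).
move=> z; have [zA|nz] := pselect (A z.1 /\ A z.2); last first.
  by rewrite bond_kernel_out// indicE memNset ?mulr0.
rewrite /bond_kernel /nonlocal_kernel !indicE !mem_set//; [|exact: zA.2|exact: zA.1].
rewrite !mul1r mulr1 ler_wpM2r ?invr_ge0// -(influence_0 hJ).
apply: (influence_noninc hJ) => //.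
by rewrite divr_ge0 ?bond_length_ge0// ltW.
Qed.

Lemma integrable_bond_kernelM (w : pt * pt -> R) : measurable_fun setT w ->
  (forall z, 0 <= w z) -> pm.-integrable (A `*` A) (EFin \o w) ->
  pm.-integrable setT (EFin \o (fun z => bond_kernel z * w z)).
Proof.
move=> mw w0 iw; have [K K0 kK] := bond_kernel_le.
have mAA : measurable (A `*` A) by exact: measurableX.
have iw' : pm.-integrable setT ((EFin \o w) \_ (A `*` A)).
  by apply/integrable_restrict => //; rewrite setTI.
apply: (@le_integrable _ _ _ pm setT measurableT _
  (fun z => (K%:E * ((EFin \o w) \_ (A `*` A)) z)%E)) => //; last exact: integrableZl.
  by apply/measurable_EFinP; apply: measurable_funM => //; exact: measurable_bond_kernel.
move=> z _ /=; have H := kK z.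
rewrite patchE; case: ifPn => zA.
  rewrite lee_fin (ger0_norm (mulr_ge0 (bond_kernel_ge0 z) (w0 z))).
  rewrite (ger0_norm (mulr_ge0 K0 (w0 z))) ler_wpM2r//.
  by move: H; rewrite indicE zA mulr1.
have -> : bond_kernel z = 0.
  apply/eqP; rewrite eq_le bond_kernel_ge0 andbT.
  by move: H; rewrite indicE (negbTE zA) mulr0.
by rewrite mul0r mule0 normr0 abse0.
Qed.

Lemma integrable_bond_kernel : pm.-integrable setT (EFin \o bond_kernel).
Proof.
have := @integrable_bond_kernelM (cst 1) (measurable_cst _) (fun=> ler01).
rewrite (_ : (fun z => _) = bond_kernel); last first.
  by apply/funext => z; rewrite mulr1.
apply; apply: (@bounded_integrable _ _ _ pm _ _ 1) => //.
- exact: measurableX.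
- rewrite [X in (X < _)%E]product_measure1E//.
  have muA := finite_box_measure mA B0 AB.
  by rewrite lte_mul_pinfty// ge0_fin_numE.
- by move=> z _; rewrite normr1.
Qed.

Lemma integrable_bond_kernel_sqrt (K : R) : 0 <= K ->
  pm.-integrable setT (EFin \o (fun z =>
    bond_kernel z * (K * (Num.sqrt (bond_length z))^-1))).
Proof.
move=> K0; apply: integrable_bond_kernelM.
- apply: measurable_funM => //; apply: (measurableT_comp measurable_invr).
  exact: (measurableT_comp measurable_sqrtr measurable_bond_length).
- by move=> z; rewrite mulr_ge0// invr_ge0 sqrtr_ge0.
- have mAA : measurable (A `*` A) by exact: measurableX.
  have := integrable_inv_sqrt_bond_length j mA B0 AB.
  by move=> /(integrableZl mAA K).
Qed.

End kernel.

End bonds.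

(** * Energy balance *)

Section kinetic.
Context {R : realType} {d : nat}.
Local Notation mu := (@lebesgue_rV R d).
Local Notation pt := 'rV[R]_d.
Local Notation vfield := (pt -> pt).
Variables (Omega : set pt) (T : R).
Hypotheses (T0 : 0 < T) (mOmega : measurable Omega) (finOmega : (mu Omega < +oo)%E).

Lemma ae_bounded_integrable (f : pt -> R) (c : R) : measurable_fun Omega f ->
  {ae mu, forall x, Omega x -> `|f x| <= c} -> mu.-integrable Omega (EFin \o f).
Proof.
move=> mf fc.
have ic : mu.-integrable Omega (EFin \o cst `|c|).
  by apply: (@bounded_integrable _ _ _ mu _ _ `|c|) => //= x _; rewrite normr_id.
have fc' : {ae mu, forall x, Omega x -> `|f x| <= cst `|c| x}.
  by apply: ae_imp fc => x H Ox; apply: le_trans (H Ox) (ler_norm _).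
exact: ae_le_integrable mf ic fc'.
Qed.

Lemma measurable_dotr (f g : vfield) : measurable_fun Omega f ->
  measurable_fun Omega g -> measurable_fun Omega (fun x => dotr (f x) (g x)).
Proof.
move=> mf mg; apply: measurable_sum => i; apply: measurable_funM.
  exact: (measurableT_comp (measurable_coord_rV i) mf).
exact: (measurableT_comp (measurable_coord_rV i) mg).
Qed.

Lemma Linf_norm_fin (w : vfield) : (Linf_norm Omega w < +oo)%E ->
  exists2 K : R, 0 <= K & {ae mu, forall x, Omega x -> forall i, `|w x ord0 i| <= K}.
Proof.
move=> wK; have := Linf_norm_le (lexx (Linf_norm Omega w)).
have : (0 <= Linf_norm Omega w)%E by exact: Lnorm_ge0.
move: wK; case: (Linf_norm Omega w) => [r _ r0 H|//|//].
by exists r => //; apply: ae_imp H => s H Os i; have := H Os i; rewrite lee_fin.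
Qed.

Lemma integrable_dotr (f g : vfield) :
  measurable_fun Omega f -> (Linf_norm Omega f < +oo)%E ->
  measurable_fun Omega g -> (Linf_norm Omega g < +oo)%E ->
  mu.-integrable Omega (EFin \o (fun x => dotr (f x) (g x))).
Proof.
move=> mf /Linf_norm_fin[K K0 fK] mg /Linf_norm_fin[L L0 gL].
apply: (@ae_bounded_integrable _ (\sum_(i < d) K * L)); first exact: measurable_dotr.
apply: ae_imp2 fK gL => x H1 H2 Ox; apply: le_trans (ler_norm_sum _ _ _) _.
by apply: ler_sum => i _; rewrite normrM; apply: ler_pM => //; [exact: H1|exact: H2].
Qed.

(** Along a given sequence of times only countably many null sets occur. This serves the velocity of
    the solution, whose trajectories, unlike those of the displacement, are not assumed
    continuous. *)
Lemma ae_quotient_cvg (u v : R -> vfield) (t : R) (s : nat -> R) :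
  Linf_derivative Omega T u v -> 0 <= t <= T -> (forall n, 0 <= s n <= T) ->
  (forall n, s n != t) -> s n @[n --> \oo] --> t ->
  {ae mu, forall x, Omega x -> forall i,
    (u (s n) x ord0 i - u t x ord0 i) / (s n - t) @[n --> \oo] --> v t x ord0 i}.
Proof.
move=> uv tT sT st sct.
have /choice[dl dlP] : forall k : nat, exists dl : R, 0 < dl /\
    forall c : R, 0 <= c <= T -> `|c - t| < dl ->
    {ae mu, forall x, Omega x -> forall i,
      `|u c x ord0 i - u t x ord0 i - (c - t) * v t x ord0 i| <= k.+1%:R^-1 * `|c - t|}.
  move=> k; have k0 : 0 < k.+1%:R^-1 :> R by rewrite invr_gt0.
  by have [dl dl0 H] := Linf_derivativeP uv tT k0; exists dl.
have : {ae mu, forall x, forall k n, `|s n - t| < dl k -> Omega x -> forall i,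
    `|u (s n) x ord0 i - u t x ord0 i - (s n - t) * v t x ord0 i| <=
    k.+1%:R^-1 * `|s n - t|}.
  apply: ae_foralln => k; apply: ae_foralln => n.
  have [h|h] := boolP (`|s n - t| < dl k); last by apply: aeW.
  by apply: ae_imp ((dlP k).2 _ (sT n) h) => x H _.
apply: ae_imp => x H Ox i; apply/cvgrPdist_le => e e0.
have [k _ /(_ k (leqnn k))/= ke] := near_infty_natSinv_lt (PosNum e0).
move/cvgrPdist_lt : sct => /(_ _ (dlP k).1); apply: filterS => n.
rewrite distrC => nd; have {}H := H k n nd Ox i.
have snt : s n - t != 0 by rewrite subr_eq0.
rewrite distrC (_ : _ / _ - _ = (u (s n) x ord0 i - u t x ord0 i -
  (s n - t) * v t x ord0 i) / (s n - t)); last by field.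
rewrite normrM normfV ler_pdivrMr ?normr_gt0//; apply: (le_trans H).
by rewrite ler_wpM2r// ltW.
Qed.

Lemma enorm_sqr (x : pt) : enorm x ^+ 2 = dotr x x.
Proof.
by rewrite sqr_sqrtr//; apply: sumr_ge0 => i _; rewrite -expr2 sqr_ge0.
Qed.

Variables (v a : R -> vfield) (rho : R).
Hypothesis va : Linf_derivative Omega T v a.
Hypothesis mv : forall t : R, 0 <= t <= T -> measurable_fun Omega (v t).
Hypothesis v_fin : forall t : R, 0 <= t <= T -> (Linf_norm Omega (v t) < +oo)%E.
Hypothesis a_fin : forall t : R, 0 <= t <= T -> (Linf_norm Omega (a t) < +oo)%E.
Hypothesis cv : Linf_continuous Omega T v.
Hypothesis ca : Linf_continuous Omega T a.

Lemma kinetic_rate (t : R) : 0 <= t <= T ->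
  is_derivative_on T (kinetic_energy Omega rho v) t
    (\int[mu]_(x in Omega) (rho * dotr (a t x) (v t x))).
Proof.
move=> tT; apply: is_derivative_on_seq => s sT st sct.
have [K K0 vK] := Linf_bounded_path T0 v_fin cv.
have [L L0 vL] := Linf_lipschitz T0 va a_fin ca.
(* The quotient of the kinetic densities, factored as a difference of squares: in each coordinate
   the first factor is bounded by [L] and tends to the acceleration, the second is bounded by
   [K + K]. *)
pose q n x := rho / 2 * \sum_i (v (s n) x ord0 i - v t x ord0 i) / (s n - t) *
  (v (s n) x ord0 i + v t x ord0 i).
have icst (c : R) : 0 <= c <= T -> mu.-integrable Omega
    (EFin \o (fun x => rho * (enorm (v c x) ^+ 2 / 2))).
  move=> cT; have i1 := integrable_dotr (mv cT) (v_fin cT) (mv cT) (v_fin cT).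
  have := integrableZl mOmega (rho / 2) i1.
  congr (is_true (_.-integrable _ _)); apply/funext => x /=.
  by rewrite -EFinM enorm_sqr; congr EFin; ring.
rewrite (_ : (fun n => _) = (fun n => \int[mu]_(x in Omega) q n x)); last first.
  apply/funext => n; rewrite /kinetic_energy -RintegralB//; [|exact: icst|exact: icst].
  rewrite mulrC -RintegralZl//; last first.
    exact: (integrableB mOmega (icst _ (sT n)) (icst _ tT)).
  apply: eq_Rintegral => x _; rewrite /q !enorm_sqr /dotr.
  rewrite (_ : rho * (_ / 2) - _ = rho / 2 * (\sum_i v (s n) x ord0 i * v (s n) x ord0 i -
    \sum_i v t x ord0 i * v t x ord0 i)); last by ring.
  rewrite -sumrB mulrCA; congr (_ * _); rewrite mulr_sumr.
  by apply: eq_bigr => i _; ring.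
have quot := ae_quotient_cvg va tT sT st sct.
apply: (@ae_dominated_convergence _ _ _ mu Omega q _
  (fun=> `|rho / 2| * \sum_(i < d) L * (K + K))) => //.
- move=> n; apply: measurable_ae_measurable; apply: measurable_funM => //.
  have mvi c i : 0 <= c <= T -> measurable_fun Omega (fun x => v c x ord0 i).
    by move=> cT; exact: (measurableT_comp (measurable_coord_rV i) (mv cT)).
  apply: measurable_sum => i; apply: measurable_funM.
    by apply: measurable_funM => //; apply: measurable_funB; exact: mvi.
  by apply: measurable_funD; exact: mvi.
- apply: ae_imp quot => x H Ox; rewrite /q.
  rewrite (_ : rho * dotr _ _ = rho / 2 * \sum_i a t x ord0 i * (v t x ord0 i + v t x ord0 i)); last first.
    by rewrite /dotr !mulr_sumr; apply: eq_bigr => i _; field.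
  apply: cvgM; first exact: cvg_cst.
  apply: cvg_big => [|i _]; first exact: add_continuous.
  have {}H := H Ox i; apply: cvgM => //.
  apply: cvgD; last exact: cvg_cst.
  have -> : (fun n => v (s n) x ord0 i) = (fun n =>
      (v (s n) x ord0 i - v t x ord0 i) / (s n - t) * (s n - t) + v t x ord0 i).
    by apply/funext => n; rewrite divfK ?subrK// subr_eq0.
  rewrite -[X in _ --> X]add0r; apply: cvgD; last exact: cvg_cst.
  rewrite -(mulr0 (a t x ord0 i)); apply: cvgM => //.
  rewrite -(subrr t); apply: cvgB => //; exact: cvg_cst.
- move=> n; have h1 := vL _ _ tT (sT n); have h2 := vK _ (sT n); have h3 := vK _ tT.
  apply: ae_imp2 (ae_imp2 (fun x p1 p2 => conj p1 p2) h1 h2) h3 => x [H1 H2] H3 Ox.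
  rewrite /q normrM ler_wpM2l//; apply: le_trans (ler_norm_sum _ _ _) _.
  apply: ler_sum => i _; rewrite normrM; apply: ler_pM => //.
    rewrite normrM normfV ler_pdivrMr ?normr_gt0 ?subr_eq0//; exact: H1.
  by apply: le_trans (ler_normD _ _) _; apply: lerD; [exact: H2|exact: H3].
- apply: (@bounded_integrable _ _ _ mu _ _ (`|rho / 2| * \sum_(i < d) L * (K + K))) => //.
  move=> x _; rewrite ger0_norm// mulr_ge0// sumr_ge0// => i _.
  by rewrite mulr_ge0// addr_ge0.
Qed.

End kinetic.

Lemma eq_is_derivative_on {R : realType} (T : R) (f f' : R -> R) (t l : R) :
  0 <= t <= T -> (forall s, 0 <= s <= T -> f s = f' s) ->
  is_derivative_on T f' t l -> is_derivative_on T f t l.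
Proof.
move=> tT ff'; rewrite /is_derivative_on; apply: cvg_trans.
apply: near_eq_cvg; rewrite near_withinE; apply: nearW => s.
by rewrite /= in_itv/= => sT; rewrite !ff'.
Qed.

Lemma ae_neq {R : realType} (x : R) : {ae lebesgue_measure, forall t : R, t != x}.
Proof.
exists [set x]; split => //; first exact: lebesgue_measure_set1.
by move=> t /= /negP; rewrite negbK => /eqP.
Qed.

Lemma Rintegral_sum dT (Z : measurableType dT) {R : realType}
    (m : {measure set Z -> \bar R}) (D : set Z) (I : Type) (s : seq I) (f : I -> Z -> R) :
  measurable D -> (forall i, m.-integrable D (EFin \o f i)) ->
  \int[m]_(x in D) (\sum_(i <- s) f i x) = \sum_(i <- s) \int[m]_(x in D) f i x.
Proof.
move=> mD fi; suff [_ //] : m.-integrable D (EFin \o (fun x => \sum_(i <- s) f i x)) /\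
  \int[m]_(x in D) (\sum_(i <- s) f i x) = \sum_(i <- s) \int[m]_(x in D) f i x.
elim: s => [|i s [IHi IH]].
  rewrite big_nil (_ : (fun x => _) = cst 0); last by apply/funext => x; rewrite big_nil.
  by split; [exact: integrable0|rewrite Rintegral_cst// mul0r].
have e : (fun x => \sum_(j <- i :: s) f j x) = (fun x => f i x + \sum_(j <- s) f j x).
  by apply/funext => x; rewrite big_cons.
rewrite e big_cons; split; last by rewrite RintegralD// IH.
exact: (integrableD mD (fi i) IHi).
Qed.

Lemma ae_strict_deriv_stretch {R : realType} {d : nat} (Omega A : set 'rV[R]_d)
    (T : R) (u v U : R -> 'rV[R]_d -> 'rV[R]_d) :
  0 < T -> Linf_derivative Omega T u v -> Linf_continuous Omega T v ->
  continuous_trajectories Omega T u -> A `<=` Omega ->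
  (forall t x, A x -> U t x = u t x) -> (forall t x, ~ A x -> U t x = 0) ->
  forall t, 0 <= t <= T -> {ae (lebesgue_rV d \x lebesgue_rV d)%E, forall z,
    strict_deriv `[0, T] (fun s => stretch (U s) z) t
      (stretch (fun x => if x \in A then v t x else 0) z)}.
Proof.
move=> T0 uv cv traj A_Omega UA UNA t tT.
have aeU : {ae lebesgue_rV d, forall x, forall i,
    strict_deriv `[0, T] (fun s => U s x ord0 i) t
      ((if x \in A then v t x else 0) ord0 i)}.
  apply: ae_imp (ae_strict_deriv_trajectories T0 uv cv traj tT) => x H i.
  have [Ax|nA] := pselect (A x).
    rewrite mem_set//; apply: eq_strict_deriv (H (A_Omega x Ax) i) => p _.
    by rewrite UA.
  rewrite memNset// mxE; apply: eq_strict_deriv (strict_deriv_cst _ 0 t) => p _.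
  by rewrite UNA// mxE.
apply: ae_imp2 (ae_fst (lebesgue_rV d) aeU) (ae_snd (lebesgue_rV d) aeU) => z H1 H2.
exact: strict_deriv_stretch.
Qed.

(** * Energy balance for a general degradation factor *)

Section energy_balance.
Context {R : realType} {d : nat}.
Local Notation mu := (@lebesgue_rV R d).
Local Notation pt := 'rV[R]_d.
Local Notation pm := (mu \x mu)%E.
Local Notation vfield := (pt -> pt).

Variables (Omega : set pt) (B : R) (j : 'I_d).
Hypotheses (mOmega : measurable Omega) (B0 : 0 < B).
Hypothesis OmegaB : forall x, Omega x -> forall i, `|x ord0 i| <= B.
Variables (T eps rho : R) (J : R -> R) (M : R).
Hypotheses (T0 : 0 < T) (eps0 : 0 < eps) (hJ : influence_function J M).
Variables (g : R -> R) (rm re rc rp Cm Cp : R).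
Hypothesis hg : bond_potential g rm re rc rp Cm Cp.
Variables (u0 v0 : vfield) (b : R -> vfield).
Hypothesis hb : C0_X Omega T b.
Variable gamma : (R -> vfield) -> pt -> pt -> R -> R.
Variables u v a : R -> vfield.
Hypothesis hsol : solution Omega eps J g gamma rho T b u0 v0 u v a.

Variables (A : set pt) (U : R -> vfield) (L K : R).
Hypotheses (mA : measurable A) (A_Omega : A `<=` Omega).
Hypothesis ae_A : {ae mu, forall x, Omega x -> A x}.
Hypothesis UA : forall t x, A x -> U t x = u t x.
Hypothesis UNA : forall t x, ~ A x -> U t x = 0.
Hypotheses (L0 : 0 <= L) (K0 : 0 <= K).
Hypothesis mU : forall t : R, 0 <= t <= T -> forall i,
  measurable_fun setT (fun x => U t x ord0 i).
Hypothesis lip_U : forall x i, lipschitz_on T (fun t => U t x ord0 i) L.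

Local Notation k := (bond_kernel A eps J).
Local Notation sq z := (Num.sqrt (bond_length z)).
Let r (s : R) (z : pt * pt) := bond_r U s z.2 z.1.
Let gam (s : R) (z : pt * pt) := gamma U z.2 z.1 s.
(** A common Lipschitz constant in time for [r] and [gam]; [K] is the share of the degradation
    factor. *)
Let c (z : pt * pt) : R := (d%:R * (2 * L) + K) * (sq z)^-1.

Hypothesis gamma_local : forall y x s, A y -> A x -> 0 <= s <= T ->
  gamma u y x s = gamma U y x s.
Hypothesis gammaC : forall y x s, gamma U y x s = gamma U x y s.
Hypothesis gamma_le1 : forall y x s, `|gamma U y x s| <= 1.
Hypothesis mgam : forall s, 0 <= s <= T -> measurable_fun setT (gam s).
Hypothesis lip_gam : forall z, lipschitz_on T (gam ^~ z) (c z).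

Variable good : set R.
Hypotheses (mgood : measurable good) (good_T : good `<=` `[0, T]).
Hypothesis ae_good : {ae lebesgue_measure, forall s, 0 <= s <= T -> good s}.
Hypothesis strict_gam : forall t, good t ->
  {ae pm, forall z, exists l, strict_deriv `[0, T] (gam ^~ z) t l}.

Let V t x : pt := if x \in A then v t x else 0.
(** Some strict derivative where one exists, 0 elsewhere. The selection carries no measurability,
    which is recovered from difference quotients. *)
Let dgam (t : R) (z : pt * pt) : R :=
  xget 0 [set l | strict_deriv `[0, T] (gam ^~ z) t l].

Let dgamP t : good t ->
  {ae pm, forall z, strict_deriv `[0, T] (gam ^~ z) t (dgam t z)}.
Proof.
move=> Gt; apply: ae_imp (strict_gam Gt) => z [l ld].
exact: (@xgetI _ 0 [set l | strict_deriv `[0, T] (gam ^~ z) t l] l ld).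
Qed.

Let goodT t : good t -> 0 <= t <= T.
Proof. by move=> /good_T; rewrite /= in_itv. Qed.

Let sqV0 (z : pt * pt) : 0 <= (sq z)^-1.
Proof. by rewrite invr_ge0 sqrtr_ge0. Qed.

Let c0 z : 0 <= c z.
Proof. by rewrite mulr_ge0// addr_ge0// mulr_ge0// mulr_ge0. Qed.

Let AB x : A x -> forall i, `|x ord0 i| <= B.
Proof. by move=> /A_Omega; exact: OmegaB. Qed.

Let k0 z : 0 <= k z.
Proof. by apply: bond_kernel_ge0; [exact: eps0|exact: hJ]. Qed.

Let mk : measurable_fun setT k.
Proof. exact: (measurable_bond_kernel mA eps0 hJ). Qed.

Let ik : pm.-integrable setT (EFin \o k).
Proof. exact: (integrable_bond_kernel mA eps0 B0 AB hJ). Qed.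

Let ik_sqrt (x : R) : 0 <= x ->
  pm.-integrable setT (EFin \o (fun z => k z * (x * (sq z)^-1))).
Proof. exact: (integrable_bond_kernel_sqrt j mA eps0 B0 AB hJ). Qed.

Let rE s z : r s z = sq z * stretch (U s) z.
Proof. by []. Qed.

Let mr s : 0 <= s <= T -> measurable_fun setT (r s).
Proof. by move=> sT; apply: measurable_bond_r => i; exact: mU. Qed.

Let lip_r z : lipschitz_on T (r ^~ z) (c z).
Proof.
move=> p q pT qT; apply: (le_trans (lipschitz_bond_r z lip_U pT qT)).
by rewrite ler_wpM2r// /c ler_wpM2r// lerDl.
Qed.

Let rC s x y : r s (x, y) = r s (y, x).
Proof. exact: bond_rC. Qed.

Let kC x y : k (x, y) = k (y, x).
Proof.
rewrite /bond_kernel /nonlocal_kernel /= -/(bond_length (y, x)) -/(bond_length (x, y)).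
by rewrite bond_lengthC; ring.
Qed.

Let kernel_local x y : A x -> A y -> nonlocal_kernel Omega eps J y x = k (x, y).
Proof.
move=> Ax Ay; rewrite /bond_kernel /nonlocal_kernel !indicE /=.
by rewrite (mem_set Ax) (mem_set Ay) (mem_set (A_Omega Ay)) !mul1r.
Qed.

Let bond_r_local s x y : A x -> A y -> bond_r u s y x = r s (x, y).
Proof. by move=> Ax Ay; rewrite /r /bond_r /strain !UA. Qed.

Let ae_AA : {ae pm, forall z, Omega z.1 -> Omega z.2 -> A z.1 /\ A z.2}.
Proof.
apply: ae_imp2 (ae_fst mu ae_A) (ae_snd mu ae_A) => z H1 H2 O1 O2.
by split; [exact: H1|exact: H2].
Qed.

Let k_out z : ~ (Omega z.1 /\ Omega z.2) -> k z = 0.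
Proof.
by move=> nO; apply: bond_kernel_out => -[A1 A2]; apply: nO; split; exact: A_Omega.
Qed.

Let elasticE s : 0 <= s <= T ->
  elastic_energy Omega eps J g gamma u s = wenergy pm k r gam g s.
Proof.
move=> sT; have [G0 [G1 [G00 G10 gG0 _ lip_g]]] := bond_potential_bounds hg.
have mg : measurable_fun setT g.
  apply: continuous_measurable_fun => x; apply: derivable_continuous_at.
  exact: (potential_derivable hg).
apply: (@Rintegral_iterated _ _ _ _ _ _ _ _ _ _ _ (fun z => G0 * k z)).
- apply: measurable_ae_measurable; apply: measurable_funM.
    by apply: measurable_funM => //; exact: mgam.
  by apply: measurableT_comp => //; exact: mr.
- exact: (integrableZl measurableT G0 ik).
- apply: aeW => z _; rewrite normrM normrM (ger0_norm (k0 z)) mulrC.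
  by apply: ler_pM => //; [exact: mulr_ge0|apply: ler_piMr; rewrite ?k0 ?gamma_le1].
- by move=> z /k_out ->; rewrite mulr0.
- apply: ae_imp ae_AA => -[x y] /= H Ox Oy; have [Ax Ay] := H Ox Oy.
  by rewrite kernel_local// gamma_local// bond_r_local.
Qed.

(** The times 0 and [T] are discarded because [derive1] is two-sided and the path is controlled on
    [[0, T]] only. At interior good times it is the strict derivative for almost every bond. *)
Let fluxE : {ae lebesgue_measure, forall s : R, 0 <= s <= T ->
  \int[mu]_(x in Omega) \int[mu]_(y in Omega)
        (nonlocal_kernel Omega eps J y x * derive1 (gamma u y x) s
           * g (bond_r u s y x)) = wflux pm k r g s (dgam s)}.
Proof.
have [G0 [G1 [G00 G10 gG0 _ lip_g]]] := bond_potential_bounds hg.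
have mg : measurable_fun setT g.
  apply: continuous_measurable_fun => x; apply: derivable_continuous_at.
  exact: (potential_derivable hg).
have ikc : pm.-integrable setT (EFin \o (fun z => k z * c z)).
  by apply: ik_sqrt; rewrite addr_ge0// mulr_ge0// mulr_ge0.
apply: ae_imp2 (ae_imp2 (fun t h1 h2 => conj h1 h2) (ae_neq 0) (ae_neq T)) ae_good.
move=> s [s0 sT'] Gs sT; have {}Gs := Gs sT.
have nT : nbhs s `[0, T]%classic.
  apply: (@filterS _ _ (nbhs_filter s) `]0, T[%classic).
    by apply: subset_itv; rewrite bnd_simp.
  apply: open_nbhs_nbhs; split; first exact: interval_open.
  rewrite /= in_itv/=; move: sT => /andP[s0' sT].
  by rewrite !lt_neqAle eq_sym s0 s0' sT' sT.
apply: (@Rintegral_iterated _ _ _ _ _ _ _ _ _ _ _ (fun z => G0 * (k z * c z))).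
- exact: (ae_measurable_flux T0 mk mr mgam mg sT (dgamP Gs)).
- exact: (integrableZl measurableT G0 ikc).
- exact: (ae_flux_le r T0 k0 lip_gam gG0 sT (dgamP Gs)).
- by move=> z /k_out ->; rewrite mul0r mulr0.
- apply: ae_imp2 (dgamP Gs) ae_AA => -[x y] /= sd H Ox Oy; have [Ax Ay] := H Ox Oy.
  rewrite kernel_local// bond_r_local//; congr (_ * _ * _).
  apply: (strict_deriv_derive1 nT); apply: eq_strict_deriv sd => p.
  by rewrite /= in_itv/= => pT; rewrite gamma_local.
Qed.

Let v_meas t : 0 <= t <= T -> measurable_fun Omega (v t).
Proof. by move=> tT; have [[_ [Cv _] _ _ _] _ _ _ _] := hsol; have [] := Cv t tT. Qed.

Let v_fin t : 0 <= t <= T -> (Linf_norm Omega (v t) < +oo)%E.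
Proof. by move=> tT; have [[_ [Cv _] _ _ _] _ _ _ _] := hsol; have [] := Cv t tT. Qed.

Let a_meas t : 0 <= t <= T -> measurable_fun Omega (a t).
Proof. by move=> tT; have [[_ _ [Ca _] _ _] _ _ _ _] := hsol; have [] := Ca t tT. Qed.

Let a_fin t : 0 <= t <= T -> (Linf_norm Omega (a t) < +oo)%E.
Proof. by move=> tT; have [[_ _ [Ca _] _ _] _ _ _ _] := hsol; have [] := Ca t tT. Qed.

Let mV t i : 0 <= t <= T -> measurable_fun setT (fun x => V t x ord0 i).
Proof.
move=> tT; rewrite (_ : (fun x => _) = (fun x => v t x ord0 i) \_ A); last first.
  by apply/funext => x; rewrite /V patchE; case: ifP => // _; rewrite mxE.
apply/measurable_restrict => //; rewrite setTI.
apply: (@measurable_funS _ _ _ _ Omega) => //.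
exact: (measurableT_comp (measurable_coord_rV i) (v_meas tT)).
Qed.

Let strict_r t : 0 <= t <= T ->
  {ae pm, forall z, strict_deriv `[0, T] (r ^~ z) t (sq z * stretch (V t) z)}.
Proof.
move=> tT; have [[_ [_ cv] _ uv _] traj _ _ _] := hsol.
apply: ae_imp (ae_strict_deriv_stretch T0 uv cv traj A_Omega UA UNA tT) => z sd.
by apply: (eq_strict_deriv (fun p _ => rE p z)); exact: strict_derivZ.
Qed.

(* The bonds (x, y) and (y, x) carry opposite forces. *)
Let power t : 0 <= t <= T ->
  \int[mu]_(x in Omega) dotr (force Omega eps J g gamma u t x) (v t x) =
  \int[pm]_z (k z * gam t z * (derive1 g (r t z) * (sq z * stretch (V t) z))).
Proof.
move=> tT; have [G0 [G1 [_ G10 _ g'G1 _]]] := bond_potential_bounds hg.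
have mg' : measurable_fun setT (derive1 g).
  apply: continuous_measurable_fun => x; apply: derivable_continuous_at.
  exact: (potential_derivable2 hg).
have [Kv Kv0 vK] := Linf_norm_fin (v_fin tT).
have VK : {ae mu, forall x, forall i, `|V t x ord0 i| <= Kv}.
  apply: ae_imp vK => x H i; rewrite /V; have [/set_mem Ax|_] := boolP (x \in A).
    by apply: H; exact: A_Omega.
  by rewrite mxE normr0.
(* Half the integrand of coordinate [i] of [force], without the outer sign; [H] is its power against
   the velocity at the first end point. *)
pose F i z := k z * (sq z)^-1 * gam t z * derive1 g (r t z) * bond_dir z.2 z.1 ord0 i.
pose H z := \sum_i F i z * V t z.1 ord0 i.
pose Gb z := G1 * (k z * (1 * (sq z)^-1)).
have iGb : pm.-integrable setT (EFin \o Gb).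
  exact: (integrableZl measurableT G1 (ik_sqrt ler01)).
have ksq z : 0 <= k z * (sq z)^-1 by apply: mulr_ge0; [exact: k0|exact: sqV0].
have Gb0 z : 0 <= Gb z by rewrite /Gb mul1r; exact: mulr_ge0.
have FG i z : `|F i z| <= Gb z.
  rewrite /F /Gb mul1r 4!normrM (ger0_norm (k0 z)) (ger0_norm (sqV0 z)) -[leRHS]mulr1.
  apply: ler_pM; rewrite ?normr_ge0//; last exact: bond_dir_le1.
    by apply: mulr_ge0 => //; exact: mulr_ge0.
  rewrite mulrC; apply: ler_pM; rewrite ?normr_ge0//; first exact: mulr_ge0.
  by apply: ler_piMr; [exact: ksq|exact: gamma_le1].
have mF i : measurable_fun setT (F i).
  apply: measurable_funM; last exact: measurable_bond_dir.
  apply: measurable_funM; last by apply: (measurableT_comp mg'); exact: mr.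
  apply: measurable_funM; last exact: mgam.
  apply: measurable_funM => //; apply: (measurableT_comp measurable_invr).
  exact: (measurableT_comp measurable_sqrtr measurable_bond_length).
have iF i : pm.-integrable setT (EFin \o F i).
  by apply: (ae_le_integrable measurableT (mF i) iGb); apply: aeW => z _; exact: FG.
have mH : measurable_fun setT H.
  apply: measurable_sum => i; apply: measurable_funM => //.
  exact: (measurableT_comp (mV i tT) measurable_fst).
pose GH z := (\sum_(i < d) Kv) * Gb z.
have iGH : pm.-integrable setT (EFin \o GH).
  exact: (integrableZl measurableT _ iGb).
have HG (z : pt * pt) (W : 'I_d -> R) : (forall i, `|W i| <= Kv) ->
    `|\sum_i F i z * W i| <= GH z.
  move=> WK; apply: le_trans (ler_norm_sum _ _ _) _; rewrite /GH mulr_suml.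
  apply: ler_sum => i _; rewrite normrM mulrC; apply: ler_pM => //; exact: FG.
have aeH : {ae pm, forall z, setT z -> `|H z| <= GH z}.
  by apply: ae_imp (ae_fst mu VK) => z Vz _; exact: HG.
have iH : pm.-integrable setT (EFin \o H).
  exact: (ae_le_integrable measurableT mH iGH aeH).
have Fswap i x y : F i (y, x) = - F i (x, y).
  rewrite /F kC rC bond_lengthC /gam /= (gammaC x y).
  by rewrite bond_dirC; ring.
have Hswap z : H (z.2, z.1) = - \sum_i F i z * V t z.2 ord0 i.
  case: z => x y; rewrite /H /= -sumrN; apply: eq_bigr => i _.
  by rewrite Fswap mulNr.
have mswap : measurable_fun setT (fun z : pt * pt => (z.2, z.1)).
  by apply/measurable_fun_pairP; split; [exact: measurable_snd|exact: measurable_fst].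
have iHs : pm.-integrable setT (EFin \o (fun z => H (z.2, z.1))).
  apply: (ae_le_integrable measurableT _ iGH).
    exact: (measurableT_comp mH mswap).
  apply: ae_imp (ae_snd mu VK) => z Vz _.
  by rewrite Hswap normrN; exact: HG.
have -> : \int[pm]_z (k z * gam t z * (derive1 g (r t z) * (sq z * stretch (V t) z))) =
    \int[pm]_z (- (2 * H z)).
  (* The stretch of [V] involves [V y - V x]: the part with [V y] is [- H] at the reversed bond, and
     exchanging end points makes it a second copy of the part with [V x]. *)
  transitivity (\int[pm]_z (- H (z.2, z.1) - H z)).
    apply: eq_Rintegral => z _; rewrite Hswap opprK stretchE mulr_sumr !mulr_sumr.
    rewrite /H -sumrB; apply: eq_bigr => i _.
    rewrite /F -sqrt_bond_lengthV; ring.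
  have iN (f : pt * pt -> R) : pm.-integrable setT (EFin \o f) ->
      pm.-integrable setT (EFin \o (fun z => - f z)).
    move=> fi; have := integrableZl measurableT (-1) fi.
    congr (is_true (_.-integrable _ _)); apply/funext => z /=.
    by rewrite -EFinM mulN1r.
  have RN (f : pt * pt -> R) : pm.-integrable setT (EFin \o f) ->
      \int[pm]_z (- f z) = - \int[pm]_z f z.
    by move=> fi; rewrite -mulN1r -RintegralZl//; apply: eq_Rintegral => z _; rewrite mulN1r.
  rewrite RintegralB//; last exact: iN.
  rewrite RN// Rintegral_swap// RN; last exact: (integrableZl measurableT 2 iH).
  by rewrite RintegralZl//; ring.
have outer : {ae mu, forall x, Omega x ->
    dotr (force Omega eps J g gamma u t x) (v t x) =
    \int[mu]_(y in Omega) (- (2 * H (x, y)))}.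
  (* [force] integrates each coordinate separately; recombining them under one integral uses
     integrable sections of every [F i], available for almost every [x]. *)
  have sec : {ae mu, forall x, forall i, mu.-integrable setT
      (EFin \o (fun y => F i (x, y)))}.
    by apply: ae_forall_countable => i; exact: (integrable_section (iF i)).
  apply: ae_imp2 ae_A sec => x Ax Fx Ox; have {}Ax := Ax Ox.
  have Fi i : mu.-integrable Omega (EFin \o (fun y => F i (x, y))).
    by apply: integrableS (Fx i).
  have FZ i (w : R) : mu.-integrable Omega (EFin \o (fun y => w * F i (x, y))).
    exact: (integrableZl mOmega w (Fi i)).
  transitivity (\int[mu]_(y in Omega) \sum_i (- 2 * v t x ord0 i) * F i (x, y)); last first.
    apply: eq_Rintegral => y _; rewrite /H /= mulr_sumr -sumrN; apply: eq_bigr => i _.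
    by rewrite /V mem_set//; ring.
  rewrite Rintegral_sum//; apply: eq_bigr => i _.
  rewrite RintegralZl// !mxE.
  have -> : \int[mu]_(y in Omega)
      (2 * nonlocal_kernel Omega eps J y x / Num.sqrt (enorm (y - x)) * gamma u y x t
         * derive1 g (bond_r u t y x) * bond_dir y x ord0 i) =
      \int[mu]_(y in Omega) (2 * F i (x, y)).
    apply: ae_eq_Rintegral; apply: ae_imp ae_A => y Ay Oy; have {}Ay := Ay Oy.
    rewrite kernel_local// gamma_local// bond_r_local// /F /=.
    by rewrite /bond_length /gam /=; ring.
  by rewrite RintegralZl//; ring.
rewrite (ae_eq_Rintegral outer).
apply: (@Rintegral_iterated _ _ _ _ _ _ _ _ _ (fun x y => - (2 * H (x, y))) _
  (fun z => 2 * GH z)).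
- apply: measurable_ae_measurable; apply: measurable_funN; exact: measurable_funM.
- exact: (integrableZl measurableT 2 iGH).
- by apply: ae_imp aeH => z Hz _; rewrite normrN normrM ger0_norm// ler_wpM2l// Hz.
- by move=> z /k_out kz; rewrite /GH /Gb kz mul0r !mulr0.
- by apply: aeW => -[x y].
Qed.

Lemma energy_balance_good t : good t ->
  energy_rate_balance Omega eps J g gamma rho T b u v t.
Proof.
move=> Gt; have tT := goodT Gt.
have [[_ [_ cv] [_ ca] _ va] _ eqn _ _] := hsol.
have [G0 [G1 [G00 G10 gG0 _ lip_g]]] := bond_potential_bounds hg.
have mg : measurable_fun setT g.
  apply: continuous_measurable_fun => x; apply: derivable_continuous_at.
  exact: (potential_derivable hg).
have ikc : pm.-integrable setT (EFin \o (fun z => k z * c z)).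
  by apply: ik_sqrt; rewrite addr_ge0// mulr_ge0// mulr_ge0.
have gam1 s z : `|gam s z| <= 1 by exact: gamma_le1.
have finO : (mu Omega < +oo)%E by exact: (finite_box_measure mOmega B0 OmegaB).
have dK := kinetic_rate T0 mOmega finO va v_meas v_fin a_fin cv ca tT.
have dE := wenergy_rate k0 c0 mk ik ikc mr mgam lip_r lip_gam gam1 G00 G10 gG0
  mg lip_g (bond_potential_strict_deriv hg) tT (dgamP Gt) (strict_r tT).
have dD := wdamage_rate T0 k0 c0 mk ikc mr mgam lip_r lip_gam G10 gG0 mg lip_g
  mgood good_T ae_good dgamP fluxE Gt.
exists (\int[mu]_(x in Omega) (rho * dotr (a t x) (v t x))), (wflux pm k r g t (dgam t) +
  \int[pm]_z (k z * gam t z * (derive1 g (r t z) * (sq z * stretch (V t) z)))),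
  (- wflux pm k r g t (dgam t)); split => //.
  exact: (eq_is_derivative_on tT elasticE dE).
rewrite -power// addrA addrAC addrK.
have iav := integrable_dotr mOmega finO (a_meas tT) (a_fin tT) (v_meas tT) (v_fin tT).
have [Cb _] := hb; have [b_meas b_fin _] := Cb t tT.
have ibv := integrable_dotr mOmega finO b_meas b_fin (v_meas tT) (v_fin tT).
have irav : mu.-integrable Omega (EFin \o (fun x => rho * dotr (a t x) (v t x))).
  exact: (integrableZl mOmega rho iav).
have -> : \int[mu]_(x in Omega) dotr (force Omega eps J g gamma u t x) (v t x) =
    \int[mu]_(x in Omega) (dotr (b t x) (v t x) - rho * dotr (a t x) (v t x)).
  apply: ae_eq_Rintegral; apply: ae_imp (eqn t tT) => x H Ox.
  rewrite -H// /dotr mulr_sumr -sumrB; apply: eq_bigr => i _.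
  by rewrite !mxE; ring.
by rewrite RintegralB// addrC subrK.
Qed.

End energy_balance.

(** Lets [ae_no_plateau_end] apply to the space of bonds, which is itself a product. *)
Lemma sigma_finite_product d1 d2 (T1 : measurableType d1) (T2 : measurableType d2)
    (R : realType) (m1 : {sigma_finite_measure set T1 -> \bar R})
    (m2 : {sigma_finite_measure set T2 -> \bar R}) :
  sigma_finite setT (m1 \x m2)%E.
Proof.
have /sigma_finiteP[F [FT ndF Foo]] := sigma_finiteT m1.
have /sigma_finiteP[G [GT ndG Goo]] := sigma_finiteT m2.
exists (fun n => F n `*` G n) => [|n].
  rewrite predeqE => -[x y]; split => // _.
  have [i _ Fx] : (\bigcup_i F i) x by rewrite -FT.
  have [j _ Gy] : (\bigcup_i G i) y by rewrite -GT.
  exists (maxn i j) => //; split.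
    exact: (subsetPset _ _ (ndF _ _ (leq_maxl i j))).
  exact: (subsetPset _ _ (ndG _ _ (leq_maxr i j))).
have [mF Fn] := Foo n; have [mG Gn] := Goo n.
split; first exact: measurableX.
by rewrite product_measure1E// lte_mul_pinfty// ge0_fin_numE.
Qed.

(** * Degradation factors *)

Section degradation.
Context {R : realType} {d : nat}.
Local Notation mu := (@lebesgue_rV R d).
Local Notation pt := 'rV[R]_d.
Local Notation pm := (mu \x mu)%E.
Local Notation vfield := (pt -> pt).

Lemma strain_local (u U : R -> vfield) s (y x : pt) :
  u s y = U s y -> u s x = U s x -> strain u s y x = strain U s y x.
Proof. by rewrite /strain => -> ->. Qed.

Lemma gamma_a_local h rp (u U : R -> vfield) (y x : pt) t :
  (forall s, u s y = U s y) -> (forall s, u s x = U s x) ->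
  gamma_a h rp u y x t = gamma_a h rp U y x t.
Proof.
move=> uy ux; congr (h _); apply: eq_Rintegral => s _.
by rewrite /bond_r (@strain_local u U).
Qed.

Lemma gamma_b_local h (u U : R -> vfield) (y x : pt) t :
  (forall s, u s y = U s y) -> (forall s, u s x = U s x) ->
  gamma_b h u y x t = gamma_b h U y x t.
Proof.
move=> uy ux; rewrite /gamma_b /max_strain.
have -> // : (fun s => strain u s y x) = (fun s => strain U s y x).
by apply/funext => s; exact: strain_local.
Qed.

Lemma gamma_aC h rp (U : R -> vfield) (y x : pt) t :
  gamma_a h rp U y x t = gamma_a h rp U x y t.
Proof. by congr (h _); apply: eq_Rintegral => s _; rewrite bond_rC. Qed.

Lemma gamma_bC h (U : R -> vfield) (y x : pt) t :
  gamma_b h U y x t = gamma_b h U x y t.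
Proof.
rewrite /gamma_b /max_strain -[enorm (y - x)]/(bond_length (x, y)) bond_lengthC.
have -> // : (fun s => strain U s y x) = (fun s => strain U s x y).
by apply/funext => s; exact: strainC.
Qed.

Variables (T L C : R) (U : R -> vfield).
Hypotheses (T0 : 0 < T) (L0 : 0 <= L) (C0 : 0 <= C).
Hypothesis mU : forall t : R, 0 <= t <= T -> forall i,
  measurable_fun setT (fun x => U t x ord0 i).
Hypothesis lip_U : forall x i, lipschitz_on T (fun t => U t x ord0 i) L.
Hypothesis UC : forall (t : R) x i, 0 <= t <= T -> `|U t x ord0 i| <= C.

Local Notation sq z := (Num.sqrt (bond_length z)).

Let sqV0 (z : pt * pt) : 0 <= (sq z)^-1.
Proof. by rewrite invr_ge0 sqrtr_ge0. Qed.

Section gamma_a.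
Variables (h : R -> R) (rp H : R).
Hypotheses (rp0 : 0 <= rp) (hs : smooth h) (H0 : 0 <= H).
Hypothesis lip_h : forall x y, `|h x - h y| <= H * `|x - y|.

Let f (s : R) (z : pt * pt) := Num.max (bond_r U s z.2 z.1 - rp) 0.
Let c1 (z : pt * pt) : R := d%:R * (2 * L) * (sq z)^-1.
Let c2 (z : pt * pt) : R := d%:R * (2 * C) * (sq z)^-1.

Let c1_ge0 z : 0 <= c1 z.
Proof. by rewrite mulr_ge0// mulr_ge0// mulr_ge0. Qed.

Let c2_ge0 z : 0 <= c2 z.
Proof. by rewrite mulr_ge0// mulr_ge0// mulr_ge0. Qed.

Let mf s : 0 <= s <= T -> measurable_fun setT (f s).
Proof.
move=> sT; apply: measurable_maxr; last exact: measurable_cst.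
by apply: measurable_funB; [apply: measurable_bond_r => i; exact: mU|exact: measurable_cst].
Qed.

Let lip_f z : lipschitz_on T (f ^~ z) (c1 z).
Proof.
move=> p q pT qT; apply: le_trans (lipschitz_bond_r z lip_U pT qT).
rewrite /f; move: (bond_r U p _ _) (bond_r U q _ _) => x y.
rewrite /Num.max; case: (ltP (x - rp) 0) => xp; case: (ltP (y - rp) 0) => yp;
  by do 2 case: ger0P => ?; lra.
Qed.

(** Since [rp >= 0], the excess over [rp] is at most [|r|]. *)
Let f_le z s : 0 <= s <= T -> `|f s z| <= c2 z.
Proof.
move=> sT; have := @bond_r_le _ _ U s z C (fun x i => UC x i sT).
rewrite -/(c2 z) /f; move: (bond_r U s _ _) (c2 z) (c2_ge0 z) => x y.
move=> c0 xc; rewrite /Num.max; case: ltP => xp; first by rewrite normr0.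
by move: xc rp0; rewrite !ler_norml => /andP[? ?] ?; apply/andP; split; lra.
Qed.

(** A primitive has the bound of its integrand as Lipschitz constant, hence the size [C] of the
    displacement instead of its Lipschitz constant [L]. *)
Lemma lipschitz_gamma_a z : lipschitz_on T (fun s => gamma_a h rp U z.2 z.1 s)
  (H * (d%:R * (2 * C)) * (sq z)^-1).
Proof.
move=> p q pT qT; apply: (le_trans (lip_h _ _)).
rewrite -!mulrA ler_wpM2l//; rewrite !mulrA.
apply: le_trans (lipschitz_integral T0 (c1_ge0 z) (c2_ge0 z) (lip_f z) (f_le z) pT qT) _.
by rewrite /c2 !mulrA.
Qed.

Lemma measurable_gamma_a s : 0 <= s <= T ->
  measurable_fun setT (fun z : pt * pt => gamma_a h rp U z.2 z.1 s).
Proof.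
move=> sT; have mh : measurable_fun setT h.
  by apply: continuous_measurable_fun => x; exact: derivable_continuous_at (@hs 0%N x).
apply: (measurableT_comp mh).
apply: (measurable_primitive T0 c1_ge0 mf lip_f sT) => t z.
by rewrite /f le_max lexx orbT.
Qed.

(** The excess is Lipschitz in time, so its primitive is strictly differentiable at each time,
    without exceptional bonds. *)
Lemma strict_deriv_gamma_a z t : 0 <= t <= T ->
  exists l, strict_deriv `[0, T] (fun s => gamma_a h rp U z.2 z.1 s) t l.
Proof.
move=> tT; eexists.
apply: strict_deriv_comp (smooth_strict_deriv hs _); first by rewrite /= in_itv.
exact: (strict_deriv_integral T0 (c1_ge0 z) (lip_f z) (f_le z) tT).
Qed.

End gamma_a.

Section gamma_b.
Variables (h : R -> R) (H : R).
Hypotheses (hs : smooth h) (H0 : 0 <= H).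
Hypothesis lip_h : forall x y, `|h x - h y| <= H * `|x - y|.

Let f (s : R) (z : pt * pt) := stretch (U s) z.
Let c (z : pt * pt) : R := d%:R * (2 * L) * (bond_length z)^-1.

Let c_ge0 z : 0 <= c z.
Proof. by rewrite mulr_ge0 ?invr_ge0 ?bond_length_ge0// mulr_ge0// mulr_ge0. Qed.

Let mf s : 0 <= s <= T -> measurable_fun setT (f s).
Proof. by move=> sT; apply: measurable_stretch => i; exact: mU. Qed.

Let lip_f z : lipschitz_on T (f ^~ z) (c z).
Proof. exact: lipschitz_stretch. Qed.

Let gamma_bE z s : gamma_b h U z.2 z.1 s = h (sq z * running_max (f ^~ z) s).
Proof. by []. Qed.

(** The running maximum keeps the Lipschitz constant of the strain, of order [1 / |y - x|]; the
    weight [sqrt |y - x|] inside [h] brings the exponent back to -1/2. *)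
Lemma lipschitz_gamma_b z : lipschitz_on T (fun s => gamma_b h U z.2 z.1 s)
  (H * (d%:R * (2 * L)) * (sq z)^-1).
Proof.
move=> p q pT qT; rewrite !gamma_bE; apply: (le_trans (lip_h _ _)).
rewrite -mulrBr normrM (ger0_norm (sqrtr_ge0 _)) -sqrt_bond_lengthV.
rewrite -!mulrA ler_wpM2l//.
rewrite (_ : _ * (_ * _) = sq z * (c z * `|p - q|)); last by rewrite /c; ring.
rewrite ler_wpM2l ?sqrtr_ge0//.
exact: (lipschitz_running_max (c_ge0 z) (lip_f z)).
Qed.

Lemma measurable_gamma_b s : 0 <= s <= T ->
  measurable_fun setT (fun z : pt * pt => gamma_b h U z.2 z.1 s).
Proof.
move=> sT; have mh : measurable_fun setT h.
  by apply: continuous_measurable_fun => x; exact: derivable_continuous_at (@hs 0%N x).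
have mmax : measurable_fun setT (fun z : pt * pt => sq z * running_max (f ^~ z) s).
  apply: measurable_funM; last exact: (measurable_running_max c_ge0 mf lip_f sT).
  exact: (measurableT_comp measurable_sqrtr measurable_bond_length).
exact: (measurableT_comp mh mmax).
Qed.

Lemma strict_deriv_gamma_b z t l : 0 <= t <= T ->
  ~ plateau_end T (fun s => stretch (U s) z) t ->
  strict_deriv `[0, T] (fun s => stretch (U s) z) t l ->
  exists l, strict_deriv `[0, T] (fun s => gamma_b h U z.2 z.1 s) t l.
Proof.
move=> tT noplat sd.
have [m sm] := strict_deriv_running_max (c_ge0 z) (lip_f z) tT noplat sd.
eexists; apply: strict_deriv_comp (strict_derivZ (sq z) sm) (smooth_strict_deriv hs _).
by rewrite /= in_itv.
Qed.

Lemma ae_no_plateau_end_stretch : {ae lebesgue_measure, forall t : R, 0 <= t <= T ->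
  {ae pm, forall z, ~ plateau_end T (fun s => stretch (U s) z) t}}.
Proof.
pose pm' : {sigma_finite_measure set _ -> \bar R} :=
  HB.pack pm (Measure_isSigmaFinite.Build _ _ _ pm (sigma_finite_product mu mu)).
exact: (@ae_no_plateau_end _ _ _ _ T0 f c c_ge0 mf lip_f pm'). Qed.

End gamma_b.
End degradation.

Theorem mainTheorem2 (R : realType) (d : nat) (hd : d = 2%N \/ d = 3%N)
    (Omega : set 'rV[R]_d) (hOmega : bounded_domain Omega)
    (T eps rho : R) (hT : 0 < T) (heps : 0 < eps) (hrho : 0 < rho)
    (J : R -> R) (M : R) (hJ : influence_function J M)
    (g : R -> R) (rm re rc rp Cm Cp : R)
    (hg : bond_potential g rm re rc rp Cm Cp)
    (u0 v0 : 'rV[R]_d -> 'rV[R]_d)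
    (hu0 : space_X Omega u0) (hv0 : space_X Omega v0)
    (b : R -> 'rV[R]_d -> 'rV[R]_d) (hb : C0_X Omega T b) :
  (forall (h : R -> R) (xD : R), damage_profile_a h xD ->
     forall u v a : R -> 'rV[R]_d -> 'rV[R]_d,
     solution Omega eps J g (gamma_a h rp) rho T b u0 v0 u v a ->
     forall t : R, 0 <= t <= T ->
     energy_rate_balance Omega eps J g (gamma_a h rp) rho T b u v t)
  /\
  (forall (h : R -> R) (rD : R), damage_profile_b h rp rD ->
     forall u v a : R -> 'rV[R]_d -> 'rV[R]_d,
     solution Omega eps J g (gamma_b h) rho T b u0 v0 u v a ->
     {ae lebesgue_measure, forall t : R, 0 <= t <= T ->
        energy_rate_balance Omega eps J g (gamma_b h) rho T b u v t}).
Proof.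
have d_gt0 : (0 < d)%N by case: hd => ->.
(* The coordinate along which short bonds are sliced; any one will do. *)
have j := Ordinal d_gt0.
have [_ oOmega _ bOmega] := hOmega.
have mOmega := open_measurable_rV oOmega.
have [B B0 OmegaB] := bounded_rV_coord bOmega.
have dC0 (x : R) : 0 <= x -> 0 <= d%:R * (2 * x) by move=> x0; rewrite !mulr_ge0.
split=> h xD hh u v a hsol.
  have [[[Xu _] [Xv cv] _ uv _] traj _ _ _] := hsol.
  have [A [U [L [C [[mA A_Omega ae_A UA UNA] [L0 C0 mU lip_U UC]]]]]] :=
    regular_representative hT uv (fun t tT => let: And3 _ H _ := Xv t tT in H) cv traj
      mOmega (fun t tT => let: And3 _ H _ := Xu t tT in H)
      (fun t tT => let: And3 H _ _ := Xu t tT in H).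
  have [H H0 lip_h] := damage_profile_a_lipschitz hh.
  have hs := profile_a_smooth hh.
  have rp0 : 0 <= rp by have [_ [_ [rc0 rcp]]] := potential_order hg; lra.
  move=> t tT.
  apply: (energy_balance_good j mOmega B0 OmegaB hT heps hJ hg hb hsol mA A_Omega ae_A
    UA UNA L0 (mulr_ge0 H0 (dC0 C C0)) mU lip_U
    _ _ _ _ _ (good := `[0, T]%classic)) => //.
  - by move=> y x s Ay Ax _; apply: gamma_a_local => tau; rewrite UA.
  - by move=> y x s; exact: gamma_aC.
  - by move=> y x s; exact: (damage_profile_a_le1 hh).
  - by move=> s sT; exact: (measurable_gamma_a hT L0 mU lip_U rp hs sT).
  - move=> z p q pT qT.
    apply: le_trans (lipschitz_gamma_a hT L0 C0 lip_U UC rp0 H0 lip_h z pT qT) _.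
    by rewrite ler_wpM2r// ler_wpM2r ?invr_ge0 ?sqrtr_ge0// lerDr dC0.
  - by apply: aeW => s sT; rewrite /= in_itv.
  - move=> s; rewrite /= in_itv/= => sT; apply: aeW => z.
    exact: (strict_deriv_gamma_a hT L0 C0 lip_U UC rp0 hs z sT).
have [[[Xu _] [Xv cv] _ uv _] traj _ _ _] := hsol.
have [A [U [L [C [[mA A_Omega ae_A UA UNA] [L0 C0 mU lip_U UC]]]]]] :=
  regular_representative hT uv (fun t tT => let: And3 _ H _ := Xv t tT in H) cv traj
    mOmega (fun t tT => let: And3 _ H _ := Xu t tT in H)
    (fun t tT => let: And3 H _ _ := Xu t tT in H).
have [H H0 lip_h] := damage_profile_b_lipschitz hh.
have hs := profile_b_smooth hh.
have [N [mN N0 badN]] := ae_no_plateau_end_stretch hT L0 mU lip_U.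
(* The good set has to be measurable, so a measurable null set [N] containing the bad times is
   removed. *)
pose good := `[0, T]%classic `\` N.
have ae_good : {ae lebesgue_measure, forall s : R, 0 <= s <= T -> good s}.
  exists N; split => // s /= bad; apply: contrapT => Ns; apply: bad => sT.
  by split => //=; rewrite in_itv.
apply: (ae_imp _ ae_good) => t + tT => /(_ tT).
apply: (energy_balance_good j mOmega B0 OmegaB hT heps hJ hg hb hsol mA A_Omega ae_A
  UA UNA L0 (mulr_ge0 H0 (dC0 L L0)) mU lip_U) => //.
- by move=> y x s Ay Ax _; apply: gamma_b_local => tau; rewrite UA.
- by move=> y x s; exact: gamma_bC.
- by move=> y x s; exact: (damage_profile_b_le1 hh).
- by move=> s sT; exact: (measurable_gamma_b L0 mU lip_U hs sT).
- move=> z p q pT qT.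
  apply: le_trans (lipschitz_gamma_b L0 lip_U H0 lip_h z pT qT) _.
  by rewrite ler_wpM2r// ler_wpM2r ?invr_ge0 ?sqrtr_ge0// lerDr dC0.
- exact: measurableD.
- by move=> s [].
- move=> s [/=]; rewrite in_itv/= => sT Ns.
  have noplat : {ae (lebesgue_rV d \x lebesgue_rV d)%E, forall z,
      ~ plateau_end T (fun s => stretch (U s) z) s}.
    by apply: contrapT => bad; apply: Ns; apply: badN => /= /(_ sT).
  apply: ae_imp2 noplat (ae_strict_deriv_stretch hT uv cv traj A_Omega UA UNA sT) => z.
  exact: (strict_deriv_gamma_b L0 lip_U hs sT).
Qed.
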